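(* Assume the $\tau$-periodic system described in the context is exponentially stable and $\mathcal{P}\in\mathcal{L}(U,Y)$ is surjective. Choose $$Z=Y=L^2(0,\tau;Y_0),\qquad G_1=I\in\mathcal{L}(Z),$$ let $G_2\in\mathcal{L}(Y,Z)$ be boundedly invertible, and let $K=\varepsilon K_0$ where $K_0\in\mathcal{L}(Y,U)$ is such that $\sigma(G_2\mathcal{P}K_0)\subset\mathbb{C}_-$. Then there exists $\varepsilon^*>0$ such that for every $0<\varepsilon\le\varepsilon^*$ the infinite-dimensional dynamic feedback controller with parameters $(G_1,G_2,K)$ solves the robust output regulation problem (as defined in the context).
   Context: Let $\tau>0$, let $X$ be a Banach space (the state space) and let $U_0$, $U_{d0}$, $Y_0$ be Hilbert spaces. Denote $U=L^2(0,\tau;U_0)$, $U_d=L^2(0,\tau;U_{d0})$, $Y=L^2(0,\tau;Y_0)$, and $\mathbb{C}_-=\{\lambda\in\mathbb{C}:\operatorname{Re}\lambda<0\}$. Consider the system $$\dot x(t)=A(t)x(t)+B(t)u(t)+B_d(t)w_{dist}(t),\quad x(0)=x_0\in X,\qquad y(t)=C(t)x(t)+D(t)u(t),$$ where $A(\cdot),B(\cdot),B_d(\cdot),C(\cdot),D(\cdot)$ are $\tau$-periodic operator-valued functions with $B\in L^\infty(\mathbb{R},\mathcal{L}(U_0,X))$, $B_d\in L^\infty(\mathbb{R},\mathcal{L}(U_{d0},X))$, $C\in L^\infty(\mathbb{R},\mathcal{L}(X,Y_0))$, $D\in L^\infty(\mathbb{R},\mathcal{L}(U_0,Y_0))$.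 It is assumed that $A(\cdot)$ determines a strongly continuous evolution family $(U_A(t,s))_{t\ge s}\subset\mathcal{L}(X)$: $U_A(t,t)=I$, $U_A(t,r)U_A(r,s)=U_A(t,s)$ for $t\ge r\ge s$, $(t,s)\mapsto U_A(t,s)x$ is continuous for every $x\in X$, and $U_A(t+\tau,s+\tau)=U_A(t,s)$ by periodicity. The state of the system is the mild state $$x(t)=U_A(t,0)x_0+\int_0^tU_A(t,s)\big(B(s)u(s)+B_d(s)w_{dist}(s)\big)ds.$$ The system is exponentially stable if there exist $M,\omega>0$ such that $\|U_A(t,s)\|\le Me^{-\omega(t-s)}$ for all $t\ge s$; in this case $I-U_A(\tau,0)$ is boundedly invertible. Denote $G_A(t,s)=U_A(t,0)(I-U_A(\tau,0))^{-1}U_A(\tau,s)$. The operator $\mathcal{P}\in\mathcal{L}(U,Y)$ is defined for $t\in[0,\tau]$ by $$(\mathcal{P}u)(t)=C(t)\int_0^\tau G_A(t,s)B(s)u(s)ds+C(t)\int_0^tU_A(t,s)B(s)u(s)ds+D(t)u(t).$$ Signals: $y_{ref}\in L^2_{loc}(0,\infty;Y_0)$ is $\tau$-periodic, and $w_{dist}=\sum_{k=1}^qv_kw_{dist}^k$ with $\tau$-periodic $w_{dist}^k\in L^2_{loc}(0,\infty;U_{d0})$ and unknown coefficient vector $v_{cf}=(v_1,\ldots,v_q)^T\in\mathbb{C}^q$. Dynamic feedback controller: for a Banach space $Z$, $G_1\in\mathcal{L}(Z)$, $G_2\in\mathcal{L}(Y,Z)$, $K\in\mathcal{L}(Z,U)$,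 the controller is $$z_{n+1}=G_1z_n+G_2\big(y(n\tau+\cdot)-y_{ref}(\cdot)\big),\quad z_0\in Z,\qquad u(n\tau+\cdot)=Kz_n\ \text{ on } [0,\tau),\quad n\ge0.$$ The closed-loop system is called exponentially stable if there exist $M_0,M_1,\alpha_0,\alpha_1>0$ such that in the case $y_{ref}\equiv0$, $w_{dist}\equiv0$ one has $\|x(t)\|\le M_0e^{-\alpha_0t}(\|x_0\|+\|z_0\|)$ and $\|z_n\|\le M_1e^{-\alpha_1n}(\|x_0\|+\|z_0\|)$ for all $t\ge0$, $n\ge0$, $x_0\in X$, $z_0\in Z$. The controller solves the robust output regulation problem if: (1) the closed-loop system is exponentially stable; (2) for some $M,\alpha>0$ and for all $x_0\in X$, $z_0\in Z$ and $v_{cf}\in\mathbb{C}^q$, $$\int_{n\tau}^{(n+1)\tau}\|y(t)-y_{ref}(t)\|^2dt\le M^2e^{-2\alpha n}\left(\|x_0\|^2+\|z_0\|^2+\|v_{cf}\|^2+1\right)\quad\text{for all } n\ge0;$$ (3) if $y_{ref}$ and $w_{dist}$ are changed to arbitrary $\tau$-periodic signals $\tilde y_{ref}\in L^2_{loc}(0,\infty;Y_0)$ and $\tilde w_{dist}\in L^2_{loc}(0,\infty;U_{d0})$ (again written as $\tilde w_{dist}=\sum_{k=1}^qv_k\tilde w_{dist}^k$ with $\tau$-periodic $\tilde w_{dist}^k$), and if the parameters $(A(t),B(t),B_d(t),C(t),D(t))$ are perturbed to $(\tilde A(t),\tilde B(t),\tilde B_d(t),\tilde C(t),\tilde D(t))$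 in such a way that the exponential closed-loop stability is preserved, then property (2) continues to hold for some constants $M,\alpha>0$. Perturbed parameters are assumed to be $\tau$-periodic and to satisfy the same boundedness assumptions and the same assumption on the existence of an evolution family as the nominal ones. *)

(* Defs.v *)
From HB Require Import structures.
From mathcomp Require Import all_boot all_order all_algebra.
From mathcomp Require Import sesquilinear ring.
From mathcomp Require Import complex.
From mathcomp Require Import all_classical all_reals all_analysis.
From mathcomp Require Import measurable_realfun.

Set Implicit Arguments.
Unset Strict Implicit.
Unset Printing Implicit Defensive.
Import Order.TTheory GRing.Theory Num.Theory.
Import numFieldNormedType.Exports.
Local Open Scope classical_set_scope.
Local Open Scope ring_scope.
Local Open Scope complex_scope.

(* On a normed module over R[i] the library norm takes values in R[i]; rnorm is
   the same norm, read in R (see rnormE). *)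
Definition rnorm (R : realType) (V : normedModType R[i]) (x : V) : R :=
  complex.Re `|x|.

Section rnorm_theory.
Context {R : realType} {V : normedModType R[i]}.
Implicit Types x y : V.

Lemma rnormE x : (rnorm x)%:C = `|x|.
Proof. by rewrite /rnorm RRe_real// ger0_real. Qed.

Lemma rnorm_ge0 x : 0 <= rnorm x.
Proof. by have := normr_ge0 x; rewrite -rnormE lecR. Qed.

Lemma rnormD x y : rnorm (x + y) <= rnorm x + rnorm y.
Proof. by rewrite -lecR rmorphD/= !rnormE ler_normD. Qed.

Lemma rnorm0 : rnorm (0 : V) = 0.
Proof. by rewrite /rnorm normr0. Qed.

Lemma rnorm0_eq0 x : rnorm x = 0 -> x = 0.
Proof. by move=> x0; apply: normr0_eq0; rewrite -rnormE x0. Qed.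

Lemma rnormZ (a : R[i]) x : rnorm (a *: x) = complex.Re `|a| * rnorm x.
Proof.
have aE : (complex.Re `|a|)%:C = `|a| by rewrite RRe_real// ger0_real.
by apply: complexI; rewrite rnormE rmorphM /= rnormE normrZ aE.
Qed.

End rnorm_theory.

Section bounded_operators.
Context {R : realType}.
Variables V W : normedModType R[i].

Definition is_bounded_op : {pred V -> W} :=
  fun f => `[< linear f /\ continuous f >].

Record bounded_op := BoundedOp {
  bounded_op_fun :> V -> W ;
  _ : bounded_op_fun \in is_bounded_op }.

HB.instance Definition _ := [isSub for bounded_op_fun].
HB.instance Definition _ := [Choice of bounded_op by <:].

Lemma is_bounded_op_submod_closed : submod_closed is_bounded_op.
Proof.
split.
  apply/asboolP; split; last by move=> x; exact: cvg_cst.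
  by move=> a x y /=; rewrite /= scaler0 addr0.
move=> a f g /asboolP[lf cf] /asboolP[lg cg]; apply/asboolP; split.
  move=> b x y; rewrite !fctE/= lf lg.
  rewrite !scalerDr !scalerA [a * b]mulrC -!addrA; congr (_ + _).
  by rewrite addrCA.
move=> x; apply: (@continuousD _ _ _ (a *: f) g); last exact: cg.
exact: (@cvgZl_tmp _ _ _ (nbhs x) _ a f (f x) (cf x)).
Qed.

HB.instance Definition _ := GRing.isSubmodClosed.Build _ _ is_bounded_op
  is_bounded_op_submod_closed.
HB.instance Definition _ := [SubChoice_isSubLmodule of bounded_op by <:].

Lemma bounded_opP (T : bounded_op) : linear T /\ continuous T.
Proof. by case: T => f fP; exact/asboolP. Qed.

HB.instance Definition _ (T : bounded_op) :=
  GRing.isLinear.Build _ _ _ _ (T : V -> W) (bounded_opP T).1.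

End bounded_operators.

Section operator_norm.
Context {R : realType} {V W : normedModType R[i]}.
Implicit Types T S : bounded_op V W.

Definition op_norm T : R := sup [set rnorm (T x) | x in [set x | rnorm x <= 1]].

Let has_ubound_op T :
  has_ubound [set rnorm (T x) | x in [set x | rnorm x <= 1]].
Proof.
have /linear_boundedP : bounded_near (T : V -> W) (nbhs (0 : V)).
  by apply: continuous_linear_bounded; exact: (bounded_opP T).2.
move=> [M [Mr HM]].
have {HM}HM : forall x, `|T x| <= (`|M| + 1) * `|x|.
  apply: HM; apply: (@le_lt_trans _ _ `|M|); last by rewrite ltrDl.
  exact: real_ler_norm.
exists (complex.Re (`|M| + 1)) => _ [x /= x1 <-].
have M0 : 0 <= `|M| + 1 by rewrite addr_ge0.
have ME : (complex.Re (`|M| + 1))%:C = `|M| + 1 by rewrite RRe_real// ger0_real.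
rewrite -lecR ME rnormE (le_trans (HM x))// ler_piMr// -rnormE.
by rewrite -[1]/(1%:C) lecR.
Qed.

Lemma op_norm_ub T x : rnorm x <= 1 -> rnorm (T x) <= op_norm T.
Proof. by move=> x1; apply: (ub_le_sup (has_ubound_op T)); exists x. Qed.

Let nonempty_op T : [set rnorm (T x) | x in [set x | rnorm x <= 1]] !=set0.
Proof. by exists (rnorm (T 0)), 0 => //=; rewrite rnorm0. Qed.

Lemma op_norm_le T (M : R) : (forall x, rnorm x <= 1 -> rnorm (T x) <= M) ->
  op_norm T <= M.
Proof. by move=> TM; apply: (ge_sup (nonempty_op T)) => _ [x /= x1 <-]; exact: TM. Qed.

Lemma op_norm_ge0 T : 0 <= op_norm T.
Proof.
by apply: (le_trans _ (op_norm_ub T (x := 0) _)); rewrite ?rnorm0// rnorm_ge0.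
Qed.

Lemma op_normP T x : rnorm (T x) <= op_norm T * rnorm x.
Proof.
have [->|x0] := eqVneq x 0; first by rewrite linear0 !rnorm0 mulr0.
have nx : 0 < rnorm x.
  rewrite lt_neqAle rnorm_ge0 andbT eq_sym; apply: contra_neq x0.
  exact: rnorm0_eq0.
have xV : complex.Re `|((rnorm x)^-1)%:C : R[i]| = (rnorm x)^-1.
  by rewrite ger0_norm// lecR invr_ge0 ltW.
have := @op_norm_ub T (((rnorm x)^-1)%:C *: x).
rewrite rnormZ xV mulVf ?gt_eqF// => /(_ (lexx _)).
by rewrite linearZ/= rnormZ xV mulrC ler_pdivrMr.
Qed.

Let normC T : R[i] := (op_norm T)%:C.

Let ler_normC T S : normC (T + S) <= normC T + normC S.
Proof.
rewrite -rmorphD/= lecR; apply: op_norm_le => x x1.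
apply: (@le_trans _ _ (rnorm (T x) + rnorm (S x))); first exact: rnormD.
by rewrite lerD// op_norm_ub.
Qed.

Let normCZ (a : R[i]) T : normC (a *: T) = `|a| * normC T.
Proof.
have aE : (complex.Re `|a|)%:C = `|a| by rewrite RRe_real// ger0_real.
have a0 : 0 <= complex.Re `|a| by have := normr_ge0 a; rewrite -aE lecR.
suff E : op_norm (a *: T) = complex.Re `|a| * op_norm T.
  by rewrite /normC E rmorphM/= aE.
apply/eqP; rewrite eq_le; apply/andP; split.
  apply: op_norm_le => x x1; rewrite [X in rnorm X](_ : _ = a *: T x)// rnormZ.
  by rewrite ler_wpM2l// op_norm_ub.
have [->|an0] := eqVneq (complex.Re `|a|) 0; first by rewrite mul0r op_norm_ge0.
have {}a0 : 0 < complex.Re `|a| by rewrite lt_neqAle eq_sym an0.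
rewrite mulrC -ler_pdivlMr//; apply: op_norm_le => x x1.
rewrite ler_pdivlMr// mulrC -rnormZ.
exact: (@op_norm_ub (a *: T) x x1).
Qed.

Let normC_eq0 T : normC T = 0 -> T = 0.
Proof.
move=> /complexI T0; apply/val_inj/funext => x /=.
apply: rnorm0_eq0; apply/eqP; rewrite eq_le rnorm_ge0 andbT.
by rewrite (le_trans (op_normP T x))// T0 mul0r.
Qed.

HB.instance Definition _ :=
  Lmodule_isNormed.Build R[i] (bounded_op V W) ler_normC normCZ normC_eq0.

Lemma op_normE T : rnorm T = op_norm T.
Proof. by []. Qed.

End operator_norm.

Section bochner.
Context {R : realType} {V : normedModType R[i]}.
Implicit Types (D : set R) (f s : R -> V).

Definition simple_fun s := finite_set (range s) /\
  forall v, measurable (s @^-1` [set v]).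

(* Strong measurability is required everywhere rather than almost everywhere:
   every a.e. class of Bochner measurable functions has such a representative,
   and t |-> rnorm (f t) is then Borel, as the library integral needs. *)
Definition strongly_measurable D f := exists s : nat -> R -> V,
  (forall n, simple_fun (s n)) /\ forall t, D t -> s n t @[n --> \oo] --> f t.

(* For D of finite measure. *)
Definition simple_integral D s : V :=
  \sum_(v \in range s) (fine (lebesgue_measure (D `&` s @^-1` [set v])))%:C *: v.

Definition bochner_integral_is D f (v : V) := strongly_measurable D f /\
  exists s : nat -> R -> V, [/\ forall n, simple_fun (s n),
    (\int[lebesgue_measure]_(t in D) (rnorm (f t - s n t))%:E)%E
      @[n --> \oo] --> 0%E &
    simple_integral D (s n) @[n --> \oo] --> v].

Definition bochner_integral D f : V := xget 0 [set v | bochner_integral_is D f v].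

Definition square_integrable D f := strongly_measurable D f /\
  (\int[lebesgue_measure]_(t in D) ((rnorm (f t)) ^+ 2)%:E < +oo)%E.

Definition Linfty f := strongly_measurable setT f /\
  exists M : R, {ae lebesgue_measure, forall t, rnorm (f t) <= M}.

End bochner.

Section square_integrable_theory.
Context {R : realType} {V : normedModType R[i]}.
Implicit Types (D : set R) (f g s : R -> V).
Local Notation mu := (@lebesgue_measure R).

Lemma simple_fun_preimage s (A : set V) : simple_fun s -> measurable (s @^-1` A).
Proof.
move=> [fs ms]; rewrite [X in measurable X](_ : _ =
    \bigcup_(v in range s `&` A) (s @^-1` [set v])); last first.
  apply/seteqP; split=> [t At|t [v [_ Av] /= -> //]].
  by exists (s t) => //; split => //; exists t.
by apply: fin_bigcup_measurable => //; exact: finite_setIl.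
Qed.

Lemma simple_fun_cst (v : V) : simple_fun (fun=> v).
Proof.
split; first by apply: sub_finite_set (finite_set1 v) => _ [t _ <-].
move=> w; have [->|vw] := pselect (w = v).
  by rewrite [X in measurable X](_ : _ = setT)//; apply/seteqP; split.
rewrite [X in measurable X](_ : _ = set0)//; apply/seteqP; split => // t /= E.
exact/vw.
Qed.

Lemma simple_funD s1 s2 : simple_fun s1 -> simple_fun s2 -> simple_fun (s1 + s2).
Proof.
move=> [f1 m1] [f2 m2]; split.
  apply: sub_finite_set (finite_image2 (fun x y : V => x + y) f1 f2) => _ [t _ <-].
  by exists (s1 t); [exists t|exists (s2 t) => //; exists t].
move=> v; rewrite [X in measurable X](_ : _ = \bigcup_(u in range s1)
    (s1 @^-1` [set u] `&` s2 @^-1` [set v - u])); last first.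
  apply/seteqP; split => [t /= <-|t [u _] [/= <- E]].
    by exists (s1 t); [exists t|split => //=; rewrite fctE addrAC subrr add0r].
  by rewrite /= fctE/= E addrC subrK.
by apply: fin_bigcup_measurable => // u _; exact: measurableI.
Qed.

Lemma simple_funZ (a : R[i]) s : simple_fun s -> simple_fun (a *: s).
Proof.
move=> ss; split.
  apply: sub_finite_set (finite_image (fun x : V => a *: x) ss.1) => _ [t _ <-].
  by exists (s t) => //; exists t.
by move=> v; exact: (simple_fun_preimage [set u | a *: u = v]).
Qed.

Lemma simple_fun_rnorm s : simple_fun s ->
  measurable_fun setT (fun t => rnorm (s t)).
Proof.
move=> ss _ A _; rewrite setTI.
exact: (simple_fun_preimage [set u | A (rnorm u)]).
Qed.

Lemma strongly_measurableD D f g : strongly_measurable D f ->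
  strongly_measurable D g -> strongly_measurable D (f + g).
Proof.
move=> [s [ss sf]] [r [sr rg]]; exists (fun n => s n + r n); split.
  by move=> n; exact: simple_funD.
by move=> t Dt; apply: (@cvgD _ _ _ _ _ (s ^~ t) (r ^~ t)); [exact: sf|exact: rg].
Qed.

Lemma strongly_measurableZ D (a : R[i]) f : strongly_measurable D f ->
  strongly_measurable D (a *: f).
Proof.
move=> [s [ss sf]]; exists (fun n => a *: s n); split.
  by move=> n; exact: simple_funZ.
by move=> t Dt; apply: (@cvgZl_tmp _ _ _ _ _ a (s ^~ t)); exact: sf.
Qed.

Lemma rnorm_cvg (u : nat -> V) (l : V) :
  u n @[n --> \oo] --> l -> rnorm (u n) @[n --> \oo] --> rnorm l.
Proof.
move=> ul; apply/cvgrPdist_lt => e e0.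
have e0' : 0 < e%:C :> R[i] by rewrite -[0]/(0%:C) ltcR.
move/cvgrPdist_lt : ul => /(_ _ e0'); apply: filterS => n.
rewrite -rnormE ltcR; apply: le_lt_trans.
have dE : forall x y : V, rnorm (x - y) = rnorm (y - x).
  by move=> x y; rewrite /rnorm distrC.
have dist : forall x y : V, rnorm x - rnorm y <= rnorm (x - y).
  by move=> x y; rewrite lerBlDr -{1}[x](subrK y) rnormD.
by rewrite ler_norml dist andbT lerNl opprB dE dist.
Qed.

Lemma strongly_measurable_rnorm D f : strongly_measurable D f ->
  measurable_fun D (fun t => rnorm (f t)).
Proof.
move=> [s [ss sf]].
apply: (@measurable_fun_cvg _ _ _ D (fun n t => rnorm (s n t))).
  by move=> n; apply: measurable_funTS; exact: simple_fun_rnorm.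
by move=> t Dt; apply: rnorm_cvg; exact: sf.
Qed.

Let sqm D f : strongly_measurable D f ->
  measurable_fun D (fun t => ((rnorm (f t)) ^+ 2)%:E).
Proof.
move=> fm; apply/measurable_EFinP.
by apply: measurable_funX; exact: strongly_measurable_rnorm.
Qed.

Lemma square_integrable0 D : square_integrable D (0 : R -> V).
Proof.
split; first by exists (fun _ => cst 0); split=> [n|t _];
  [exact: simple_fun_cst|exact: cvg_cst].
by rewrite integral0_eq// => t _; rewrite rnorm0 expr0n.
Qed.

Lemma square_integrableZ D (a : R[i]) f : measurable D ->
  square_integrable D f -> square_integrable D (a *: f).
Proof.
move=> mD [fm foo]; split; first exact: strongly_measurableZ.
under eq_integral do rewrite fctE /= rnormZ exprMn EFinM.
rewrite ge0_integralZl//=; last 3 first.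
- exact: sqm.
- by move=> t _; rewrite lee_fin sqr_ge0.
- by rewrite lee_fin sqr_ge0.
by apply: lte_mul_pinfty => //; rewrite lee_fin sqr_ge0.
Qed.

Lemma square_integrableD D f g : measurable D ->
  square_integrable D f -> square_integrable D g -> square_integrable D (f + g).
Proof.
move=> mD [fm foo] [gm goo]; split; first exact: strongly_measurableD.
apply: (@le_lt_trans _ _ (\int[mu]_(t in D)
   (2%:E * ((rnorm (f t)) ^+ 2)%:E + 2%:E * ((rnorm (g t)) ^+ 2)%:E))%E).
  apply: ge0_le_integral => //.
  - by move=> t _; rewrite lee_fin sqr_ge0.
  - apply: sqm; exact: strongly_measurableD.
  - by apply: emeasurable_funD; apply: measurable_funeM; exact: sqm.
  - move=> t _; rewrite -!EFinM -EFinD lee_fin.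
    have := rnormD (f t) (g t); have := rnorm_ge0 (f t + g t).
    rewrite fctE; move: (rnorm (f t)) (rnorm (g t)) (rnorm _) => x y z z0 zxy.
    apply: (@le_trans _ _ ((x + y) ^+ 2)).
      by rewrite lerXn2r ?nnegrE// (le_trans z0).
    rewrite -subr_ge0 (_ : _ - _ = (x - y) ^+ 2) ?sqr_ge0//.
    ring.
rewrite ge0_integralD//=; last 4 first.
- by move=> t _; rewrite -EFinM lee_fin mulr_ge0// sqr_ge0.
- by apply: measurable_funeM; exact: sqm.
- by move=> t _; rewrite -EFinM lee_fin mulr_ge0// sqr_ge0.
- by apply: measurable_funeM; exact: sqm.
rewrite !ge0_integralZl//=; try exact: sqm;
  try (by move=> t _; rewrite lee_fin sqr_ge0).
by apply: lte_add_pinfty; apply: lte_mul_pinfty.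
Qed.

End square_integrable_theory.

Section L2fun.
Context {R : realType}.
Variables (tau : R) (V : normedModType R[i]).
Local Notation mu := (@lebesgue_measure R).
Local Notation J := (`[0, tau]%classic : set R).

Definition is_L2fun : {pred R -> V} := fun f => `[< square_integrable J f >].

Record L2fun := BuildL2fun { L2fun_fun :> R -> V ; _ : L2fun_fun \in is_L2fun }.

HB.instance Definition _ := [isSub for L2fun_fun].
HB.instance Definition _ := [Choice of L2fun by <:].

Lemma is_L2fun_submod_closed : submod_closed is_L2fun.
Proof.
split; first by apply/asboolP; exact: square_integrable0.
move=> a f g /asboolP fI /asboolP gI; apply/asboolP.
by apply: square_integrableD => //; exact: square_integrableZ.
Qed.

HB.instance Definition _ := GRing.isSubmodClosed.Build _ _ is_L2fun
  is_L2fun_submod_closed.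
HB.instance Definition _ := [SubChoice_isSubLmodule of L2fun by <:].

Lemma L2funP (f : L2fun) : square_integrable J f.
Proof. by case: f => f fP; exact/asboolP. Qed.

Definition L2fun_eq (f g : L2fun) : bool :=
  `[< ae_eq mu J (f : R -> V) (g : R -> V) >].

Let L2fun_eq_refl : reflexive L2fun_eq.
Proof. by move=> f; apply/asboolP; exact: ae_eq_refl. Qed.

Let L2fun_eq_sym : symmetric L2fun_eq.
Proof. by move=> f g; apply/idP/idP => /asboolP h; apply/asboolP/ae_eq_sym. Qed.

Let L2fun_eq_trans : transitive L2fun_eq.
Proof. by move=> g f h /asboolP fg /asboolP gh; apply/asboolP/(ae_eq_trans fg gh). Qed.

Canonical L2fun_eq_canonical :=
  EquivRel L2fun_eq L2fun_eq_refl L2fun_eq_sym L2fun_eq_trans.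

Definition L2 : Type := {eq_quot L2fun_eq}%qT.
HB.instance Definition _ := Choice.on L2.
HB.instance Definition _ := EqQuotient.on L2.

End L2fun.

Section L2.
Context {R : realType} {tau : R} {V : normedModType R[i]}.
Local Notation mu := (@lebesgue_measure R).
Local Notation J := (`[0, tau]%classic : set R).
Local Notation L2 := (L2 tau V).
Local Notation L2fun := (L2fun tau V).
Local Open Scope quotient_scope.
Implicit Types (f g : L2fun) (x y z : L2).

(* An arbitrary representative, so only meaningful up to a null set. *)
Definition L2val x : R -> V := repr x : L2fun.

(* The junk value 0 is taken when f is not square integrable on [0, tau]. *)
Definition L2class (f : R -> V) : L2 := \pi_L2 (insubd (0 : L2fun) f).

Lemma L2_eqP f g : reflect (ae_eq mu J (f : R -> V) (g : R -> V))
  (\pi_L2 f == \pi_L2 g).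
Proof. by apply: (iffP idP); rewrite eqmodE => /asboolP. Qed.

Let L2_repr f : ae_eq mu J (repr (\pi_L2 f) : R -> V) (f : R -> V).
Proof. by apply/L2_eqP; rewrite reprK. Qed.

Definition L2_zero : L2 := \pi_L2 (0 : L2fun).
Definition L2_add x y : L2 := \pi_L2 (repr x + repr y).
Definition L2_opp x : L2 := \pi_L2 (- repr x).
Definition L2_scale (a : R[i]) x : L2 := \pi_L2 (a *: repr x).

Let piD f g : L2_add (\pi_L2 f) (\pi_L2 g) = \pi_L2 (f + g).
Proof.
apply/eqP/L2_eqP; have := L2_repr f; have := L2_repr g.
by apply: filterS2 => t /= gE fE It; rewrite /= !fctE /= fE// gE.
Qed.

Let piN f : L2_opp (\pi_L2 f) = \pi_L2 (- f).
Proof.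
apply/eqP/L2_eqP; have := L2_repr f.
by apply: filterS => t /= fE It; rewrite /= !fctE /= fE.
Qed.

Let piZ a f : L2_scale a (\pi_L2 f) = \pi_L2 (a *: f).
Proof.
apply/eqP/L2_eqP; have := L2_repr f.
by apply: filterS => t /= fE It; rewrite /= !fctE /= fE.
Qed.

Let L2_addA : associative L2_add.
Proof.
elim/quotW => f; elim/quotW => g; elim/quotW => h.
by rewrite (piD g h) (piD f g) !piD addrA.
Qed.

Let L2_addC : commutative L2_add.
Proof. by elim/quotW => f; elim/quotW => g; rewrite !piD addrC. Qed.

Let L2_add0 : left_id L2_zero L2_add.
Proof. by elim/quotW => f; rewrite piD add0r. Qed.

Let L2_addN : left_inverse L2_zero L2_opp L2_add.
Proof. by elim/quotW => f; rewrite piN piD addNr. Qed.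

HB.instance Definition _ :=
  GRing.isZmodule.Build L2 L2_addA L2_addC L2_add0 L2_addN.

Let L2_scaleA a b x : L2_scale a (L2_scale b x) = L2_scale (a * b) x.
Proof. by elim/quotW: x => f; rewrite (piZ b f) !piZ scalerA. Qed.

Let L2_scale1 : left_id 1 L2_scale.
Proof. by elim/quotW => f; rewrite piZ scale1r. Qed.

Let L2_scaleDr : right_distributive L2_scale +%R.
Proof.
move=> a; elim/quotW => f; elim/quotW => g.
by rewrite [LHS](congr1 (L2_scale a) (piD f g)) !piZ [RHS]piD scalerDr.
Qed.

Let L2_scaleDl x : {morph L2_scale^~ x : a b / a + b}.
Proof. by move=> a b; elim/quotW: x => f; rewrite !piZ [RHS]piD scalerDl. Qed.

HB.instance Definition _ := GRing.Zmodule_isLmodule.Build R[i] L2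
  L2_scaleA L2_scale1 L2_scaleDr L2_scaleDl.

Lemma L2_piD f g : \pi_L2 f + \pi_L2 g = \pi_L2 (f + g).
Proof. exact: piD. Qed.

Lemma L2_piN f : - \pi_L2 f = \pi_L2 (- f).
Proof. exact: piN. Qed.

Lemma L2_piZ (a : R[i]) f : a *: \pi_L2 f = \pi_L2 (a *: f).
Proof. exact: piZ. Qed.

Definition L2_norm x : R :=
  Num.sqrt (fine (\int[mu]_(t in J) ((rnorm (L2val x t)) ^+ 2)%:E)%E).

Let nfun f : R -> R := (fun t => rnorm (f t)) \_ J.

Let nfun_measurable f : measurable_fun setT (nfun f).
Proof.
apply/(measurable_restrictT _ _).1 => //.
exact: strongly_measurable_rnorm (L2funP f).1.
Qed.

Let nfun_ge0 f t : 0 <= nfun f t.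
Proof. by rewrite /nfun patchE; case: ifP => // _; exact: rnorm_ge0. Qed.

Let nfun_sq f : (\int[mu]_(t in J) ((rnorm (f t)) ^+ 2)%:E =
  \int[mu]_t ((nfun f t) ^+ 2)%:E)%E.
Proof.
rewrite integral_mkcond; apply: eq_integral => t _.
by rewrite /nfun !patchE; case: ifP => // _; rewrite expr0n.
Qed.

Let sq_fin f : (\int[mu]_(t in J) ((rnorm (f t)) ^+ 2)%:E)%E \is a fin_num.
Proof.
rewrite ge0_fin_numE; first exact: (L2funP f).2.
by apply: integral_ge0 => t _; rewrite lee_fin sqr_ge0.
Qed.

Let nfun_Lnorm f : ('N[mu]_2%:E [EFin \o nfun f] =
  (Num.sqrt (fine (\int[mu]_(t in J) ((rnorm (f t)) ^+ 2)%:E)%E))%:E)%E.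
Proof.
rewrite unlock (_ : (\int[mu]_t _)%E =
    \int[mu]_(t in J) ((rnorm (f t)) ^+ 2)%:E)%E; last first.
  rewrite nfun_sq; apply: eq_integral => t _ /=.
  by rewrite ger0_norm ?nfun_ge0// powR_mulrn ?nfun_ge0.
rewrite -[in LHS](fineK (sq_fin f)) poweR_EFin powR12_sqrt//.
by apply: fine_ge0; apply: integral_ge0 => t _; rewrite lee_fin sqr_ge0.
Qed.

Lemma L2_norm_pi f : L2_norm (\pi_L2 f) =
  Num.sqrt (fine (\int[mu]_(t in J) ((rnorm (f t)) ^+ 2)%:E)%E).
Proof.
congr (Num.sqrt (fine _)); apply: ge0_ae_eq_integral => //.
- apply/measurable_EFinP; apply: measurable_funX.
  exact: strongly_measurable_rnorm (L2funP _).1.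
- apply/measurable_EFinP; apply: measurable_funX.
  exact: strongly_measurable_rnorm (L2funP _).1.
- by move=> t _; rewrite lee_fin sqr_ge0.
- by move=> t _; rewrite lee_fin sqr_ge0.
by have := L2_repr f; apply: filterS => t /= fE It; rewrite /L2val fE.
Qed.

Let L2_normD x y : (L2_norm (x + y))%:C <= (L2_norm x)%:C + (L2_norm y)%:C.
Proof.
elim/quotW: x => f; elim/quotW: y => g; rewrite -rmorphD/= lecR L2_piD !L2_norm_pi.
rewrite -lee_fin EFinD -!nfun_Lnorm.
have := eminkowski mu (nfun_measurable f) (nfun_measurable g) (lee1n 2).
apply: le_trans; rewrite unlock.
apply: gt0_ler_poweR; rewrite ?invr_ge0//.
- rewrite in_itv/= leey andbT; by apply: integral_ge0 => t _; rewrite lee_fin powR_ge0.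
- rewrite in_itv/= leey andbT; by apply: integral_ge0 => t _; rewrite lee_fin powR_ge0.
apply: ge0_le_integral => //.
- by move=> t _; rewrite lee_fin powR_ge0.
- apply/measurable_EFinP/(measurableT_comp (measurable_powR _)).
  by apply: measurableT_comp => //; exact: nfun_measurable.
- apply/measurable_EFinP/(measurableT_comp (measurable_powR _)).
  apply: measurableT_comp => //.
  by apply: measurable_funD; exact: nfun_measurable.
move=> t _ /=; rewrite lee_fin !ger0_norm ?addr_ge0 ?nfun_ge0//.
rewrite ge0_ler_powR ?nnegrE ?addr_ge0 ?nfun_ge0//.
rewrite /nfun !patchE; case: ifP => _; last by rewrite addr0.
exact: rnormD.
Qed.

Let L2_normZ (a : R[i]) x : (L2_norm (a *: x))%:C = `|a| * (L2_norm x)%:C.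
Proof.
have aE : (complex.Re `|a|)%:C = `|a| by rewrite RRe_real// ger0_real.
have a0 : 0 <= complex.Re `|a| by have := normr_ge0 a; rewrite -aE lecR.
elim/quotW: x => f; rewrite L2_piZ !L2_norm_pi.
under eq_integral do rewrite /= fctE /= rnormZ exprMn EFinM.
rewrite ge0_integralZl//=; last 3 first.
- apply/measurable_EFinP; apply: measurable_funX.
  exact: strongly_measurable_rnorm (L2funP _).1.
- by move=> t _; rewrite lee_fin sqr_ge0.
- by rewrite lee_fin sqr_ge0.
rewrite fineM ?sq_fin//= sqrtrM ?sqr_ge0// sqrtr_sqr (ger0_norm a0).
by rewrite rmorphM/= aE.
Qed.

Let L2_norm_eq0 x : (L2_norm x)%:C = 0 -> x = 0.
Proof.
elim/quotW: x => f /complexI; rewrite L2_norm_pi => f0.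
have N0 : ('N[mu]_2%:E [EFin \o nfun f] = 0)%E by rewrite nfun_Lnorm f0.
apply/eqP/L2_eqP.
have mf : measurable_fun setT (EFin \o nfun f) by apply/measurable_EFinP.
have l2 : (0 < 2%:E :> \bar R)%E by rewrite lte_fin.
have := Lnorm_eq0_eq0 _ _ N0; move=> /(_ mf l2); apply: filterS => t /= /(_ I) + It.
rewrite /nfun patchE mem_set// => -[] /rnorm0_eq0 ->.
by [].
Qed.

HB.instance Definition _ :=
  Lmodule_isNormed.Build R[i] L2 L2_normD L2_normZ L2_norm_eq0.

Lemma L2_normE x : rnorm x = L2_norm x.
Proof. by []. Qed.

End L2.

Arguments L2class {R} tau {V} f.

Section operators.
Context {R : realType}.

Lemma id_is_bounded_op (V : normedModType R[i]) :
  (idfun : V -> V) \in @is_bounded_op R V V.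
Proof. by apply/asboolP; split=> // x; exact: cvg_id. Qed.

Definition id_op (V : normedModType R[i]) : bounded_op V V :=
  BoundedOp (id_is_bounded_op V).

Definition boundedly_invertible (V W : normedModType R[i]) (T : V -> W) :=
  exists S : bounded_op W V, cancel T S /\ cancel S T.

(* Stated for a plain map T; the inverse of l - T is required to be bounded. *)
Definition resolvent_set (V : normedModType R[i]) (T : V -> V) : set R[i] :=
  [set l | boundedly_invertible (fun x => l *: x - T x)].

Definition spectrum (V : normedModType R[i]) (T : V -> V) : set R[i] :=
  ~` resolvent_set T.

(* The norm of V is induced by an inner product, linear in its first argument. *)
Definition hilbert_norm (V : normedModType R[i]) :=
  exists ip : {dot V for (@Num.conj R[i])}, forall x : V, `|x| ^+ 2 = ip x x.

End operators.

Definition periodic (R : realType) (T : Type) (tau : R) (F : R -> T) :=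
  forall t, F (t + tau) = F t.

(* A(.) enters the model only through the evolution family that it determines,
   so the evolution family is the datum; only its values at s <= t matter. *)
Record system (R : realType) (X U0 Ud0 Y0 : normedModType R[i]) := System {
  sysU : R -> R -> bounded_op X X ;
  sysB : R -> bounded_op U0 X ;
  sysBd : R -> bounded_op Ud0 X ;
  sysC : R -> bounded_op X Y0 ;
  sysD : R -> bounded_op U0 Y0 }.

Section system_theory.
Context {R : realType} {X U0 Ud0 Y0 : normedModType R[i]}.
Implicit Types (S : system X U0 Ud0 Y0) (tau : R).

Definition evolution_family (U : R -> R -> bounded_op X X) :=
  [/\ forall t x, U t t x = x,
      forall s r t, s <= r -> r <= t -> forall x, U t r (U r s x) = U t s x &
      forall x, {within [set p : R * R | p.2 <= p.1],
        continuous (fun p : R * R => U p.1 p.2 x)}].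

Definition periodic_system tau S :=
  [/\ evolution_family (sysU S),
      forall s t, s <= t -> sysU S (t + tau) (s + tau) = sysU S t s,
      [/\ Linfty (sysB S), Linfty (sysBd S), Linfty (sysC S) & Linfty (sysD S)] &
      [/\ periodic tau (sysB S), periodic tau (sysBd S),
          periodic tau (sysC S) & periodic tau (sysD S)]].

Definition exponentially_stable S := exists M omega : R,
  [/\ 0 < M, 0 < omega &
      forall s t, s <= t -> rnorm (sysU S t s) <= M * expR (- omega * (t - s))].

Definition mild_state S (x0 : X) (u : R -> U0) (w : R -> Ud0) (t : R) : X :=
  sysU S t 0 x0 + bochner_integral `[0, t]
    (fun s => sysU S t s (sysB S s (u s) + sysBd S s (w s))).

Definition output S (x : R -> X) (u : R -> U0) (t : R) : Y0 :=
  sysC S t (x t) + sysD S t (u t).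

(* The inverse of id - sysU S tau 0; junk where that map is not bijective. *)
Definition inv_id_sub_monodromy tau S : X -> X :=
  'pinv_(fun=> 0) setT (fun x => x - sysU S tau 0 x).

Definition green tau S (t s : R) (x : X) : X :=
  sysU S t 0 (inv_id_sub_monodromy tau S (sysU S tau s x)).

(* The operator P from U to Y. It is given as a plain map: its linearity and
   boundedness are consequences of the formula, not part of the definition. *)
Definition input_output tau S (u : L2 tau U0) : L2 tau Y0 :=
  L2class tau (fun t =>
    sysC S t (bochner_integral `[0, tau]
      (fun s => green tau S t s (sysB S s (L2val u s)))) +
    sysC S t (bochner_integral `[0, t]
      (fun s => sysU S t s (sysB S s (L2val u s)))) +
    sysD S t (L2val u t)).

(* An L^2_loc(0, oo) signal, given by a representative that is periodic
   everywhere. *)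
Definition periodic_signal (V : normedModType R[i]) tau (f : R -> V) :=
  [/\ strongly_measurable `[0, +oo[ f,
      forall b, square_integrable `[0, b] f &
      forall t, 0 <= t -> f (t + tau) = f t].

Definition disturbance q (v : 'I_q -> R[i]) (w : 'I_q -> R -> Ud0) (t : R) : Ud0 :=
  \sum_k v k *: w k t.

End system_theory.

Record controller (R : realType) (tau : R) (U0 Y0 Z : normedModType R[i]) :=
  Controller {
    ctrlG1 : bounded_op Z Z ;
    ctrlG2 : bounded_op (L2 tau Y0) Z ;
    ctrlK : bounded_op Z (L2 tau U0) }.

Section closed_loop.
Context {R : realType} {tau : R} {X U0 Ud0 Y0 Z : normedModType R[i]}.
Implicit Types (S : system X U0 Ud0 Y0) (Ctrl : controller tau U0 Y0 Z).

(* On [n tau, (n + 1) tau[ this is (K z_n) (t - n tau). *)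
Definition control_input Ctrl (z : nat -> Z) (t : R) : U0 :=
  let n := Num.truncn (t / tau) in L2val (ctrlK Ctrl (z n)) (t - n%:R * tau).

(* x, z and y are determined by the other arguments for t >= 0. *)
Definition closed_loop S Ctrl (yref : R -> Y0) (w : R -> Ud0) (x0 : X) (z0 : Z)
    (x : R -> X) (z : nat -> Z) (y : R -> Y0) :=
  let u := control_input Ctrl z in
  [/\ forall t, 0 <= t -> x t = mild_state S x0 u w t,
      forall t, 0 <= t -> y t = output S x u t,
      z 0%N = z0 &
      forall n, z n.+1 = ctrlG1 Ctrl (z n) +
        ctrlG2 Ctrl (L2class tau (fun s => y (n%:R * tau + s) - yref s))].

Definition closed_loop_stable S Ctrl :=
  exists M0 M1 alpha0 alpha1 : R,
  [/\ [/\ 0 < M0, 0 < M1, 0 < alpha0 & 0 < alpha1] &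
      forall x0 z0 x z y,
        closed_loop S Ctrl (fun=> 0) (fun=> 0) x0 z0 x z y ->
        (forall t, 0 <= t ->
          rnorm (x t) <= M0 * expR (- alpha0 * t) * (rnorm x0 + rnorm z0)) /\
        (forall n : nat,
          rnorm (z n) <= M1 * expR (- alpha1 * n%:R) * (rnorm x0 + rnorm z0))].

Definition output_tracking S Ctrl (yref : R -> Y0)
    q (wk : 'I_q -> R -> Ud0) :=
  exists M alpha : R, [/\ 0 < M, 0 < alpha &
    forall x0 z0 (v : 'I_q -> R[i]) x z y,
      closed_loop S Ctrl yref (disturbance v wk) x0 z0 x z y ->
      forall n : nat,
      (\int[lebesgue_measure]_(t in `[(n%:R * tau)%R, (n.+1%:R * tau)%R])
          ((rnorm (y t - yref t)) ^+ 2)%:E <=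
        (M ^+ 2 * expR (- 2 * alpha * n%:R) *
          (rnorm x0 ^+ 2 + rnorm z0 ^+ 2 +
           (\sum_k (complex.Re `|v k|) ^+ 2) + 1))%R%:E)%E].

Definition solves_robust_output_regulation S Ctrl (yref : R -> Y0)
    q (wk : 'I_q -> R -> Ud0) :=
  [/\ closed_loop_stable S Ctrl,
      output_tracking S Ctrl yref wk &
      forall S' yref' (wk' : 'I_q -> R -> Ud0),
        periodic_system tau S' ->
        periodic_signal tau yref' ->
        (forall k, periodic_signal tau (wk' k)) ->
        closed_loop_stable S' Ctrl ->
        output_tracking S' Ctrl yref' wk'].

End closed_loop.

(* Main.v *)
Require Import Defs.
From HB Require Import structures.
From mathcomp Require Import all_boot all_order all_algebra.
From mathcomp Require Import complex ring lra finmap.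
From mathcomp Require Import all_classical all_reals all_analysis.
From mathcomp Require Import measurable_realfun.

Set Implicit Arguments.
Unset Strict Implicit.
Unset Printing Implicit Defensive.
Import Order.TTheory GRing.Theory Num.Theory.
Import numFieldNormedType.Exports.
Local Open Scope classical_set_scope.
Local Open Scope ring_scope.
Local Open Scope complex_scope.

(** Sampled once per period, the closed loop is a discrete-time system. If x_n
is the state at time n tau and u_n = K z_n the input during the n-th period, then
[x_(n+1) = sample_state x_n (K z_n) w] and
[z_(n+1) = z_n + G2 (sample_output x_n (K z_n) w - yref)], where the two sampling
maps are bounded, jointly linear in their arguments, and the same in every period.
Everything is proved for this recursion, and carried over to continuous time with
one uniform bound of the state within a period.

Regulation is the internal model principle for the controller state map I. When
the reference and the disturbance are periodic they cancel from the difference of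
two consecutive periods, so (x_(n+1) - x_n, z_(n+1) - z_n) is a trajectory of the
closed loop without reference and disturbance, and decays exponentially as soon
as that loop is stable. But z_(n+1) - z_n is G2 applied to the tracking error of
the n-th period, so inverting G2 gives the decay of the error. The argument uses
the plant only through its periodicity and the stability of the closed loop, which
is why it covers the perturbed systems as well (internal_model_tracking).

Stability for small eps is a slow-fast argument (slow_fast_contraction). Write A
for the monodromy operator, [sample_state x u 0 = A x + b u] and
[sample_output x u 0 = c x + d u], with K = eps K0 absorbed into b and d, and put
h = (I - A)^-1 b. The deviation x^_n = x_n - eps h z_n from the slow manifold
satisfies [x^_(n+1) = A x^_n - eps h (z_(n+1) - z_n)], while
[z_(n+1) = (I + eps Q) z_n + G2 c x^_n] with Q = G2 (c h + d), and c h + d is P K0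
(input_output_sampled). Some power of A is a contraction because the plant is
stable. Some power of I + e0 Q is a contraction for a suitable e0, because the
spectrum of Q lies in the open left half-plane
(spectrum_left_half_plane_contraction). In norms adapted to A and to I + e0 Q,
convexity gives I + eps Q the contraction factor 1 - const eps, which outweighs
the coupling of order eps^2 that comes back through x^: a weighted sum of the
two norms decreases geometrically.

The spectral step avoids the spectral radius formula. For small e the operators
T_s = (1 - s) I + e Q, 0 <= s <= 1, have the unit circle in their resolvent set,
with bounds uniform in s. T_1 = e Q is a contraction, and power contractivity
passes from T_s to T_s' when s' is close to s, so it reaches T_0 = I + e Q in
finitely many steps. To pass it on, T_s and T_s' are squared repeatedly: since
[(w^2 - B^2)^-1 = (2w)^-1 ((w - B)^-1 + (w + B)^-1)], neither the bounds of the
resolvents on the unit circle nor their distance grow, and once the power of T_s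
is tiny that of T_s' is at most 1/2.

The analytic part builds what the mild solution needs: the Bochner integral (its
existence, uniqueness, additivity, invariance under translation, exchange with
bounded operators), the uniform boundedness principle, from which an evolution
family is bounded on compact time intervals, and the measurability of
s |-> U(t,s) g(s) and of the mild state. *)

(** * Real-valued norms *)

Definition cnorm (R : realType) (z : R[i]) : R := complex.Re `|z|.

Section cnorm_theory.
Context {R : realType}.
Implicit Types z w : R[i].

Lemma cnormE z : (cnorm z)%:C = `|z|.
Proof. by rewrite /cnorm RRe_real// ger0_real. Qed.

Lemma cnorm_sqrt z :
  cnorm z = Num.sqrt (complex.Re z ^+ 2 + complex.Im z ^+ 2).
Proof. by rewrite /cnorm normc_def. Qed.

Lemma cnorm_sqr z : cnorm z ^+ 2 = complex.Re z ^+ 2 + complex.Im z ^+ 2.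
Proof. by rewrite cnorm_sqrt sqr_sqrtr// addr_ge0// sqr_ge0. Qed.

Lemma cnorm_ge0 z : 0 <= cnorm z.
Proof. by rewrite cnorm_sqrt sqrtr_ge0. Qed.

Lemma cnormM z w : cnorm (z * w) = cnorm z * cnorm w.
Proof. by apply: complexI; rewrite rmorphM/= !cnormE normrM. Qed.

Lemma cnormV z : cnorm z^-1 = (cnorm z)^-1.
Proof. by apply: complexI; rewrite fmorphV/= !cnormE normfV. Qed.

Lemma cnorm_real (a : R) : cnorm a%:C = `|a|.
Proof. by rewrite cnorm_sqrt /= expr0n addr0 sqrtr_sqr. Qed.

Lemma cnormN z : cnorm (- z) = cnorm z.
Proof. by rewrite /cnorm normrN. Qed.

Lemma cnorm_le_Re_Im z : cnorm z <= `|complex.Re z| + `|complex.Im z|.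
Proof.
rewrite -(@ler_pXn2r _ 2) ?nnegrE ?cnorm_ge0 ?addr_ge0//.
rewrite cnorm_sqr sqrrD !real_normK ?num_real// lerD2r lerDl.
by rewrite mulrn_wge0// mulr_ge0.
Qed.

Lemma Re_le_cnorm z : `|complex.Re z| <= cnorm z.
Proof.
rewrite -(@ler_pXn2r _ 2) ?nnegrE ?cnorm_ge0//.
by rewrite cnorm_sqr real_normK ?num_real// lerDl sqr_ge0.
Qed.

Lemma Im_le_cnorm z : `|complex.Im z| <= cnorm z.
Proof.
rewrite -(@ler_pXn2r _ 2) ?nnegrE ?cnorm_ge0//.
by rewrite cnorm_sqr real_normK ?num_real// lerDr sqr_ge0.
Qed.

Lemma cnorm_eq0 z : (cnorm z == 0) = (z == 0).
Proof. by rewrite -(inj_eq (@complexI R)) cnormE normr_eq0. Qed.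

End cnorm_theory.

Section rnorm_more.
Context {R : realType} {V : normedModType R[i]}.
Implicit Types x y : V.

Lemma rnormZc (a : R[i]) x : rnorm (a *: x) = cnorm a * rnorm x.
Proof. exact: rnormZ. Qed.

Lemma rnormZr (a : R) x : rnorm (a%:C *: x) = `|a| * rnorm x.
Proof. by rewrite rnormZc cnorm_real. Qed.

Lemma rnormN x : rnorm (- x) = rnorm x.
Proof. by rewrite /rnorm normrN. Qed.

Lemma rnormBC x y : rnorm (x - y) = rnorm (y - x).
Proof. by rewrite /rnorm distrC. Qed.

Lemma rnormB x y : rnorm (x - y) <= rnorm x + rnorm y.
Proof. by rewrite -[in leRHS](rnormN y) rnormD. Qed.

Lemma rnorm_dist z x y : rnorm (x - y) <= rnorm (x - z) + rnorm (z - y).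
Proof. by rewrite (le_trans _ (rnormD _ _))// addrA subrK. Qed.

Lemma rnorm_le_add x y : rnorm x <= rnorm y + rnorm (x - y).
Proof. by rewrite -{1}(subrK y x) addrC rnormD. Qed.

Lemma rnorm_sum (I : Type) (r : seq I) (P : pred I) (F : I -> V) :
  rnorm (\sum_(i <- r | P i) F i) <= \sum_(i <- r | P i) rnorm (F i).
Proof.
elim/big_ind2 : _ => //; first by rewrite rnorm0.
by move=> x a y b xa yb; rewrite (le_trans (rnormD _ _))// lerD.
Qed.

Lemma rcvgP (T : Type) (F : set_system T) (FF : Filter F) (f : T -> V) (l : V) :
  f @ F --> l <-> forall e : R, 0 < e -> \forall t \near F, rnorm (f t - l) < e.
Proof.
split=> [/cvgrPdist_lt fl e e0|fl].
  have e0' : 0 < e%:C :> R[i] by rewrite -[0]/(0%:C) ltcR.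
  by have := fl _ e0'; apply: filterS => t; rewrite distrC -rnormE ltcR.
apply/cvgrPdist_lt => e e0.
have er : (complex.Re e)%:C = e by rewrite RRe_real// gtr0_real.
have e0' : 0 < complex.Re e by rewrite -ltcR er.
by have := fl _ e0'; apply: filterS => t; rewrite distrC -er -rnormE ltcR.
Qed.

Lemma rcvg0P (T : Type) (F : set_system T) (FF : Filter F) (f : T -> V) (l : V) :
  f @ F --> l <-> rnorm (f t - l) @[t --> F] --> (0 : R).
Proof.
split=> [/rcvgP fl|/cvgrPdist_lt fl].
  apply/cvgrPdist_lt => e e0; have := fl e e0; apply: filterS => t.
  by rewrite sub0r normrN ger0_norm ?rnorm_ge0.
apply/rcvgP => e e0; have := fl e e0; apply: filterS => t.
by rewrite sub0r normrN ger0_norm ?rnorm_ge0.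
Qed.

End rnorm_more.

Lemma rnorm_cauchy_cvg (R : realType) (V : completeNormedModType R[i])
    (u : nat -> V) :
  (forall e : R, 0 < e -> exists N, forall m n, (N <= m)%N -> (N <= n)%N ->
     rnorm (u m - u n) < e) ->
  exists l : V, u n @[n --> \oo] --> l.
Proof.
move=> uC; suff : cvg (u @ \oo) by move=> h; exists (lim (u @ \oo)).
apply: cauchy_cvg; apply: cauchy_exP => e e0.
have er : (complex.Re e)%:C = e by rewrite RRe_real// gtr0_real.
have e0' : 0 < complex.Re e by rewrite -ltcR er.
have [N uN] := uC _ e0'; exists (u N); exists N => // n /= Nn.
rewrite -ball_normE /ball_ /= -er -rnormE ltcR.
exact: uN.
Qed.

(** * Bounded linear maps *)

Section bounded_maps.
Context {R : realType}.

Definition bounded_by (V W : normedModType R[i]) (f : V -> W) (c : R) :=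
  forall x, rnorm (f x) <= c * rnorm x.

Lemma bounded_by_le (V W : normedModType R[i]) (f : V -> W) (c d : R) :
  c <= d -> bounded_by f c -> bounded_by f d.
Proof. by move=> cd fc x; rewrite (le_trans (fc x))// ler_wpM2r// rnorm_ge0. Qed.

Lemma bounded_by_comp (V W Z : normedModType R[i]) (f : W -> Z) (g : V -> W)
    (c d : R) : 0 <= c -> bounded_by f c -> bounded_by g d ->
  bounded_by (f \o g) (c * d).
Proof.
by move=> c0 fc gd x; rewrite (le_trans (fc _))// -mulrA ler_wpM2l.
Qed.

Lemma bounded_opW (V W : normedModType R[i]) (T : bounded_op V W) :
  bounded_by T (op_norm T).
Proof. by move=> x; exact: op_normP. Qed.

Lemma bounded_op_continuous (V W : normedModType R[i]) (T : bounded_op V W) :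
  continuous T.
Proof. exact: (bounded_opP T).2. Qed.

Lemma bopZ (V W : normedModType R[i]) (T : bounded_op V W) (a : R[i]) x :
  T (a *: x) = a *: T x.
Proof. by rewrite linearZ. Qed.

Lemma bopD (V W : normedModType R[i]) (T : bounded_op V W) x y :
  T (x + y) = T x + T y.
Proof. by rewrite linearD. Qed.

Lemma bopB (V W : normedModType R[i]) (T : bounded_op V W) x y :
  T (x - y) = T x - T y.
Proof. by rewrite linearB. Qed.

Lemma bop0 (V W : normedModType R[i]) (T : bounded_op V W) : T 0 = 0.
Proof. by rewrite linear0. Qed.

Lemma op_norm_le_bound (V W : normedModType R[i]) (T : bounded_op V W) (c : R) :
  0 <= c -> bounded_by T c -> op_norm T <= c.
Proof.
move=> c0 Tc; apply: op_norm_le => x x1; rewrite (le_trans (Tc x))//.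
by rewrite ler_piMr.
Qed.

Lemma bounded_op_of (V W : normedModType R[i]) (f : V -> W) (c : R) :
  linear f -> bounded_by f c -> exists T : bounded_op V W, forall x, T x = f x.
Proof.
move=> lf fc; have fP : f \in @is_bounded_op R V W.
  apply/asboolP; split => // x; apply/rcvgP => e e0.
  have fB y : f y - f x = f (y - x).
    by rewrite addrC -scaleN1r -lf scaleN1r addrC.
  have d0 : 0 < e / (`|c| + 1) by rewrite divr_gt0// ltr_wpDl.
  have /rcvgP/(_ _ d0) : (y : V) @[y --> x] --> x by exact: cvg_id.
  apply: filterS => y; rewrite ltr_pdivlMr ?ltr_wpDl// fB; apply: le_lt_trans.
  rewrite (le_trans (fc _))// mulrC ler_wpM2l ?rnorm_ge0//.
  by rewrite (le_trans (ler_norm c))// lerDl.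
by exists (BoundedOp fP).
Qed.

End bounded_maps.

(** * Norms adapted to a power contraction *)

Section adapted_norm.
Context {R : realType} {V : normedModType R[i]}.
Variables (T : {linear V -> V}) (k : nat).

Let r : R := 1 - (k.*2)%:R^-1.

(** When [iter k T] halves every vector, T itself need not be a contraction, but
it is one for this equivalent norm: the weights
[r ^- j] grow towards the later iterates, and r is so close to 1 that [r ^+ k] is
still at least 1/2. *)
Definition adapted_norm (x : V) : R := \sum_(j < k) r ^- j * rnorm (iter j T x).

Hypothesis k_gt0 : (0 < k)%N.
Hypothesis Tk : bounded_by (iter k T) 2^-1.

Let k2_gt1 : 1 < (k.*2)%:R :> R.
Proof. by rewrite (ltr_nat _ 1) -muln2 (@leq_trans (1 * 2)) ?leq_mul. Qed.

Let k2_gt0 : 0 < (k.*2)%:R :> R.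
Proof. exact: lt_trans k2_gt1. Qed.

Let r_gt0 : 0 < r.
Proof. by rewrite /r subr_gt0 invf_lt1. Qed.

Let rk : 2^-1 <= r ^+ k.
Proof.
(* Bernoulli's inequality for r = 1 - 1/(2k) *)
have bern : forall n, 1 - n%:R * (k.*2)%:R^-1 <= r ^+ n.
  elim=> [|n IH]; first by rewrite mul0r subr0 expr0.
  rewrite exprSr (le_trans _ (ler_wpM2r (ltW r_gt0) IH))//.
  rewrite /r -[n.+1]addn1 natrD.
  have : 0 <= n%:R * (k.*2)%:R^-1 * (k.*2)%:R^-1 :> R.
    by rewrite !mulr_ge0// invr_ge0.
  by set a := (k.*2)%:R^-1; set b := n%:R => ab; nra.
apply: le_trans (bern k); rewrite -muln2 natrM invfM mulrA divff ?mul1r; last first.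
  by rewrite pnatr_eq0 -lt0n.
by lra.
Qed.

Lemma adapted_norm_ge x : rnorm x <= adapted_norm x.
Proof.
rewrite /adapted_norm; case: k k_gt0 => // m _; rewrite big_ord_recl /=.
rewrite expr0 invr1 mul1r lerDl; apply: sumr_ge0 => j _.
by rewrite mulr_ge0 ?rnorm_ge0// invr_ge0 exprn_ge0// ltW.
Qed.

Let iterD j x y : iter j T (x + y) = iter j T x + iter j T y.
Proof. by elim: j => //= j ->; rewrite linearD. Qed.

Let iterZ j (a : R[i]) x : iter j T (a *: x) = a *: iter j T x.
Proof. by elim: j => //= j ->; rewrite linearZ. Qed.

Lemma adapted_normD x y : adapted_norm (x + y) <= adapted_norm x + adapted_norm y.
Proof.
rewrite /adapted_norm -big_split /=; apply: ler_sum => j _.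
by rewrite -mulrDr ler_wpM2l ?iterD ?rnormD// invr_ge0 exprn_ge0// ltW.
Qed.

Lemma adapted_normZ (a : R[i]) x : adapted_norm (a *: x) = cnorm a * adapted_norm x.
Proof.
rewrite /adapted_norm mulr_sumr; apply: eq_bigr => j _.
by rewrite iterZ rnormZc mulrCA.
Qed.

(** Applying T shifts the sum by one index, which multiplies the weights by r. The new
last term [r ^- (k - 1) * rnorm (iter k T x)] is at most r times the first term
[rnorm x] that drops out, since [iter k T] halves and [r ^+ k] is at least 1/2. *)
Lemma adapted_norm_contr x : adapted_norm (T x) <= r * adapted_norm x.
Proof.
rewrite /adapted_norm; case: k k_gt0 Tk rk => // m _ Tm rm.
rewrite [in leLHS]big_ord_recr [in leRHS]big_ord_recl /= expr0 invr1 mul1r mulrDr.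
rewrite mulr_sumr [leLHS]addrC; apply: lerD.
  rewrite -iterSr -[iter _ _ _]/(iter m.+1 T x) mulrC -ler_pdivlMr ?invr_gt0 ?exprn_gt0//.
  rewrite invrK mulrAC -exprS; apply: (le_trans (Tm x)).
  by rewrite ler_wpM2r ?rnorm_ge0.
apply: ler_sum => j _; rewrite -iterSr iterS /bump /= add1n exprS invfM.
by rewrite !mulrA divff ?gt_eqF// mul1r.
Qed.

Lemma adapted_norm_le (c : R) : 0 <= c -> bounded_by T c ->
  exists C, 0 < C /\ forall x, adapted_norm x <= C * rnorm x.
Proof.
move=> c0 Tc; exists (1 + \sum_(j < k) r ^- j * c ^+ j); split.
  rewrite ltr_wpDr//; apply: sumr_ge0 => j _.
  by rewrite mulr_ge0 ?exprn_ge0// invr_ge0 exprn_ge0// ltW.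
move=> x; rewrite mulrDl mul1r ler_wpDl ?rnorm_ge0// mulr_suml.
apply: ler_sum => j _; rewrite -mulrA ler_wpM2l ?invr_ge0 ?exprn_ge0 ?(ltW r_gt0)//.
elim: (nat_of_ord j) => [|n IH] /=; first by rewrite expr0 mul1r.
by rewrite (le_trans (Tc _))// exprS -mulrA ler_wpM2l.
Qed.

End adapted_norm.

Lemma exists_adapted_norm (R : realType) (V : normedModType R[i])
    (T : {linear V -> V}) (k : nat) (c : R) : (0 < k)%N -> 0 <= c ->
  bounded_by T c -> bounded_by (iter k T) 2^-1 ->
  exists (N : V -> R) (r C : R), [/\ 0 < r, r < 1, 0 < C &
    [/\ forall x, rnorm x <= N x, forall x, N x <= C * rnorm x,
      forall x y, N (x + y) <= N x + N y,
      forall (a : R[i]) x, N (a *: x) = cnorm a * N x &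
      forall x, N (T x) <= r * N x]].
Proof.
move=> k0 c0 Tc Tk; have [C [C0 CP]] := adapted_norm_le k0 c0 Tc.
have k2 : 1 < (k.*2)%:R :> R.
  by rewrite (ltr_nat _ 1) -muln2 (@leq_trans (1 * 2)) ?leq_mul.
have k2' := lt_trans ltr01 k2.
exists (adapted_norm T k), (1 - (k.*2)%:R^-1), C; split => //.
- by rewrite subr_gt0 invf_lt1.
- by rewrite ltrBlDr ltrDl invr_gt0.
split => //.
- exact: adapted_norm_ge.
- exact: adapted_normD.
- exact: adapted_normZ.
- exact: adapted_norm_contr.
Qed.

(** * Operators with spectrum in the open left half-plane *)

Section resolvent.
Context {R : realType} {V : normedModType R[i]}.
Variable Q : bounded_op V V.
Let q := op_norm Q.

Let q_ge0 : 0 <= q. Proof. exact: op_norm_ge0. Qed.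

(** Local boundedness of the resolvent on the compact rectangle, by the
perturbation estimate at each of its points, and compactness. *)
Lemma resolvent_bounded (rho : R) :
  (forall l : R[i], 0 <= complex.Re l ->
     boundedly_invertible (fun x => l *: x - Q x)) ->
  exists M : R, 0 < M /\ forall l : R[i], 0 <= complex.Re l ->
    complex.Re l <= rho -> `|complex.Im l| <= rho ->
    forall x, rnorm x <= M * rnorm (l *: x - Q x).
Proof.
move=> Rex.
pose K := (`[0, rho] `*` `[- rho, rho])%classic : set (R * R).
have cK : compact K by apply: compact_setX; exact: segment_compact.
pose P (M : R) (p : R * R) :=
  forall x, rnorm x <= M * rnorm ((p.1 +i* p.2) *: x - Q x).
have : \forall M \near +oo, K `<=` P M.
  apply: (iffLR (compact_near_coveringP K) cK) => -[a b] [/=].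
  rewrite !in_itv/= => /andP[a0 _] _.
  have [S [QS _]] := Rex (a +i* b) a0.
  pose m := op_norm S + 1.
  have m0 : 0 < m by rewrite ltr_wpDl// op_norm_ge0.
  have Sm x : rnorm x <= m * rnorm ((a +i* b) *: x - Q x).
    rewrite -{1}(QS x) (le_trans (op_normP _ _))// ler_wpM2r ?rnorm_ge0//.
    by rewrite lerDl.
  have d0 : 0 < (4 * m)^-1 by rewrite invr_gt0 mulr_gt0.
  exists (ball (a, b) (4 * m)^-1, [set M | 2 * m < M]).
    split; first exact: nbhsx_ballx.
    by exists (2 * m); split => //; rewrite num_real.
  move=> -[[a' b'] M] /= [[/= ba bb] mM] x.
  have mM' : 2 * m <= M by exact: ltW.
  have dl : cnorm ((a +i* b) - (a' +i* b')) <= (2 * m)^-1.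
    apply: (le_trans (cnorm_le_Re_Im _)) => /=.
    move: ba bb; rewrite /ball /= => ba bb.
    rewrite (_ : (2 * m)^-1 = (4 * m)^-1 + (4 * m)^-1).
      by apply: lerD; exact: ltW.
    by field; rewrite gt_eqF.
  have := Sm x.
  rewrite -[X in X *: x](subrK (a' +i* b')) scalerDl -addrA => h.
  have {h} : rnorm x <= m * ((2 * m)^-1 * rnorm x + rnorm ((a' +i* b') *: x - Q x)).
    apply: (le_trans h); rewrite ler_pM2l// (le_trans (rnormD _ _))// lerD2r.
    by rewrite rnormZc ler_wpM2r ?rnorm_ge0.
  rewrite mulrDr mulrA (_ : m * (2 * m)^-1 = 2^-1); last by field; rewrite gt_eqF.
  move=> h; have : rnorm x <= 2 * m * rnorm ((a' +i* b') *: x - Q x) by lra.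
  move=> /le_trans; apply; rewrite ler_wpM2r// rnorm_ge0//.
move=> /pinfty_ex_gt0 [M M0 KM]; exists M; split => // -[a b] /= a0 ar br x.
by apply: (KM (a, b)); split; rewrite /= in_itv/= ?a0// -ler_norml.
Qed.

(** If L is invertible and N is a small operator that commutes with it, then
[L \o (id - N)] is inverted by the Neumann series of N after [L^-1]. Its finite
partial sums are inverses up to eta with a uniform bound; approximate inverses are
all that is used below, and they exist in any normed space. *)
Lemma neumann_approx (L Rv N : {linear V -> V}) (M theta : R) :
  0 <= M -> 0 <= theta -> theta < 1 ->
  cancel L Rv -> cancel Rv L -> (forall x, L (N x) = N (L x)) ->
  bounded_by Rv M -> bounded_by N theta ->
  forall eta : R, 0 < eta -> exists S : {linear V -> V},
    [/\ bounded_by S (M / (1 - theta)),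
      forall x, rnorm (x - (L (S x) - L (N (S x)))) <= eta * rnorm x &
      forall x, rnorm (x - S (L x - L (N x))) <= eta * rnorm x].
Proof.
move=> M0 t0 t1 LR RL LN RM Nt eta eta0.
have t1' : 0 < 1 - theta by rewrite subr_gt0.
have Nj j : bounded_by (iter j N) (theta ^+ j).
  elim: j => [|j IH] x /=; first by rewrite expr0 mul1r.
  by rewrite (le_trans (Nt _))// exprS -mulrA ler_wpM2l.
suff H : forall m, exists S : {linear V -> V},
    [/\ bounded_by S (M / (1 - theta)),
      forall x, L (S x) - L (N (S x)) = x - iter m N x &
      forall x, S (L x - L (N x)) = x - iter m N x].
  have : theta ^+ n @[n --> \oo] --> (0 : R).
    by apply: cvg_expr; rewrite ger0_norm.
  move=> /cvgrPdist_lt/(_ _ eta0)[m _ /(_ m (leqnn m))] /=.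
  rewrite sub0r normrN ger0_norm ?exprn_ge0// => tm.
  have [S [SM S1 S2]] := H m; exists S; split => // x.
    rewrite S1 opprB addrC subrK (le_trans (Nj m x))//.
    by rewrite ler_wpM2r ?rnorm_ge0// ltW.
  rewrite S2 opprB addrC subrK (le_trans (Nj m x))//.
  by rewrite ler_wpM2r ?rnorm_ge0// ltW.
elim=> [|m [S [SM S1 S2]]].
  exists (\0 : {linear V -> V}); split => x /=.
  - by rewrite rnorm0 mulr_ge0 ?rnorm_ge0// divr_ge0// ltW.
  - by rewrite !linear0 !subrr ?addr0.
  - by rewrite subrr.
exists (Rv \+ (N \o S) : {linear V -> V}); split => x /=.
- rewrite (le_trans (rnormD _ _))//.
  apply: (@le_trans _ _ (M * rnorm x + theta * (M / (1 - theta) * rnorm x))).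
    apply: lerD; first exact: RM.
    by rewrite (le_trans (Nt _))// ler_wpM2l// SM.
  rewrite mulrA -mulrDl ler_wpM2r ?rnorm_ge0//.
  rewrite [leLHS](_ : _ = M / (1 - theta))//; field; by rewrite gt_eqF.
- have h1 : L (N (Rv x)) = N x by rewrite LN RL.
  have h2 : L (N (S x)) - L (N (N (S x))) = N x - N (iter m N x).
    by rewrite LN (LN (N _)) -linearB S1 linearB.
  by rewrite !linearD /= RL h1 ?opprD addrACA h2 addrA subrK.
- by rewrite S2 (linearB Rv) (linearB N) !LR addrA subrK.
Qed.

(** The resolvent is bounded on the union of the half-plane [- h <= Re l] and the
exterior [q + 1 <= |l|]: in the exterior by the Neumann series of [l^-1 Q]; otherwise
by perturbing from [l + h], which lies in the rectangle of [resolvent_bounded]. *)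
Lemma resolvent_approx :
  (forall l : R[i], 0 <= complex.Re l ->
     boundedly_invertible (fun x => l *: x - Q x)) ->
  exists M h : R, [/\ 0 < M, 0 < h, h <= 2^-1 &
    forall l : R[i], (- h <= complex.Re l) || (q + 1 <= cnorm l) ->
    forall eta : R, 0 < eta -> exists S : {linear V -> V},
    [/\ bounded_by S M,
      forall x, rnorm (x - (l *: S x - Q (S x))) <= eta * rnorm x &
      forall x, rnorm (x - S (l *: x - Q x)) <= eta * rnorm x]].
Proof.
move=> Rex; have [M1 [M10 M1P]] := resolvent_bounded (q + 2) Rex.
pose h : R := (2 * (M1 + 1))^-1.
have M11 : 0 < M1 + 1 by rewrite ltr_wpDl// ltW.
have h0 : 0 < h by rewrite invr_gt0 mulr_gt0.
have hh : h <= 2^-1.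
  by rewrite /h lef_pV2 ?posrE ?mulr_gt0//; move: M10; lra.
exists (1 + 2 * M1), h; split => //; first by rewrite ltr_wpDr// mulr_ge0// ltW.
move=> l lP eta eta0.
have [lq|lq] := leP (q + 1) (cnorm l).
  have l0 : 0 < cnorm l by apply: lt_le_trans lq; rewrite ltr_wpDl.
  have l0' : l != 0 by rewrite -cnorm_eq0 gt_eqF.
  have [S [S1 S2 S3]] := @neumann_approx ( *:%R l) ( *:%R l^-1) (l^-1 \*: Q)
     (cnorm l)^-1 (q / cnorm l) (ltac:(by rewrite invr_ge0 ltW))
     (ltac:(by rewrite divr_ge0// ltW))
     (ltac:(by rewrite ltr_pdivrMr// mul1r (lt_le_trans _ lq)// ltrDl))
     (scalerK l0') (scalerKV l0')
     (ltac:(by move=> x /=; rewrite bopZ !scalerA mulrC))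
     (ltac:(by move=> x; rewrite rnormZc cnormV))
     (ltac:(by move=> x /=; rewrite rnormZc cnormV mulrC mulrAC ler_wpM2r ?invr_ge0 ?op_normP// ltW))
     eta eta0.
  exists S; split => [|x|x].
  - apply: bounded_by_le S1; rewrite (@le_trans _ _ 1)//; last first.
      by rewrite lerDl mulr_ge0// ltW.
    rewrite (_ : _ / _ = (cnorm l - q)^-1); last first.
      have : cnorm l - q != 0 by rewrite subr_eq0 gt_eqF// (lt_le_trans _ lq)// ltrDl.
      by move=> hq; field; rewrite hq gt_eqF.
    by rewrite invf_le1 ?lerBrDl// subr_gt0 (lt_le_trans _ lq)// ltrDl.
  - by have := S2 x; rewrite /= scalerA mulfV// scale1r.
  - by have := S3 x; rewrite /= scalerA mulfV// scale1r.
move: lP => /orP[lh|/(lt_le_trans lq)]; last by rewrite ltxx.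
pose nu : R[i] := l + h%:C.
have nuR : complex.Re nu = complex.Re l + h by rewrite /nu; case: (l).
have nuI : complex.Im nu = complex.Im l by rewrite /nu; case: (l) => a b /=; rewrite addr0.
have nu0 : 0 <= complex.Re nu by rewrite nuR -lerBlDr sub0r.
have [Rv [LR RL]] := Rex nu nu0.
have RvM : bounded_by Rv M1.
  move=> x; rewrite -{2}(RL x); apply: M1P => //.
    rewrite nuR; have := le_trans (ler_norm _) (Re_le_cnorm l); lra.
  by rewrite nuI (le_trans (Im_le_cnorm _))// ltW// (lt_le_trans lq)// lerD2l ler1n.
have [S [S1 S2 S3]] := @neumann_approx (( *:%R nu) \- Q) Rv (h%:C \*: Rv)
     M1 2^-1 (ltW M10) (ltac:(by rewrite invr_ge0))
     (ltac:(by rewrite invf_lt1// ltr1n)) LR RL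
     (ltac:(by move=> x /=; rewrite bopZ scalerA mulrC -scalerA -scalerBr RL LR))
     RvM
     (ltac:(by move=> x /=; rewrite rnormZr ger0_norm ?(ltW h0)//;
        apply: le_trans (ler_wpM2l (ltW h0) (RvM x)) _;
        rewrite mulrA ler_wpM2r ?rnorm_ge0// /h ler_pdivrMl ?mulr_gt0//; lra))
     eta eta0.
have E x : ((( *:%R nu) \- Q) x) - ((( *:%R nu) \- Q) ((h%:C \*: Rv) x)) =
    l *: x - Q x.
  rewrite /= bopZ scalerA mulrC -scalerA -scalerBr RL.
  by rewrite /nu scalerDl addrAC addrK.
exists S; split => [|x|x].
- apply: bounded_by_le S1.
  by rewrite (_ : M1 / (1 - 2^-1) = 2 * M1); [lra|field].
- by have := S2 x; rewrite E.
- by have := S3 x; rewrite E.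
Qed.

End resolvent.

Lemma subrACA (V : zmodType) (a b c d : V) : (a - b) - (c - d) = (a - c) - (b - d).
Proof. by rewrite opprD addrACA -opprD. Qed.

Section squaring.
Context {R : realType} {V : normedModType R[i]}.

(** On the unit circle S and S' are right inverses up to eta of [w - B] and [w - B'],
with M bounding S and kappa the distance of S and S'; the same M and kappa serve
every w and eta. This is the property of a pair of operators that survives squaring. *)
Definition approx_pair (B B' : V -> V) (M kappa : R) :=
  forall w : R[i], cnorm w = 1 -> forall eta : R, 0 < eta ->
  exists S S' : V -> V, [/\ bounded_by S M,
    bounded_by (fun x => S x - S' x) kappa,
    bounded_by (fun x => x - (w *: S x - B (S x))) eta &
    bounded_by (fun x => x - (w *: S' x - B' (S' x))) eta].

(** The approximate form of
[(w^2 - B^2)^-1 = (2w)^-1 ((w - B)^-1 + (w + B)^-1)]; [S2] inverts [- w - B], hence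
the minus sign. *)
Lemma sqr_approx_inverse (B : {linear V -> V}) (b : R) (w : R[i])
    (S1 S2 : V -> V) (eta : R) : 0 <= b -> bounded_by B b -> cnorm w = 1 ->
  bounded_by (fun x => x - (w *: S1 x - B (S1 x))) eta ->
  bounded_by (fun x => x - (- w *: S2 x - B (S2 x))) eta ->
  bounded_by (fun x => x - (w ^+ 2 *: ((2 * w)^-1 *: (S1 x - S2 x))
    - B (B ((2 * w)^-1 *: (S1 x - S2 x))))) ((1 + b) * eta).
Proof.
move=> b0 Bb w1 F1 F2 x; move: {F1 F2}(F1 x) (F2 x).
set u1 := w *: S1 x - B (S1 x); set u2 := - w *: S2 x - B (S2 x) => F1 F2.
have w0 : 2 * w != 0.
  by rewrite mulf_neq0 ?pnatr_eq0// -cnorm_eq0 w1 oner_eq0.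
have BB y z : B (y - z) = B y - B z by exact: linearB.
have BZ (a : R[i]) y : B (a *: y) = a *: B y by exact: linearZ.
have E1 : w ^+ 2 *: S1 x - B (B (S1 x)) = w *: u1 + B u1.
  by rewrite /u1 scalerBr BB BZ scalerA addrA subrK.
have E2 : w ^+ 2 *: S2 x - B (B (S2 x)) = B u2 - w *: u2.
  rewrite /u2 BB BZ scalerBr scalerA mulrN -expr2 !scaleNr.
  by rewrite opprB opprK addrACA addNr add0r addrC.
have E3 : w ^+ 2 *: ((2 * w)^-1 *: (S1 x - S2 x))
    - B (B ((2 * w)^-1 *: (S1 x - S2 x))) =
    (2 * w)^-1 *: ((w *: u1 + B u1) - (B u2 - w *: u2)).
  rewrite !BZ scalerA [w ^+ 2 * _]mulrC -scalerA -scalerBr; congr (_ *: _).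
  by rewrite (BB (S1 x)) (BB (B _)) scalerBr subrACA E1 E2.
clearbody u1 u2.
have -> : x - (w ^+ 2 *: ((2 * w)^-1 *: (S1 x - S2 x))
    - B (B ((2 * w)^-1 *: (S1 x - S2 x)))) =
    (2 * w)^-1 *: (w *: ((x - u1) + (x - u2)) + B ((x - u1) - (x - u2))).
  apply: (scalerI w0); rewrite E3 scalerBr !scalerA mulfV// !scale1r.
  rewrite [2 * w]mulrC -scalerA scaler_nat mulr2n.
  rewrite [x - u1 + (x - u2)]addrACA -opprD [x - u1 - (x - u2)]subrACA subrr sub0r.
  rewrite [in B (- _)]opprB BB [in RHS]scalerBr -[RHS]addrA; congr (_ + _).
  rewrite scalerDr opprB !opprD addrACA [in RHS]addrACA.
  by rewrite [B u2 - _]addrC.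
rewrite rnormZc cnormV cnormM w1 mulr1 (_ : cnorm 2 = 2); last first.
  by rewrite -(rmorph_nat (real_complex R) 2) cnorm_real ger0_norm.
rewrite ler_pdivrMl//; apply: (le_trans (rnormD _ _)).
rewrite rnormZc w1 mul1r.
have := Bb (x - u1 - (x - u2)); have := rnormD (x - u1) (x - u2).
have := rnormB (x - u1) (x - u2).
set f1 := rnorm _ in F1 *; set f2 := rnorm _ in F2 *.
move=> h1 h2 h3.
have : rnorm (B (x - u1 - (x - u2))) <= b * (f1 + f2).
  by rewrite (le_trans h3)// ler_wpM2l.
move=> h4; rewrite [leRHS](_ : _ = 2 * (eta * rnorm x) + b * (2 * (eta * rnorm x))); last by ring.
apply: lerD; first by lra.
by apply: (le_trans h4); rewrite ler_wpM2l//; lra.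
Qed.

(** The right-hand side of the resolvent identity for squares averages two
resolvents on the unit circle with weight [|(2w)^-1| = 1/2], so neither M nor kappa
increases. *)
Lemma approx_pair_sqr (B B' : {linear V -> V}) (b b' M kappa : R) :
  0 <= b -> 0 <= b' -> bounded_by B b -> bounded_by B' b' ->
  approx_pair B B' M kappa -> approx_pair (B \o B) (B' \o B') M kappa.
Proof.
move=> b0 b'0 Bb Bb' BB' v v1 eta eta0.
have [w wv] : exists w : R[i], w ^+ 2 = v by exists (sqrtc v); exact: sqr_sqrtc.
have w1 : cnorm w = 1.
  have := v1; rewrite -wv expr2 cnormM -expr2 => /eqP.
  by rewrite sqrp_eq1 ?cnorm_ge0// => /eqP.
pose d := eta / (1 + b + b').
have bb0 : 0 < 1 + b + b' by rewrite -addrA ltr_pwDl// addr_ge0.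
have d0 : 0 < d by rewrite divr_gt0.
have [S1 [S1' [M1 k1 a1 a1']]] := BB' w w1 d d0.
have [S2 [S2' [M2 k2 a2 a2']]] := BB' (- w) (ltac:(by rewrite cnormN)) d d0.
have c1 : cnorm (2 * w)^-1 = 2^-1.
  rewrite cnormV cnormM w1 mulr1 -(rmorph_nat (real_complex R) 2) cnorm_real.
  by rewrite ger0_norm.
exists (fun x => (2 * w)^-1 *: (S1 x - S2 x)).
exists (fun x => (2 * w)^-1 *: (S1' x - S2' x)); split => [x|x|x|x].
- rewrite rnormZc c1; have := rnormB (S1 x) (S2 x).
  by have := M1 x; have := M2 x; lra.
- rewrite -scalerBr subrACA rnormZc c1.
  have := rnormB (S1 x - S1' x) (S2 x - S2' x).
  by have := k1 x; have := k2 x; lra.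
- rewrite -wv; apply: le_trans (sqr_approx_inverse b0 Bb w1 a1 a2 x) _.
  rewrite ler_wpM2r ?rnorm_ge0// /d mulrA ler_pdivrMr// mulrC.
  by rewrite ler_wpM2l ?(ltW eta0)// lerDl.
- rewrite -wv; apply: le_trans (sqr_approx_inverse b'0 Bb' w1 a1' a2' x) _.
  rewrite ler_wpM2r ?rnorm_ge0// /d mulrA ler_pdivrMr// mulrC.
  by rewrite ler_wpM2l ?(ltW eta0)// addrAC lerDl.
Qed.

Lemma iter_bounded_by (B : V -> V) (b : R) n : 0 <= b -> bounded_by B b ->
  bounded_by (iter n B) (b ^+ n).
Proof.
move=> b0 Bb; elim: n => [|n IH] x /=; first by rewrite expr0 mul1r.
by rewrite (le_trans (Bb _))// exprS -mulrA ler_wpM2l.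
Qed.

Lemma iter_linear (B : {linear V -> V}) n :
  exists C : {linear V -> V}, (C : V -> V) = iter n B.
Proof.
elim: n => [|n [C CE]]; first by exists (idfun : {linear V -> V}).
by exists (B \o C : {linear V -> V}); apply/funext => x /=; rewrite CE.
Qed.

Lemma approx_pair_iter (B B' : {linear V -> V}) (b b' M kappa : R) m :
  0 <= b -> 0 <= b' -> bounded_by B b -> bounded_by B' b' ->
  approx_pair B B' M kappa ->
  approx_pair (iter (2 ^ m) B) (iter (2 ^ m) B') M kappa.
Proof.
move=> b0 b'0 Bb Bb' BB'; elim: m => [//|m IH].
have [C CE] := iter_linear B (2 ^ m); have [C' CE'] := iter_linear B' (2 ^ m).
rewrite expnS mul2n -addnn.
rewrite (_ : iter _ B = C \o C); last first.
  by apply/funext => x; rewrite iterD /= CE.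
rewrite (_ : iter _ B' = C' \o C'); last first.
  by apply/funext => x; rewrite iterD /= CE'.
apply: (@approx_pair_sqr _ _ (b ^+ (2 ^ m)) (b' ^+ (2 ^ m))).
- exact: exprn_ge0.
- exact: exprn_ge0.
- by rewrite CE; exact: iter_bounded_by.
- by rewrite CE'; exact: iter_bounded_by.
by rewrite CE CE'.
Qed.

(** If B is nearly 0, the resolvents at 1 of B, hence of B', are near the identity:
[id - S'] has norm at most 1/4. Then [B' = B' (id - S') + B' S'] with [B' S']
approximately [S' - id] bounds the norm of B' by a quarter of itself plus 5/16. *)
Lemma approx_pair_small (B B' : {linear V -> V}) (beta b' M : R) :
  bounded_by B beta -> beta * M <= 16^-1 -> 0 <= beta -> bounded_by B' b' ->
  approx_pair B B' M 8^-1 -> bounded_by B' 2^-1.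
Proof.
move=> Bb bM b0 Bb' BB'.
have [T TE] : exists T : bounded_op V V, forall x, T x = B' x.
  by apply: (bounded_op_of _ Bb') => a x y; exact: linearP.
have cnorm1 : cnorm (1 : R[i]) = 1 by rewrite -[1]/(1%:C) cnorm_real normr1.
have e0 : 0 < 16^-1 :> R by rewrite invr_gt0.
have [S [S' [SM kap a1 a2]]] := BB' 1 cnorm1 16^-1 e0.
have key x : rnorm (T x) <= (op_norm T / 4 + 5 / 16) * rnorm x.
  have h1 : rnorm (B (S x)) <= 16^-1 * rnorm x.
    rewrite (le_trans (Bb _))//; apply: le_trans (ler_wpM2l b0 (SM x)) _.
    by rewrite mulrA ler_wpM2r ?rnorm_ge0.
  have h2 : rnorm (x - S' x) <= 4^-1 * rnorm x.
    have := a1 x; have := kap x => /=; rewrite scale1r => k1 k2.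
    have : rnorm (x - S' x) <= rnorm (x - S x) + rnorm (S x - S' x).
      exact: rnorm_dist.
    have : rnorm (x - S x) <= rnorm (x - (S x - B (S x))) + rnorm (B (S x)).
      have := rnormB (x - (S x - B (S x))) (B (S x)).
      by rewrite -addrA -opprD subrK.
    lra.
  have h3 : rnorm (B' (S' x)) <= 5 / 16 * rnorm x.
    have := a2 x => /=; rewrite scale1r => k2.
    have := rnormB (x - (S' x - B' (S' x))) (x - S' x).
    rewrite (_ : x - (S' x - B' (S' x)) - (x - S' x) = B' (S' x)); first lra.
    by rewrite subrACA subrr sub0r !opprB addrC subrK.
  have -> : T x = T (x - S' x) + B' (S' x) by rewrite -TE -linearD subrK.
  rewrite (le_trans (rnormD _ _))// mulrDl; apply: lerD => //.
  by rewrite (le_trans (op_normP _ _))// -mulrA ler_wpM2l ?op_norm_ge0//.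
have Tn : op_norm T <= op_norm T / 4 + 5 / 16.
  apply: op_norm_le_bound => //.
  by rewrite addr_ge0// divr_ge0// op_norm_ge0.
move=> x; rewrite -TE (le_trans (op_normP T x))// ler_wpM2r ?rnorm_ge0//; lra.
Qed.

(** Squaring often enough makes the power of B as small as [approx_pair_small] asks,
while M and kappa = 1/8 stay what they were for B and B'. *)
Lemma approx_pair_power_small (B B' : {linear V -> V}) (b b' M : R) (k : nat) :
  0 <= b -> 0 <= b' -> 0 <= M -> bounded_by B b -> bounded_by B' b' ->
  approx_pair B B' M 8^-1 -> (0 < k)%N -> bounded_by (iter k B) 2^-1 ->
  exists2 k', (0 < k')%N & bounded_by (iter k' B') 2^-1.
Proof.
move=> b0 b'0 M0 Bb Bb' BB' k0 Bk.
have [N [r [C [r0 r1 C0 [N1 N2 _ _ N5]]]]] := exists_adapted_norm k0 b0 Bb Bk.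
have Br n : bounded_by (iter n B) (C * r ^+ n).
  move=> x; rewrite (le_trans (N1 _))// mulrAC.
  elim: n => [|n IH] /=; first by rewrite expr0 mulr1.
  by rewrite (le_trans (N5 _))// exprS mulrCA ler_wpM2l// ltW.
have : C * M * r ^+ n @[n --> \oo] --> (0 : R).
  rewrite -[X in _ --> X](mulr0 (C * M)); apply: cvgMl_tmp => //.
  by apply: cvg_expr; rewrite ger0_norm// ltW.
have e0 : 0 < 16^-1 :> R by rewrite invr_gt0.
move=> /cvgrPdist_lt/(_ _ e0)[m _ /(_ (2 ^ m)%N) /=].
move=> /(_ (ltnW (ltn_expl m (ltnSn 1)))).
rewrite sub0r normrN ger0_norm ?mulr_ge0 ?exprn_ge0 ?(ltW C0) ?(ltW r0)// => small.
exists (2 ^ m)%N; first by rewrite expn_gt0.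
have [D DE] := iter_linear B (2 ^ m); have [D' DE'] := iter_linear B' (2 ^ m).
rewrite -DE'; apply: (@approx_pair_small D D' (C * r ^+ (2 ^ m)) (b' ^+ (2 ^ m)) M).
- by rewrite DE; exact: Br.
- by rewrite mulrAC ltW.
- by rewrite mulr_ge0 ?exprn_ge0 ?(ltW C0) ?(ltW r0).
- by rewrite DE'; exact: iter_bounded_by.
by rewrite DE DE'; exact: (approx_pair_iter _ b0 b'0 Bb Bb' BB').
Qed.

End squaring.

Section euler_steps.
Context {R : realType} {V : normedModType R[i]}.
Variable Q : bounded_op V V.

(** The homotopy from [e Q], at s = 1, to the explicit Euler step [id + e Q] of the
flow of Q, at s = 0. *)
Definition euler_step (e s : R) : {linear V -> V} :=
  ((1 - s)%:C \*: idfun) \+ (e%:C \*: Q).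

Lemma euler_stepE e s x : euler_step e s x = (1 - s)%:C *: x + e%:C *: Q x.
Proof. by []. Qed.

Lemma euler_step_bounded e s : 0 <= e -> 0 <= s -> s <= 1 ->
  bounded_by (euler_step e s) (1 - s + e * op_norm Q).
Proof.
move=> e0 s0 s1 x; rewrite euler_stepE (le_trans (rnormD _ _))// mulrDl.
rewrite !rnormZr ger0_norm ?subr_ge0// lerD2l ger0_norm// -mulrA.
by rewrite ler_wpM2l// op_normP.
Qed.

Hypothesis Rex : forall l : R[i], 0 <= complex.Re l ->
  boundedly_invertible (fun x => l *: x - Q x).

(** The point w of the unit circle is in the resolvent set of [euler_step e s] when
[l = (w - (1 - s)) / e] is in the resolvent set of Q. If [Re l < - h] and [|l| < q + 1], then
[w = (1 - s) + e l] lies inside the unit disc, so l is in the region of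
[resolvent_approx]. *)
Lemma euler_step_approx : exists e M : R, [/\ 0 < e, 0 < M, e * op_norm Q <= 2^-1 &
  forall s, 0 <= s -> s <= 1 -> forall w, cnorm w = 1 -> forall eta, 0 < eta ->
  exists S : {linear V -> V}, [/\ bounded_by S M,
    bounded_by (fun x => x - (w *: S x - euler_step e s (S x))) eta &
    bounded_by (fun x => x - S (w *: x - euler_step e s x)) eta]].
Proof.
have [M [h [M0 h0 h1 H]]] := resolvent_approx Rex.
have := op_norm_ge0 Q; set q := op_norm Q in H *; move=> q0.
(* for |l| < q + 1 the quadratic term e^2 |l|^2 of |w|^2 is then less than e h *)
pose e := h / (q + 1) ^+ 2.
have q1 : 1 <= (q + 1) ^+ 2 by rewrite exprn_ege1// lerDr.
have q1' : 0 < (q + 1) ^+ 2 by exact: lt_le_trans q1.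
have e0 : 0 < e by rewrite divr_gt0.
have eq2 : e * (q + 1) ^+ 2 = h by rewrite divfK// gt_eqF.
have eh : e <= h by rewrite -eq2 ler_peMr// ltW.
have e0C : e%:C != 0 :> R[i] by rewrite -[0]/(0%:C) (inj_eq (@complexI R)) gt_eqF.
exists e, (M / e); split => //; first by rewrite divr_gt0.
  rewrite (le_trans _ h1)// -eq2 ler_wpM2l// ?(ltW e0)//; nra.
move=> s s0 s1 w w1 eta eta0.
pose l := e%:C^-1 * (w - (1 - s)%:C).
have lE : w = (1 - s)%:C + e%:C * l by rewrite /l mulVKf// addrC subrK.
have lP : (- h <= complex.Re l) || (q + 1 <= cnorm l).
  have [//|/= lh] := leP (- h) (complex.Re l).
  rewrite leNgt; apply/negP => lq.
  have := cnorm_sqr w; rewrite w1 expr1n lE.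
  have : cnorm l ^+ 2 < (q + 1) ^+ 2 by rewrite ltrXn2r// ?nnegrE ?cnorm_ge0// addr_ge0.
  rewrite cnorm_sqr; case: (l) lh => a b /= ah.
  rewrite !mul0r subr0 addr0 add0r => ab E.
  have : e * (a ^+ 2 + b ^+ 2) < h by rewrite -eq2 ltr_pM2l.
  move=> ab2; have : 1 <= (1 - s) ^+ 2 - 2 * (1 - s) * (e * h) + e * h.
    have : e * (e * (a ^+ 2 + b ^+ 2)) <= e * h by rewrite ler_wpM2l// ltW.
    have : (1 - s) * (e * a) <= (1 - s) * (e * - h).
      apply: ler_wpM2l; first by rewrite subr_ge0.
      by apply: ler_wpM2l; exact: ltW.
    by move: E; rewrite !expr2; lra.
  have c0 : 0 < e * h by rewrite mulr_gt0.
  have c1 : e * h <= 4^-1.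
    rewrite (@le_trans _ _ (2^-1 * 2^-1))//; last lra.
    by apply: ler_pM => //; [exact: ltW|exact: ltW|exact: le_trans h1].
  move: c0 c1; set c := e * h => c0 c1; set t := 1 - s => ht.
  have t0 : 0 <= t by rewrite subr_ge0.
  have t1 : t <= 1 by rewrite /t; lra.
  have : t ^+ 2 <= t by rewrite expr2; nra.
  nra.
have [S [S1 S2 S3]] := H l lP eta eta0.
have E x : w *: x - euler_step e s x = e%:C *: (l *: x - Q x).
  rewrite euler_stepE lE scalerDl opprD addrACA subrr add0r.
  by rewrite scalerBr scalerA.
exists (e%:C^-1 \*: S); split => x.
- rewrite /= rnormZc cnormV cnorm_real gtr0_norm// mulrAC mulrC.
  by rewrite ler_wpM2r// invr_ge0 ltW.
- rewrite E /= (bopZ Q) [l *: _]scalerA [l * _]mulrC -scalerA -scalerBr scalerA.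
  by rewrite mulfV// scale1r; exact: S2.
- have SZ y : S (e%:C *: y) = e%:C *: S y by exact: linearZ.
  by rewrite E /= SZ scalerA mulVf// scale1r; exact: S3.
Qed.

(** Continuation from s = 1, where [e Q] has norm at most 1/2, down to s = 0 in J
equal steps. The resolvent identity bounds the distance of neighbouring resolvents
by [M^2 / J] up to the approximation errors. *)
Theorem spectrum_left_half_plane_contraction : exists e : R, 0 < e /\
  exists2 k, (0 < k)%N & bounded_by (iter k (euler_step e 0)) 2^-1.
Proof.
have [e [M [e0 M0 eq H]]] := euler_step_approx.
exists e; split => //.
(* M^2 / J <= 1/16 leaves room for two errors of 1/32 within kappa = 1/8 *)
pose J := (Num.truncn (16 * M ^+ 2)).+1.
have J0 : 0 < J%:R :> R by rewrite ltr0n.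
have JM : M ^+ 2 / J%:R <= 16^-1.
  by rewrite ler_pdivrMr// ler_pdivlMl// ltW// truncnS_gt.
suff : forall j, (j <= J)%N ->
    exists2 k, (0 < k)%N & bounded_by (iter k (euler_step e (1 - j%:R / J%:R))) 2^-1.
  by move=> /(_ _ (leqnn J)); rewrite divff ?subrr// gt_eqF.
elim=> [_|j IH jJ].
  exists 1%N => //; rewrite mul0r subr0 /=.
  apply: bounded_by_le (euler_step_bounded (ltW e0) ler01 (lexx _)).
  by rewrite subrr add0r.
have [k k0 Bk] := IH (ltnW jJ).
pose s : R := 1 - j%:R / J%:R; pose s' : R := 1 - j.+1%:R / J%:R.
have s0 : 0 <= s by rewrite subr_ge0 ler_pdivrMr// mul1r ler_nat ltnW.
have s1 : s <= 1 by rewrite gerBl divr_ge0// ltW.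
have s'0 : 0 <= s' by rewrite subr_ge0 ler_pdivrMr// mul1r ler_nat.
have s'1 : s' <= 1 by rewrite gerBl divr_ge0// ltW.
have ss' : - (1 - s) = - (1 - s') + J%:R^-1.
  by rewrite /s /s' -[j.+1%:R]natr1; field; rewrite gt_eqF.
rewrite -/s in Bk; rewrite -/s'; clearbody s s'.
have bq : 0 <= e * op_norm Q by rewrite mulr_ge0 ?op_norm_ge0// ltW.
apply: (@approx_pair_power_small _ _ (euler_step e s) (euler_step e s')
  (1 - s + e * op_norm Q) (1 - s' + e * op_norm Q) M k) => //.
- by rewrite addr_ge0// subr_ge0.
- by rewrite addr_ge0// subr_ge0.
- exact: ltW.
- exact: (euler_step_bounded (ltW e0)).
- exact: (euler_step_bounded (ltW e0)).
move=> w w1 eta eta0.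
pose d := Num.min eta (32 * M)^-1.
have d0 : 0 < d by rewrite lt_min eta0 invr_gt0 mulr_gt0.
have [S [S1 S2 S3]] := H s s0 s1 w w1 d d0.
have [S' [S1' S2' S3']] := H s' s'0 s'1 w w1 d d0.
exists S, S'; split => //.
- move=> x /=.
  pose y := S' x.
  (* the resolvent identity, with the defects of S and S' as error terms *)
  have -> : S x - S' x = S (x - (w *: y - euler_step e s' y))
      - (y - S (w *: y - euler_step e s y))
      - (J%:R^-1)%:C *: S y.
    have SB u v : S (u - v) = S u - S v by exact: linearB.
    have SD u v : S (u + v) = S u + S v by exact: linearD.
    have SZ (a : R[i]) u : S (a *: u) = a *: S u by exact: linearZ.
    have -> : w *: y - euler_step e s y =
        (w *: y - euler_step e s' y) + (J%:R^-1)%:C *: y.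
      rewrite -addrA; congr (_ + _); rewrite !euler_stepE !opprD [RHS]addrAC; congr (_ + _).
      rewrite -!scaleNr -scalerDl; congr (_ *: _).
      by rewrite -!rmorphN -rmorphD /= ss'.
    move: (w *: y - euler_step e s' y) => u.
    by rewrite SB SD SZ opprB !addrA subrK addrAC addrK.
  rewrite (le_trans (rnormB _ _))//.
  have yM : rnorm y <= M * rnorm x by exact: S1'.
  have dM : M * d <= 32^-1.
    rewrite mulrC -ler_pdivlMr// -invfM mulrC; rewrite mulrC.
    by rewrite ge_min lexx orbT.
  have x0 := rnorm_ge0 x.
  have h1 : rnorm (S (x - (w *: y - euler_step e s' y))) <= 32^-1 * rnorm x.
    rewrite (le_trans (S1 _))//; apply: le_trans (ler_wpM2l (ltW M0) (S2' x)) _.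
    by rewrite mulrA ler_wpM2r.
  have h2 : rnorm (y - S (w *: y - euler_step e s y)) <= 32^-1 * rnorm x.
    rewrite (le_trans (S3 y))//; apply: le_trans (ler_wpM2l (ltW d0) yM) _.
    by rewrite mulrA [d * M]mulrC ler_wpM2r.
  have h3 : rnorm ((J%:R^-1)%:C *: S y) <= 16^-1 * rnorm x.
    rewrite rnormZr ger0_norm ?invr_ge0// (@le_trans _ _ (J%:R^-1 * (M * (M * rnorm x))))//.
      rewrite ler_wpM2l ?invr_ge0// (le_trans (S1 _))// ler_wpM2l// ltW//.
    by rewrite mulrC mulrA -expr2 mulrAC ler_wpM2r.
  have := rnormB (S (x - (w *: y - euler_step e s' y))) (y - S (w *: y - euler_step e s y)).
  lra.
- by apply: bounded_by_le S2; rewrite ge_min lexx.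
- by apply: bounded_by_le S2'; rewrite ge_min lexx.
Qed.

End euler_steps.

Local Notation mu := (@lebesgue_measure _).

(** * Simple functions and their integrals *)

Section step_maps.
Context {R : realType}.

(** Simple functions into an arbitrary type: pairing two of them, or restricting one
by a measurable condition, stays within the class without any structure on the
values. *)
Definition step_map (T : Type) (p : R -> T) :=
  finite_set (range p) /\ forall A : set T, measurable (p @^-1` A).

Lemma step_mapP (V : normedModType R[i]) (s : R -> V) :
  simple_fun s <-> step_map s.
Proof.
split => [ss|[fs ms]]; last by split.
by split; [exact: ss.1|move=> A; exact: simple_fun_preimage].
Qed.

Lemma step_map_fibers (T : Type) (p : R -> T) : finite_set (range p) ->
  (forall w, measurable (p @^-1` [set w])) -> step_map p.
Proof.
move=> fp mp; split => // A; rewrite [X in measurable X](_ : _ =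
    \bigcup_(v in range p `&` A) (p @^-1` [set v])); last first.
  apply/seteqP; split=> [t At|t [v [_ Av] /= -> //]].
  by exists (p t) => //; split => //; exists t.
by apply: fin_bigcup_measurable => //; exact: finite_setIl.
Qed.

Lemma step_map_comp (T W : Type) (p : R -> T) (h : T -> W) :
  step_map p -> step_map (h \o p).
Proof.
move=> [fp mp]; split=> [|A]; last by rewrite comp_preimage; exact: mp.
by apply: sub_finite_set (finite_image h fp) => _ [t _ <-]; exists (p t) => //; exists t.
Qed.

Lemma step_map_pair (T W : Type) (p : R -> T) (r : R -> W) :
  step_map p -> step_map r -> step_map (fun t => (p t, r t)).
Proof.
move=> [fp mp] [fr mr]; apply: step_map_fibers.
  apply: sub_finite_set (finite_setX fp fr) => _ [t _ <-].
  by split => /=; exists t.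
move=> [v w]; rewrite [X in measurable X](_ : _ =
    p @^-1` [set v] `&` r @^-1` [set w]); first exact: measurableI.
by apply/seteqP; split => [t [<- <-]//|t [/= -> ->]].
Qed.

Lemma step_map_cst (T : Type) (c : T) : step_map (fun _ : R => c).
Proof.
apply: step_map_fibers; first by apply: sub_finite_set (finite_set1 c) => _ [t _ <-].
move=> w; have [->|cw] := pselect (w = c).
  by rewrite [X in measurable X](_ : _ = setT)//; apply/seteqP; split.
rewrite [X in measurable X](_ : _ = set0)//; apply/seteqP; split => // t /= E.
by apply: cw; rewrite E.
Qed.

Lemma step_map_mem (E : set R) : measurable E -> step_map (fun t => t \in E).
Proof.
move=> mE; apply: step_map_fibers.
  apply: sub_finite_set (finite_set2 true false) => _ [t _ <-] /=.
  by case: (t \in E); [left|right].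
case.
  by rewrite [X in measurable X](_ : _ = E)//; apply/seteqP; split=> t /= => [/set_mem|/mem_set].
rewrite [X in measurable X](_ : _ = ~` E); first exact: measurableC.
apply/seteqP; split=> t /=; first by move/negbT; rewrite notin_setE.
by move=> h; apply/negbTE; rewrite notin_setE.
Qed.

Lemma step_map_if (T : Type) (E : set R) (p r : R -> T) : measurable E ->
  step_map p -> step_map r -> step_map (fun t => if t \in E then p t else r t).
Proof.
move=> mE sp sr.
have := step_map_pair (step_map_mem mE) (step_map_pair sp sr).
exact: (@step_map_comp _ _ _ (fun z : bool * (T * T) => if z.1 then z.2.1 else z.2.2)).
Qed.

Lemma step_map_shift (T : Type) (p : R -> T) (a : R) :
  step_map p -> step_map (fun t => p (t + a)).
Proof.
move=> [fp mp]; split=> [|A].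
  by apply: sub_finite_set fp => _ [t _ <-]; exists (t + a).
have ma : measurable_fun [set: R] (fun t : R => t + a).
  exact: measurable_funD.
by have := ma measurableT _ (mp A); rewrite setTI.
Qed.

End step_maps.

Section simple_integral_theory.
Context {R : realType} {V : normedModType R[i]}.
Variable D : set R.
Hypotheses (mD : measurable D) (fD : (mu D < +oo)%E).

Lemma mu_fin (A : set R) : measurable A -> mu (D `&` A) \is a fin_num.
Proof.
move=> mA; rewrite ge0_fin_numE//; apply: le_lt_trans fD.
by apply: le_measure; rewrite ?inE//; exact: measurableI.
Qed.

(** Summing over the values of p instead of those of [h \o p] only splits fibres.
It lets several simple functions be integrated over the fibres of one tuple. *)
Lemma simple_integral_comp (W : normedModType R[i]) (T : choiceType)
    (p : R -> T) (h : T -> W) :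
  step_map p -> simple_integral D (h \o p) =
  \sum_(w \in range p) (fine (mu (D `&` p @^-1` [set w])))%:C *: h w.
Proof.
move=> sp; have sh := step_map_comp h sp.
pose m w := fine (mu (D `&` p @^-1` [set w])).
have mE v : (fine (mu (D `&` (h \o p) @^-1` [set v]))) =
    \sum_(w <- fset_set (range p)) (if h w == v then m w else 0).
  apply: EFin_inj; rewrite fineK ?mu_fin//; last exact: sh.2.
  rewrite (_ : D `&` _ = \bigcup_(w in range p `&` [set w | h w = v])
      (D `&` p @^-1` [set w])); last first.
    apply/seteqP; split => [t [Dt /= htv]|t [w [_ /= hw] [Dt /= ptw]]].
      by exists (p t) => //; split => //; exists t.
    by split => //=; rewrite ptw.
  rewrite measure_fin_bigcup//=; last 3 first.
  - by apply: finite_setIl; exact: sp.1.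
  - by move=> w1 w2 _ _ [t [[_ <-] [_ <-]]].
  - by move=> w _; apply: measurableI => //; exact: sp.2.
  rewrite fsbig_mkcondr fsbig_finite; last exact: sp.1.
  rewrite /= -sumEFin; apply: eq_bigr => w _.
  rewrite /patch; case: ifPn => [/[!inE] /= ->|].
    by rewrite eqxx fineK// mu_fin//; exact: sp.2.
  by rewrite notin_setE/= => /eqP/negbTE ->.
rewrite /simple_integral fsbig_finite; last exact: sh.1.
rewrite fsbig_finite; last exact: sp.1.
under eq_bigr do rewrite mE rmorph_sum/= scaler_suml.
rewrite exchange_big /= big_seq [RHS]big_seq; apply: eq_bigr => w.
rewrite in_fset_set; last exact: sp.1.
rewrite inE => -[t _ ptw].
rewrite (bigD1_seq (h w)) /= ?fset_uniq//; last first.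
  rewrite in_fset_set; last exact: sh.1.
  by rewrite inE; exists t => //; rewrite /= ptw.
rewrite eqxx big1 ?addr0// => v vw; rewrite eq_sym (negbTE vw).
by rewrite scale0r.
Qed.

Lemma simple_integralD (s r : R -> V) : simple_fun s -> simple_fun r ->
  simple_integral D (s + r) = simple_integral D s + simple_integral D r.
Proof.
move=> /step_mapP ss /step_mapP sr; have sp := step_map_pair ss sr.
rewrite (_ : s + r = (fun z => z.1 + z.2) \o (fun t => (s t, r t)))//.
rewrite [in RHS](_ : s = fst \o (fun t => (s t, r t)))//.
rewrite [in X in _ = _ + X](_ : r = snd \o (fun t => (s t, r t)))//.
rewrite !(@simple_integral_comp _ (V * V)%type)//.
rewrite !fsbig_finite; try exact: sp.1.
rewrite -big_split; apply: eq_bigr => z _ /=.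
by rewrite scalerDr.
Qed.

Lemma simple_integral_norm (s : R -> V) : simple_fun s ->
  ((rnorm (simple_integral D s))%:E <= \int[mu]_(t in D) (rnorm (s t))%:E)%E.
Proof.
move=> /step_mapP ss.
have E t : (rnorm (s t))%:E =
    (\sum_(v \in range s) (rnorm v)%:E * (\1_(s @^-1` [set v]) t)%:E)%E.
  rewrite fsbig_finite; last exact: ss.1.
  rewrite (bigD1_seq (s t)) /= ?fset_uniq//; last first.
    by rewrite in_fset_set; [rewrite inE; exists t|exact: ss.1].
  rewrite indicE mem_set// mule1 big1 ?adde0// => v vs.
  rewrite indicE memNset ?mule0//= => E; by rewrite E eqxx in vs.
under eq_integral do rewrite E.
rewrite ge0_integral_fsum//=; last 3 first.
- by move=> v; apply: measurable_funeM; apply/measurable_EFinP;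
    apply: measurable_indic; exact: ss.2.
- by move=> v t _; rewrite mule_ge0// lee_fin rnorm_ge0.
- exact: ss.1.
rewrite fsbig_finite; last exact: ss.1.
rewrite /simple_integral fsbig_finite; last exact: ss.1.
apply: (@le_trans _ _ (\sum_(v <- fset_set (range s))
    (fine (mu (D `&` s @^-1` [set v])) * rnorm v))%:E).
  rewrite lee_fin (le_trans (rnorm_sum _ _ _))//; apply: ler_sum => v _.
  by rewrite rnormZr ger0_norm// fine_ge0.
rewrite -sumEFin; apply: lee_sum => v _.
rewrite ge0_integralZl//=; last 2 first.
- by apply/measurable_EFinP/measurable_indic; exact: ss.2.
- by rewrite lee_fin rnorm_ge0.
rewrite integral_indic//=; last exact: ss.2.
by rewrite muleC EFinM setIC fineK// setIC mu_fin//; exact: ss.2.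
Qed.

Lemma simple_integral_map (W : normedModType R[i]) (T : bounded_op V W)
    (s : R -> V) : simple_fun s ->
  simple_integral D (T \o s) = T (simple_integral D s).
Proof.
move=> /step_mapP ss; rewrite (@simple_integral_comp _ V)//.
rewrite /simple_integral !fsbig_finite; try exact: ss.1.
rewrite linear_sum; apply: eq_bigr => v _.
by rewrite /= bopZ.
Qed.

End simple_integral_theory.

(** * The Bochner integral *)

Lemma ereal_cvg0P (R : realType) (u : nat -> \bar R) : (forall n, (0 <= u n)%E) ->
  u n @[n --> \oo] --> 0%E <->
  (forall e : R, 0 < e -> \forall n \near \oo, (u n < e%:E)%E).
Proof.
move=> u0; split=> [/fine_cvgP[uf ul] e e0|ul].
  move/cvgrPdist_lt : ul => /(_ e e0); apply: filterS2 uf => n un.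
  by rewrite sub0r normrN ger0_norm ?fine_ge0//= -{2}(fineK un) lte_fin.
have uf : \forall n \near \oo, u n \is a fin_num.
  by have := ul 1 ltr01; apply: filterS => n un; rewrite ge0_fin_numE// (lt_trans un)// ltry.
apply/fine_cvgP; split => //; apply/cvgrPdist_lt => e e0.
apply: filterS2 uf (ul e e0) => n un une.
by rewrite sub0r normrN ger0_norm ?fine_ge0//= -lte_fin fineK.
Qed.

Section L1norm.
Context {R : realType} {V : normedModType R[i]}.
Variable D : set R.
Hypothesis mD : measurable D.
Implicit Types f g h : R -> V.

Definition L1norm f : \bar R := (\int[mu]_(t in D) (rnorm (f t))%:E)%E.

Lemma L1norm_ge0 f : (0 <= L1norm f)%E.
Proof. by apply: integral_ge0 => t _; rewrite lee_fin rnorm_ge0. Qed.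

Lemma eq_L1norm f g : (forall t, D t -> rnorm (f t) = rnorm (g t)) ->
  L1norm f = L1norm g.
Proof. by move=> fg; apply: eq_integral => t /[1!inE] Dt; rewrite fg. Qed.

Lemma strongly_measurable_rnormE f : strongly_measurable D f ->
  measurable_fun D (fun t => (rnorm (f t))%:E).
Proof. by move=> fm; apply/measurable_EFinP; exact: strongly_measurable_rnorm. Qed.

Lemma simple_strongly_measurable f : simple_fun f -> strongly_measurable D f.
Proof. by move=> sf; exists (fun=> f); split => // t _; exact: cvg_cst. Qed.

Lemma strongly_measurableN f : strongly_measurable D f -> strongly_measurable D (- f).
Proof. by move=> fm; rewrite -scaleN1r; exact: strongly_measurableZ. Qed.

Lemma strongly_measurableB f g : strongly_measurable D f ->
  strongly_measurable D g -> strongly_measurable D (f - g).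
Proof. by move=> fm gm; apply: strongly_measurableD => //; exact: strongly_measurableN. Qed.

Lemma L1norm_le f (G : R -> R) : strongly_measurable D f ->
  measurable_fun D G -> (forall t, D t -> rnorm (f t) <= G t) ->
  (L1norm f <= \int[mu]_(t in D) (G t)%:E)%E.
Proof.
move=> fm mG fG; apply: ge0_le_integral => //.
- by move=> t _; rewrite lee_fin rnorm_ge0.
- exact: strongly_measurable_rnormE.
- exact/measurable_EFinP.
Qed.

Lemma L1normD f g : strongly_measurable D f -> strongly_measurable D g ->
  (L1norm (f + g)%R <= L1norm f + L1norm g)%E.
Proof.
move=> fm gm; rewrite /L1norm -ge0_integralD//=; last 4 first.
- by move=> t _; rewrite lee_fin rnorm_ge0.
- exact: strongly_measurable_rnormE.
- by move=> t _; rewrite lee_fin rnorm_ge0.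
- exact: strongly_measurable_rnormE.
apply: (@L1norm_le (f + g) (fun t => rnorm (f t) + rnorm (g t))).
- exact: strongly_measurableD.
- by apply: measurable_funD; exact: strongly_measurable_rnorm.
by move=> t _; exact: rnormD.
Qed.

Lemma L1normBC f g : L1norm (f - g)%R = L1norm (g - f).
Proof. by apply: eq_L1norm => t _; exact: rnormBC. Qed.

Lemma L1norm_dist g f h : strongly_measurable D f -> strongly_measurable D g ->
  strongly_measurable D h -> (L1norm (f - h)%R <= L1norm (f - g)%R + L1norm (g - h)%R)%E.
Proof.
move=> fm gm hm; rewrite (_ : f - h = (f - g) + (g - h)).
  by apply: L1normD; exact: strongly_measurableB.
by rewrite addrA subrK.
Qed.

(** Cutting the approximants off where they exceed [2 * rnorm (f t)] keeps pointwise
convergence and makes [3 * rnorm (f t)] a dominating function. *)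
Lemma simple_approximation f : strongly_measurable D f -> (L1norm f < +oo)%E ->
  exists s : nat -> R -> V, (forall n, simple_fun (s n)) /\
    L1norm (f - s n) @[n --> \oo] --> 0%E.
Proof.
move=> fm foo; have [s0 [ss0 s0f]] := fm.
pose E n := D `&` [set t | rnorm (s0 n t) <= 2 * rnorm (f t)].
have mE n : measurable (E n).
  apply: measurable_fun_le => //.
    by apply: measurable_funTS; exact: simple_fun_rnorm.
  by apply: measurable_funM => //; exact: strongly_measurable_rnorm.
pose s n t := if t \in E n then s0 n t else 0.
have ss n : simple_fun (s n).
  by apply/step_mapP/step_map_if => //; [exact/step_mapP|exact: step_map_cst].
exists s; split => //.
have key t : D t -> rnorm (f t - s n t) @[n --> \oo] --> (0 : R).
  move=> Dt; have /rcvgP sft := s0f t Dt.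
  apply/cvgrPdist_lt => e e0; have [f0|f0] := eqVneq (f t) 0.
    apply: nearW => n; rewrite (_ : s n t = 0) ?f0 ?subrr ?rnorm0 ?subr0 ?normr0//.
    rewrite /s; case: ifPn => // /[1!inE] -[_ /=]; rewrite f0 rnorm0 mulr0 => h.
    by apply: rnorm0_eq0; apply/eqP; rewrite eq_le h rnorm_ge0.
  have ft0 : 0 < rnorm (f t).
    by rewrite lt_neqAle rnorm_ge0 andbT eq_sym; apply: contra_neq f0; exact: rnorm0_eq0.
  apply: filterS2 (sft e e0) (sft _ ft0) => n n1 n2.
  rewrite /s mem_set; first by rewrite sub0r normrN ger0_norm ?rnorm_ge0// rnormBC.
  split => //=; have := rnorm_le_add (s0 n t) (f t); lra.
have bnd n t : D t -> rnorm (f t - s n t) <= 3 * rnorm (f t).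
  move=> Dt; rewrite /s; case: ifPn => [/[1!inE] -[_ /= h]|_]; last first.
    by rewrite subr0; have := rnorm_ge0 (f t); lra.
  by rewrite (le_trans (rnormB _ _))//; lra.
have [_ _] := @dominated_convergence _ _ _ mu D mD
  (fun n t => (rnorm (f t - s n t))%:E) (fun=> 0%E)
  (fun t => (3%:E * (rnorm (f t))%:E)%E)
  (ltac:(by move=> n; apply: strongly_measurable_rnormE;
     apply: strongly_measurableB => //; exact: simple_strongly_measurable))
  (ltac:(exact: measurable_cst))
  (ltac:(by apply: aeW => t Dt; apply: cvg_EFin; [exact: nearW|exact: key]))
  (ltac:(by apply: integrableZl => //; apply/integrableP; split;
     [exact: strongly_measurable_rnormE|
      under eq_integral do rewrite gee0_abs ?lee_fin ?rnorm_ge0//]))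
  (ltac:(by apply: aeW => t n Dt; rewrite gee0_abs ?lee_fin ?rnorm_ge0// bnd)).
by rewrite integral0.
Qed.

End L1norm.

Section bochner_theory.
Context {R : realType}.
Variable D : set R.
Hypotheses (mD : measurable D) (fD : (mu D < +oo)%E).

Lemma simple_integral_dist (V : normedModType R[i]) (s r : R -> V) :
  simple_fun s -> simple_fun r ->
  ((rnorm (simple_integral D s - simple_integral D r))%:E <= L1norm D (s - r)%R)%E.
Proof.
move=> ss sr; have sN : simple_fun (- r) by rewrite -scaleN1r; exact: simple_funZ.
have sB : simple_fun (s - r) by exact: simple_funD.
rewrite -[X in simple_integral D X](subrK r s) (simple_integralD mD fD sB sr) addrK.
exact: simple_integral_norm.
Qed.

(** The basic estimate, from which uniqueness and the norm bound follow: any simple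
function can be compared with the sequence that defines the integral. *)
Lemma bochner_integral_is_dist (V : normedModType R[i]) (f r : R -> V) (v : V) :
  bochner_integral_is D f v -> simple_fun r ->
  ((rnorm (v - simple_integral D r))%:E <= L1norm D (f - r)%R)%E.
Proof.
move=> [fm [s [ss sf sv]]] sr; apply/lee_addgt0Pr => e e0.
have e20 : 0 < e / 2 by rewrite divr_gt0.
move/rcvgP/(_ _ e20) : sv => sv.
have /ereal_cvg0P-/(_ (fun n => L1norm_ge0 _ _) _ e20) sf' := sf.
have [n [/= n1 n2]] := filter_ex (filterI sv sf').
have sm (r' : R -> V) : simple_fun r' -> strongly_measurable D r'.
  exact: simple_strongly_measurable.
apply: (@le_trans _ _ ((rnorm (simple_integral D (s n) - v))%:E +
    (rnorm (simple_integral D (s n) - simple_integral D r))%:E)%E).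
  by rewrite -EFinD lee_fin rnormBC -[in leLHS]rnormBC -[X in _ <= X + _]rnormBC rnorm_dist.
rewrite addeC; apply: (@le_trans _ _ (L1norm D (f - r)%R + (e / 2)%:E + (e / 2)%:E)%E).
  apply: leeD; last by rewrite lee_fin ltW.
  rewrite (le_trans (simple_integral_dist (ss n) sr))// addeC.
  rewrite (le_trans (L1norm_dist mD (sm _ (ss n)) fm (sm _ sr)))//.
  by apply: leeD => //; rewrite L1normBC ltW.
by rewrite -addeA -EFinD -splitr.
Qed.

Lemma bochner_integral_is_unique (V : normedModType R[i]) (f : R -> V) (v w : V) :
  bochner_integral_is D f v -> bochner_integral_is D f w -> v = w.
Proof.
move=> fv [fm [s [ss sf sw]]]; apply: cvg_unique sw => //.
apply/rcvgP => e e0; have /ereal_cvg0P-/(_ (fun n => L1norm_ge0 _ _) _ e0) sf' := sf.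
apply: filterS sf' => n ne; rewrite rnormBC -lte_fin.
exact: le_lt_trans (bochner_integral_is_dist fv (ss n)) ne.
Qed.

Lemma bochner_integralE (V : normedModType R[i]) (f : R -> V) (v : V) :
  bochner_integral_is D f v -> bochner_integral D f = v.
Proof.
move=> fv; rewrite /bochner_integral; case: xgetP => [w _ fw|/(_ v)//].
exact: bochner_integral_is_unique fw fv.
Qed.

Lemma bochner_integral_is_norm (V : normedModType R[i]) (f : R -> V) (v : V) :
  bochner_integral_is D f v -> ((rnorm v)%:E <= L1norm D f)%E.
Proof.
move=> fv; have := bochner_integral_is_dist fv (simple_fun_cst 0).
rewrite (_ : simple_integral D (fun=> 0) = 0); last first.
  by rewrite /simple_integral fsbig1// => _ [t _ <-]; rewrite scaler0.
by rewrite subr0 (_ : f - (fun=> 0) = f)//; apply/funext => t; rewrite !fctE subr0.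
Qed.

Lemma bochner_integral_isD (V : normedModType R[i]) (f g : R -> V) (v w : V) :
  bochner_integral_is D f v -> bochner_integral_is D g w ->
  bochner_integral_is D (f + g) (v + w).
Proof.
move=> [fm [s [ss sf sv]]] [gm [r [sr rg rw]]].
split; first exact: strongly_measurableD.
exists (fun n => s n + r n); split => [n||]; first exact: simple_funD.
  apply/ereal_cvg0P => [n|e e0]; first exact: L1norm_ge0.
  have e20 : 0 < e / 2 by rewrite divr_gt0.
  have /ereal_cvg0P-/(_ (fun n => L1norm_ge0 _ _) _ e20) sf' := sf.
  have /ereal_cvg0P-/(_ (fun n => L1norm_ge0 _ _) _ e20) rg' := rg.
  apply: filterS2 sf' rg' => n n1 n2; rewrite [e in X in (_ < X)%E]splitr EFinD.
  apply: le_lt_trans (lteD n1 n2); rewrite -[leLHS]/(L1norm D ((f + g) - (s n + r n))%R).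
  rewrite opprD addrACA; apply: L1normD => //; apply: strongly_measurableB => //;
    exact: simple_strongly_measurable.
under eq_fun do rewrite simple_integralD//.
exact: cvgD.
Qed.

Lemma bochner_integral_is_map (V W : normedModType R[i]) (T : bounded_op V W)
    (f : R -> V) (v : V) :
  bochner_integral_is D f v -> bochner_integral_is D (T \o f) (T v).
Proof.
move=> [fm [s [ss sf sv]]].
have Tm g : strongly_measurable D g -> strongly_measurable D (T \o g).
  move=> [q [sq qg]]; exists (fun n => T \o q n); split.
    by move=> n; apply/step_mapP/step_map_comp/step_mapP.
  by move=> t Dt; apply: (continuous_cvg _ (@bounded_op_continuous _ _ _ T (g t))); exact: qg.
split; first exact: Tm.
exists (fun n => T \o s n); split => [n||].
- by apply/step_mapP/step_map_comp/step_mapP.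
- apply/ereal_cvg0P => [n|e e0]; first exact: L1norm_ge0.
  have e20 : 0 < e / (op_norm T + 1) by rewrite divr_gt0// ltr_wpDl// op_norm_ge0.
  have /ereal_cvg0P-/(_ (fun n => L1norm_ge0 _ _) _ e20) sf' := sf.
  apply: filterS sf' => n n1.
  have T0 : 0 < op_norm T + 1 by rewrite ltr_wpDl// op_norm_ge0.
  apply: (@le_lt_trans _ _ ((op_norm T + 1)%:E * L1norm D (f - s n)%R)%E).
    rewrite /L1norm -ge0_integralZl//=; last 3 first.
    - apply: strongly_measurable_rnormE; apply: strongly_measurableB => //.
      exact: simple_strongly_measurable.
    - by move=> t _; rewrite lee_fin rnorm_ge0.
    - by rewrite lee_fin ltW.
    rewrite -[leLHS]/(L1norm D ((T \o f) - (T \o s n))%R).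
    apply: L1norm_le => //.
    + apply: strongly_measurableB; apply: Tm => //; exact: simple_strongly_measurable.
    + apply: measurable_funM => //; apply: strongly_measurable_rnorm.
      by apply: strongly_measurableB => //; exact: simple_strongly_measurable.
    + move=> t _; rewrite !fctE/= -bopB (le_trans (op_normP _ _))//.
      by rewrite ler_wpM2r ?rnorm_ge0// lerDl.
  rewrite -lte_pdivlMl// -EFinM mulrC//.
under eq_fun do rewrite simple_integral_map//.
exact: (continuous_cvg _ (@bounded_op_continuous _ _ _ T v)).
Qed.

Lemma bochner_integral_is_ae (V : normedModType R[i]) (f g : R -> V) (v : V) :
  strongly_measurable D g -> ae_eq mu D f g ->
  bochner_integral_is D f v -> bochner_integral_is D g v.
Proof.
move=> gm fg [fm [s [ss sf sv]]]; split => //; exists s; split => //.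
rewrite [X in X @ \oo](_ : _ = fun n => L1norm D (f - s n)%R)//.
apply/funext => n; apply: ge0_ae_eq_integral => //.
- apply: (@strongly_measurable_rnormE _ _ _ (g - s n)).
  by apply: strongly_measurableB => //; exact: simple_strongly_measurable.
- apply: (@strongly_measurable_rnormE _ _ _ (f - s n)).
  by apply: strongly_measurableB => //; exact: simple_strongly_measurable.
- by move=> t _; rewrite lee_fin rnorm_ge0.
- by move=> t _; rewrite lee_fin rnorm_ge0.
by apply: filterS fg => t /= E Dt; rewrite !fctE E.
Qed.

Lemma bochner_integral_exists (V : completeNormedModType R[i]) (f : R -> V) :
  strongly_measurable D f -> (L1norm D f < +oo)%E ->
  exists v, bochner_integral_is D f v.
Proof.
move=> fm foo; have [s [ss sf]] := simple_approximation mD fm foo.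
have [v sv] : exists v : V, simple_integral D (s n) @[n --> \oo] --> v.
  apply: rnorm_cauchy_cvg => e e0.
  have e20 : 0 < e / 2 by rewrite divr_gt0.
  have /ereal_cvg0P-/(_ (fun n => L1norm_ge0 _ _) _ e20) [N _ sN] := sf.
  exists N => m n Nm Nn; rewrite -lte_fin.
  rewrite (le_lt_trans (simple_integral_dist (ss m) (ss n)))//.
  rewrite (le_lt_trans (L1norm_dist mD _ fm _))//; try exact: simple_strongly_measurable.
  rewrite [e]splitr EFinD; apply: lteD; last exact: sN.
  by rewrite L1normBC; exact: sN.
by exists v; split => //; exists s.
Qed.

End bochner_theory.

Section glue.
Context {R : realType} {V : normedModType R[i]}.
Implicit Types (D : set R) (f g s r : R -> V) (v w : V).

Lemma strongly_measurable_setU D1 D2 f : measurable D1 ->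
  strongly_measurable D1 f -> strongly_measurable D2 f ->
  strongly_measurable (D1 `|` D2) f.
Proof.
move=> mD1 [s [ss sf]] [r [sr rf]].
exists (fun n t => if t \in D1 then s n t else r n t); split => [n|t Dt].
  by apply/step_mapP/step_map_if => //; exact/step_mapP.
have [Dt1|Dt1] := boolP (t \in D1); first by apply: sf; rewrite inE in Dt1.
apply: rf; case: Dt => // Dt2; by move: Dt1; rewrite notin_setE.
Qed.

Lemma strongly_measurable_sub D1 D2 f : D1 `<=` D2 ->
  strongly_measurable D2 f -> strongly_measurable D1 f.
Proof. by move=> D12 [s [ss sf]]; exists s; split => // t /D12; exact: sf. Qed.

Lemma eq_strongly_measurable D f g : (forall t, D t -> f t = g t) ->
  strongly_measurable D f -> strongly_measurable D g.
Proof.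
move=> fg [s [ss sf]]; exists s; split => // t Dt.
by rewrite -fg//; exact: sf.
Qed.

Lemma eq_bochner_integral_is D f g v : (forall t, D t -> f t = g t) ->
  bochner_integral_is D f v -> bochner_integral_is D g v.
Proof.
move=> fg [fm [s [ss sf sv]]]; split; first exact: eq_strongly_measurable fm.
exists s; split => //; rewrite [X in X @ \oo](_ : _ = fun n =>
   (\int[mu]_(t in D) (rnorm (f t - s n t))%:E)%E)//.
by apply/funext => n; apply: eq_integral => t /[1!inE] Dt; rewrite fg.
Qed.

Lemma L1norm_setU D1 D2 f : measurable D1 -> measurable D2 ->
  D1 `&` D2 = set0 -> strongly_measurable (D1 `|` D2) f ->
  (L1norm (D1 `|` D2) f = L1norm D1 f + L1norm D2 f)%E.
Proof.
move=> mD1 mD2 D12 fm; apply: ge0_integral_setU => //.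
- exact: strongly_measurable_rnormE.
- by move=> t _; rewrite lee_fin rnorm_ge0.
- exact/eqP.
Qed.

Lemma simple_integral_setU D1 D2 s : measurable D1 -> measurable D2 ->
  (mu D1 < +oo)%E -> (mu D2 < +oo)%E -> D1 `&` D2 = set0 -> simple_fun s ->
  simple_integral (D1 `|` D2) s = simple_integral D1 s + simple_integral D2 s.
Proof.
move=> mD1 mD2 f1 f2 D12 [fs ms].
rewrite /simple_integral !fsbig_finite// -big_split; apply: eq_bigr => v _ /=.
rewrite -scalerDl -rmorphD /= -fineD ?mu_fin//.
rewrite setIUl measureU//.
- exact: (measurableI _ _ mD1 (ms v)).
- exact: (measurableI _ _ mD2 (ms v)).
by rewrite setIACA D12 set0I.
Qed.

Lemma eq_simple_integral D s r : measurable D -> (mu D < +oo)%E ->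
  simple_fun s -> simple_fun r -> (forall t, D t -> s t = r t) ->
  simple_integral D s = simple_integral D r.
Proof.
move=> mD fD ss sr sr'; apply/eqP; rewrite -subr_eq0; apply/eqP/rnorm0_eq0.
apply/eqP; rewrite eq_le rnorm_ge0 andbT -lee_fin.
rewrite (le_trans (simple_integral_dist mD fD ss sr))//.
rewrite /L1norm integral0_eq// => t Dt.
by rewrite fctE/= sr'// subrr rnorm0.
Qed.

Lemma bochner_integral_is_setU D1 D2 f v w : measurable D1 -> measurable D2 ->
  (mu D1 < +oo)%E -> (mu D2 < +oo)%E -> D1 `&` D2 = set0 ->
  bochner_integral_is D1 f v -> bochner_integral_is D2 f w ->
  bochner_integral_is (D1 `|` D2) f (v + w).
Proof.
move=> mD1 mD2 f1 f2 D12 [fm [s [ss sf sv]]] [fm' [r [sr rf rw]]].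
have fmU := strongly_measurable_setU mD1 fm fm'.
split => //; exists (fun n t => if t \in D1 then s n t else r n t).
have sq n : simple_fun (fun t => if t \in D1 then s n t else r n t).
  by apply/step_mapP/step_map_if => //; exact/step_mapP.
have q1 n t : D1 t -> (if t \in D1 then s n t else r n t) = s n t.
  by move=> D1t; rewrite mem_set.
have q2 n t : D2 t -> (if t \in D1 then s n t else r n t) = r n t.
  move=> D2t; rewrite memNset// => D1t.
  by have : (D1 `&` D2) t by []; rewrite D12.
split => //.
  rewrite [X in X @ \oo](_ : _ = fun n =>
     (L1norm D1 (f - s n)%R + L1norm D2 (f - r n)%R)%E); last first.
    apply/funext => n.
    rewrite -[LHS]/(L1norm _ (f - (fun t => if t \in D1 then s n t else r n t))%R).
    rewrite L1norm_setU//; last first.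
      by apply: strongly_measurableB => //; exact: simple_strongly_measurable.
    congr (_ + _)%E; apply: eq_L1norm => t Dt; rewrite !fctE/=.
      by rewrite q1.
    by rewrite q2.
  by rewrite -[0%E]adde0; apply: cvgeD.
rewrite [X in X @ \oo](_ : _ = fun n =>
  simple_integral D1 (s n) + simple_integral D2 (r n)); first exact: cvgD.
apply/funext => n; rewrite simple_integral_setU//; congr (_ + _).
  by apply: eq_simple_integral => // t; exact: q1.
by apply: eq_simple_integral => // t; exact: q2.
Qed.

(** Used for one-point intervals, to trade half-open intervals for closed ones. *)
Lemma bochner_integral_is_null D f : measurable D -> mu D = 0%E ->
  strongly_measurable D f -> bochner_integral_is D f 0.
Proof.
move=> mD D0 fm; split => //; exists (fun=> fun=> 0); split => [n||].
- exact: simple_fun_cst.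
- rewrite [X in X @ \oo](_ : _ = fun=> 0%E); first exact: cvg_cst.
  apply/funext => n; rewrite null_set_integral//.
  apply: strongly_measurable_rnormE => //.
  apply: (@eq_strongly_measurable _ f) => // t _; by rewrite subr0.
- rewrite [X in X @ \oo](_ : _ = fun=> 0); first exact: cvg_cst.
  apply/funext => n; rewrite /simple_integral fsbig1// => v _.
  rewrite (_ : mu _ = 0%E) ?scale0r//; apply/eqP; rewrite -measure_le0 -D0.
  apply: le_measure; rewrite ?inE//; apply: measurableI => //.
  exact: (simple_fun_cst _).2.
Qed.

End glue.

Section translation.
Context {R : realType}.
Variable a : R.

Let phi : measurableTypeR R -> measurableTypeR R := fun t : R => t + a.

Let mphi : measurable_fun setT phi.
Proof. exact: measurable_funD. Qed.

Lemma lebesgue_measure_shift (A : set R) : measurable A ->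
  mu (phi @^-1` A) = mu A.
Proof.
move=> mA; rewrite -[LHS]/(pushforward mu (phi : _ -> measurableTypeR R) A).
apply/esym/lebesgue_measure_unique => //= _ [[x y]] _ <-.
rewrite /pushforward (_ : phi @^-1` _ = `]x - a, y - a]%classic); last first.
  by apply/seteqP; split => t /=; rewrite !in_itv/= ltrBlDr lerBrDr.
rewrite !lebesgue_measure_itv/= !lte_fin ltrD2r; case: ifPn => // _.
by rewrite -!EFinB opprB addrA subrK.
Qed.

Lemma ge0_integral_shift (D : set R) (f : R -> \bar R) : measurable D ->
  measurable_fun D f -> (forall t, D t -> (0 <= f t)%E) ->
  (\int[mu]_(t in phi @^-1` D) f (t + a)%R = \int[mu]_(t in D) f t)%E.
Proof.
move=> mD mf f0.
rewrite -[LHS]/(\int[mu]_(t in phi @^-1` D) (f \o phi) t)%E.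
rewrite -(ge0_integral_pushforward mphi mu mD mf); last first.
  by move=> t /[1!inE]; exact: f0.
apply: eq_measure_integral => A mA AD.
exact: lebesgue_measure_shift.
Qed.

Lemma strongly_measurable_shift (V : normedModType R[i]) (D : set R) (f : R -> V) :
  strongly_measurable D f -> strongly_measurable (phi @^-1` D) (fun t => f (t + a)).
Proof.
move=> [s [ss sf]]; exists (fun n t => s n (t + a)); split => [n|t Dt].
  by apply/step_mapP/(@step_map_shift _ _ (s n) a)/step_mapP.
exact: sf.
Qed.

Lemma bochner_integral_is_shift (V : normedModType R[i]) (D : set R) (f : R -> V) v :
  measurable D -> bochner_integral_is D f v ->
  bochner_integral_is (phi @^-1` D) (fun t => f (t + a)) v.
Proof.
move=> mD [fm [s [ss sf sv]]]; split; first exact: strongly_measurable_shift.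
exists (fun n t => s n (t + a)); split => [n||].
- by apply/step_mapP/(@step_map_shift _ _ (s n) a)/step_mapP.
- rewrite [X in X @ \oo](_ : _ = fun n => L1norm D (f - s n)%R)//.
  apply/funext => n.
  apply: (@ge0_integral_shift D (fun t => (rnorm (f t - s n t))%:E)) => //.
    apply: (@strongly_measurable_rnormE _ _ _ (f - s n)).
    by apply: strongly_measurableB => //; exact: simple_strongly_measurable.
  by move=> t _; rewrite lee_fin rnorm_ge0.
rewrite [X in X @ \oo](_ : _ = fun n => simple_integral D (s n))//.
apply/funext => n; rewrite /simple_integral.
rewrite (_ : range (fun t => s n (t + a)) = range (s n)); last first.
  apply/seteqP; split => _ [t _ <-]; first by exists (t + a).
  by exists (t - a) => //; rewrite subrK.
apply: eq_fsbigr => w _; congr ((fine _)%:C *: _).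
rewrite -[RHS]lebesgue_measure_shift//; apply: measurableI => //.
exact: (ss n).2.
Qed.

End translation.

(** * Uniform boundedness *)

Section uniform_boundedness.
Context {R : realType} {X : completeNormedModType R[i]} {W : normedModType R[i]}.

(** One of [x + y] and [x - y] is mapped at least as far as y, by the triangle
inequality for [T (x + y) - T (x - y)]. Hence T attains nearly [r * op_norm T] on
every ball of radius r, wherever its centre is. *)
Lemma op_norm_hump (T : bounded_op X W) (x : X) (r : R) : 0 < r ->
  exists x', rnorm (x' - x) <= r /\ 2 / 3 * (r * op_norm T) <= rnorm (T x').
Proof.
move=> r0; have [T0|T0] := eqVneq (op_norm T) 0.
  by exists x; rewrite subrr rnorm0 T0 !mulr0 rnorm_ge0 ltW.
have {}T0 : 0 < op_norm T by rewrite lt_neqAle eq_sym T0 op_norm_ge0.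
have [y y1 Ty] : exists2 y, rnorm y <= 1 & 2 / 3 * op_norm T <= rnorm (T y).
  apply: contrapT => H.
  have : op_norm T <= 2 / 3 * op_norm T; last lra.
  apply: op_norm_le => y y1; rewrite leNgt; apply/negP => h; apply: H.
  by exists y => //; exact: ltW.
have : rnorm (T (r%:C *: y)) <= rnorm (T (x + r%:C *: y)) \/
       rnorm (T (r%:C *: y)) <= rnorm (T (x - r%:C *: y)).
  have [h|h] := leP (rnorm (T (r%:C *: y))) (rnorm (T (x + r%:C *: y))); first by left.
  right; have := rnormB (T (x + r%:C *: y)) (T (x - r%:C *: y)).
  rewrite -bopB opprB addrC addrA subrK bopD -mulr2n -scaler_nat rnormZc.
  rewrite -(rmorph_nat (real_complex R) 2) cnorm_real ger0_norm//; lra.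
have yr : rnorm (r%:C *: y) <= r.
  by rewrite rnormZr gtr0_norm// ler_piMr// ltW.
have Tyr : 2 / 3 * (r * op_norm T) <= rnorm (T (r%:C *: y)).
  by rewrite bopZ rnormZr gtr0_norm// mulrCA ler_pM2l.
case=> h; [exists (x + r%:C *: y)|exists (x - r%:C *: y)]; split.
- by rewrite addrC addKr.
- exact: le_trans h.
- by rewrite addrC addKr rnormN.
- exact: le_trans h.
Qed.

(** The gliding hump: were the norms unbounded, operators [T n] of rapidly growing
norm and steps of size [3^-(n+1)] would give a Cauchy sequence at whose limit the
values [T n l] are unbounded: the n-th step gains 2/3 of
[3^-(n+1) * op_norm (T n)], and all later ones take back at most 1/2 of it. *)
Theorem uniform_boundedness (F : set (bounded_op X W)) :
  (forall x, exists M : R, forall T, F T -> rnorm (T x) <= M) ->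
  exists C : R, forall T, F T -> op_norm T <= C.
Proof.
move=> pb; apply: contrapT => /forallNP nb.
have {nb} /choice[T TP] : forall n : nat, exists T, F T /\
    6 * 3 ^+ n.+1 * n%:R < op_norm T.
  move=> n; apply: contrapT => /forallNP h; apply: (nb (6 * 3 ^+ n.+1 * n%:R)).
  by move=> T FT; rewrite leNgt; apply/negP => ?; apply: (h T).
have r0 n : 0 < 3 ^- n.+1 :> R by rewrite invr_gt0 exprn_gt0.
have /choice[f fP] : forall z : nat * X, exists x',
    rnorm (x' - z.2) <= 3 ^- z.1.+1 /\
    2 / 3 * (3 ^- z.1.+1 * op_norm (T z.1)) <= rnorm (T z.1 x').
  by move=> z; exact: op_norm_hump.
pose x := fix x n := if n is m.+1 then f (m, x m) else 0.
have x1 n : rnorm (x n.+1 - x n) <= 3 ^- n.+1 by exact: (fP (n, x n)).1.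
have x2 n : 2 / 3 * (3 ^- n.+1 * op_norm (T n)) <= rnorm (T n (x n.+1)).
  exact: (fP (n, x n)).2.
have xd n k : rnorm (x (n + k)%N - x n) <= 3 ^- n / 2.
  suff : rnorm (x (n + k)%N - x n) <= 3 ^- n / 2 - 3 ^- (n + k) / 2.
    move=> /le_trans; apply; rewrite gerBl divr_ge0// invr_ge0 exprn_ge0//.
  elim: k => [|k IH]; first by rewrite addn0 !subrr rnorm0.
  rewrite addnS (le_trans (rnorm_dist (x (n + k)%N) _ _))//.
  have := x1 (n + k)%N; rewrite exprS invfM; move: IH.
  by set a := 3 ^- (n + k); set b := 3 ^- n; lra.
have [l xl] : exists l : X, x n @[n --> \oo] --> l.
  apply: rnorm_cauchy_cvg => e e0.
  have : (3^-1) ^+ n @[n --> \oo] --> (0 : R).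
    by apply: cvg_expr; rewrite ger0_norm// invf_lt1 ?ltr1n.
  move=> /cvgrPdist_lt/(_ _ e0)[N _ /(_ N (leqnn N))] /=.
  rewrite sub0r normrN ger0_norm ?exprn_ge0// exprVn => Ne.
  exists N => m n Nm Nn; rewrite (le_lt_trans (rnorm_dist (x N) _ _))//.
  have := xd N (m - N)%N; rewrite subnKC// => h1.
  have := xd N (n - N)%N; rewrite subnKC// => h2.
  by rewrite [X in _ + X]rnormBC (le_lt_trans (lerD h1 h2))// -splitr.
have ld n : rnorm (l - x n) <= 3 ^- n / 2.
  apply/ler_addgt0Pr => e e0; move/rcvgP/(_ _ e0) : xl => [N _ xN].
  have := xN (n + N)%N (leq_addl _ _); rewrite rnormBC => h1.
  by rewrite (le_trans (rnorm_dist (x (n + N)%N) _ _))// addrC lerD// ltW.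
have [M MP] := pb l.
pose n := (Num.truncn M).+1.
have [FT Tn] := TP n; have := MP _ FT; apply/negP; rewrite -ltNge.
apply: (@lt_le_trans _ _ n%:R); first exact: truncnS_gt.
have h1 : rnorm (T n (l - x n.+1)) <= op_norm (T n) * (3 ^- n.+1 / 2).
  by rewrite (le_trans (op_normP _ _))// ler_wpM2l ?op_norm_ge0.
have h2 := x2 n; have := rnormB (T n l) (T n (l - x n.+1)).
rewrite -bopB opprB addrC subrK => h3.
have : 6 * n%:R <= 3 ^- n.+1 * op_norm (T n).
  by rewrite ler_pdivlMl ?exprn_gt0//; move: Tn; lra.
move: h1 h2 h3; rewrite [op_norm _ * _]mulrCA mulrA.
by set a := 3 ^- n.+1 * op_norm (T n); lra.
Qed.

End uniform_boundedness.

(** * Measurability along operator families and evolution families *)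

Section measurability.
Context {R : realType}.

(** A simple function that rounds s up to a grid of mesh below e. Rounding up is
strict except at the right end point, so composing a function with such maps probes
it strictly from the right. *)
Lemma grid_map (a b e : R) : a <= b -> 0 < e -> exists d : R -> R, step_map d /\
  forall s, a <= s -> s <= b ->
    [/\ s <= d s, d s <= b, d s < s + e & s < b -> s < d s].
Proof.
move=> ab e0.
pose h := e / 2.
have h0 : 0 < h by rewrite divr_gt0.
pose d := fix d k s := if k is k'.+1 then
  if s \in `]-oo, b - k%:R * h[%classic then b - k%:R * h else d k' s else b.
have ds k : step_map (d k).
  elim: k => [|k IH] /=; first exact: step_map_cst.
  by apply: step_map_if => //; exact: step_map_cst.
have dP k s : b - k.+1%:R * h <= s -> s <= b ->
    [/\ s <= d k s, d k s <= b, d k s <= s + h & s < b -> s < d k s].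
  elim: k => [|k IH] /=; first by rewrite mul1r lerBlDr => *; split.
  rewrite -[k.+2]addn1 natrD mulrDl mul1r opprD addrA lerBlDr => ks sb.
  case: ifPn => [/[1!inE]/=|].
    rewrite in_itv/= => sk; split => //; first exact: ltW.
    by rewrite lerBlDr lerDl mulr_ge0// ltW.
  by rewrite notin_setE/= in_itv/= => /negP; rewrite -leNgt => /IH; exact.
pose N := (Num.truncn ((b - a) / h)).
exists (d N); split => // s as_ sb.
have [] := dP N s _ sb; last first.
  move=> h1 h2 h3 h4; split => //; rewrite (le_lt_trans h3)// ltrD2l /h.
  by rewrite ltr_pdivrMr// ltr_pMr// ltr1n.
rewrite (le_trans _ as_)// lerBlDr -lerBlDl -ler_pdivrMr// ltW// truncnS_gt//.
Qed.

Definition right_continuous_on (V : normedModType R[i]) (a b : R) (f : R -> V) :=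
  forall s, a <= s -> s < b -> forall e : R, 0 < e -> exists2 dl : R, 0 < dl &
    forall s', s < s' -> s' < s + dl -> s' <= b -> rnorm (f s' - f s) < e.

Lemma rcvg_squeeze (V : normedModType R[i]) (u : nat -> V) (l : V) (a : nat -> R) :
  (forall n, rnorm (u n - l) <= a n) -> a n @[n --> \oo] --> (0 : R) ->
  u n @[n --> \oo] --> l.
Proof.
move=> ua a0; apply/rcvgP => e e0; move/cvgrPdist_lt : a0 => /(_ e e0).
apply: filterS => n; rewrite sub0r normrN; apply: le_lt_trans.
exact: le_trans (ua n) (ler_norm _).
Qed.

Lemma exists_grid (a b : R) : a <= b -> exists d : nat -> R -> R,
  (forall n, step_map (d n)) /\ forall n s, a <= s -> s <= b ->
    [/\ s <= d n s, d n s <= b, d n s < s + n.+1%:R^-1 & s < b -> s < d n s].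
Proof.
move=> ab; have e0 n : 0 < n.+1%:R^-1 :> R by rewrite invr_gt0.
have /choice[d dP] := fun n => grid_map ab (e0 n).
by exists d; split => n; [exact: (dP n).1|exact: (dP n).2].
Qed.

Lemma right_continuous_grid (V : normedModType R[i]) (a b : R) (f : R -> V)
    (d : nat -> R -> R) (s : R) : a <= s -> s <= b ->
  (forall n, [/\ s <= d n s, d n s <= b, d n s < s + n.+1%:R^-1 & s < b -> s < d n s]) ->
  right_continuous_on a b f -> f (d n s) @[n --> \oo] --> f s.
Proof.
move=> as_ sb dP fc; apply/rcvgP => e e0.
have [sb'|bs] := ltP s b; last first.
  have E : s = b by apply/eqP; rewrite eq_le sb.
  apply: nearW => n; have [h1 h2 _ _] := dP n.
  rewrite (_ : d n s = s) ?subrr ?rnorm0//.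
  by apply/eqP; rewrite eq_le h1 andbT (le_trans h2).
have [dl dl0 H] := fc s as_ sb' e e0.
exists (Num.truncn dl^-1) => // n /= Nn.
have [h1 h2 h3 h4] := dP n; apply: H => //; first exact: h4.
rewrite (lt_trans h3)// ltrD2l -ltf_pV2 ?posrE ?invr_gt0// invrK.
by rewrite (lt_le_trans (truncnS_gt _))// ler_nat.
Qed.

Lemma right_continuous_strongly_measurable (V : normedModType R[i]) (a b : R)
    (f : R -> V) : a <= b -> right_continuous_on a b f ->
  strongly_measurable `[a, b] f.
Proof.
move=> ab fc; have [d [ds dP]] := exists_grid ab.
exists (fun n => f \o d n); split => [n|s /=].
  by apply/step_mapP/step_map_comp.
by rewrite in_itv/= => /andP[as_ sb]; exact: (right_continuous_grid as_ sb (fun n => dP n s as_ sb) fc).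
Qed.

Lemma strongly_measurable_op (V W : normedModType R[i]) (D : set R)
    (F : R -> bounded_op V W) (g : R -> V) :
  strongly_measurable D F -> strongly_measurable D g ->
  strongly_measurable D (fun s => F s (g s)).
Proof.
move=> [s [ss sF]] [r [sr rg]]; exists (fun n t => s n t (r n t)); split => [n|t Dt].
  have := step_map_pair (iffLR (step_mapP _) (ss n)) (iffLR (step_mapP _) (sr n)).
  by move=> /(step_map_comp (fun z : bounded_op V W * V => z.1 z.2)) /step_mapP.
have sF' := sF t Dt; have /rcvg0P rg' := rg t Dt.
apply: (@rcvg_squeeze _ _ _ (fun n => op_norm (s n t) * rnorm (r n t - g t) +
    op_norm (s n t - F t) * rnorm (g t))) => [n|].
  rewrite (_ : _ - _ = s n t (r n t - g t) + (s n t - F t) (g t)); last first.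
    by rewrite bopB [X in _ = _ + X](_ : _ = s n t (g t) - F t (g t))// addrA subrK.
  by rewrite (le_trans (rnormD _ _))// lerD// op_normP.
rewrite -[0]addr0 -[X in X + _](mulr0 (op_norm (F t))) -[X in _ + X](mul0r (rnorm (g t))).
apply: cvgD; apply: cvgM => //.
- exact: (rnorm_cvg sF').
- by move/rcvg0P : sF'.
- exact: cvg_cst.
Qed.

(** A family that is only strongly right-continuous need not be measurable for the
operator norm, so the simple approximations of F are [F \o d n] with grid maps
[d n], whose convergence is only strong. *)
Lemma strongly_measurable_family (V W : normedModType R[i]) (a b C : R)
    (F : R -> bounded_op V W) (g : R -> V) : a <= b ->
  (forall s, a <= s -> s <= b -> op_norm (F s) <= C) ->
  (forall x, right_continuous_on a b (fun s => F s x)) ->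
  strongly_measurable `[a, b] g ->
  strongly_measurable `[a, b] (fun s => F s (g s)).
Proof.
move=> ab FC Fc [r [sr rg]]; have [d [ds dP]] := exists_grid ab.
exists (fun n t => F (d n t) (r n t)); split => [n|t /=].
  have := step_map_pair (ds n) (iffLR (step_mapP _) (sr n)).
  by move=> /(step_map_comp (fun z : R * V => F z.1 z.2)) /step_mapP.
rewrite in_itv/= => /andP[at_ tb].
have /rcvg0P rg' : r n t @[n --> \oo] --> g t by apply: rg; rewrite /= in_itv/= at_.
have /rcvg0P Fd : F (d n t) (g t) @[n --> \oo] --> F t (g t).
  exact: (right_continuous_grid at_ tb (fun n => dP n t at_ tb) (Fc (g t))).
apply: (@rcvg_squeeze _ _ _ (fun n => C * rnorm (r n t - g t) +
    rnorm (F (d n t) (g t) - F t (g t)))) => [n|].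
  rewrite (_ : _ - _ = F (d n t) (r n t - g t) + (F (d n t) (g t) - F t (g t))); last first.
    by rewrite bopB addrA subrK.
  rewrite (le_trans (rnormD _ _))// lerD2r (le_trans (op_normP _ _))//.
  have [h1 h2 _ _] := dP n t at_ tb.
  by rewrite ler_wpM2r ?rnorm_ge0// FC// (le_trans at_).
rewrite -[0]addr0 -[X in X + _](mulr0 C).
by apply: cvgD => //; apply: cvgM => //; exact: cvg_cst.
Qed.

End measurability.

Section evolution.
Context {R : realType} {X : completeNormedModType R[i]}.
Variable U : R -> R -> bounded_op X X.
Hypothesis UE : evolution_family U.

Lemma evolution_near (x : X) (t s : R) : s <= t -> forall e : R, 0 < e ->
  exists2 dl : R, 0 < dl & forall t' s', s' <= t' -> `|t' - t| < dl ->
    `|s' - s| < dl -> rnorm (U t' s' x - U t s x) < e.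
Proof.
move=> st e e0; have [_ _ /(_ x) /subspace_continuousP Uc] := UE.
have /rcvgP/(_ e e0) := Uc (t, s) st.
move=> /nbhs_ballP[dl /= dl0 H]; exists dl => // t' s' st' tt ss.
by apply: (H (t', s')) => //; split; rewrite /ball /= distrC.
Qed.

(** Strong continuity bounds [U t s x] on the compact triangle for each x; uniform
boundedness does the rest. *)
Lemma evolution_locally_bounded (T : R) : exists2 C : R, 0 < C &
  forall t s, 0 <= s -> s <= t -> t <= T -> op_norm (U t s) <= C.
Proof.
pose F := [set A | exists t s, [/\ 0 <= s, s <= t, t <= T & A = U t s]].
have [C CP] : exists C : R, forall A, F A -> op_norm A <= C.
  apply: uniform_boundedness => x.
  pose K := (`[0, T] `*` `[0, T])%classic : set (R * R).
  have cK : compact K by apply: compact_setX; exact: segment_compact.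
  pose P (M : R) (p : R * R) := p.2 <= p.1 -> rnorm (U p.1 p.2 x) <= M.
  have : \forall M \near +oo, K `<=` P M.
    apply: (iffLR (compact_near_coveringP K) cK) => -[t s] _.
    have [st|st] := leP s t; last first.
      have e0 : 0 < (s - t) / 2 by rewrite divr_gt0// subr_gt0.
      exists (ball (t, s) ((s - t) / 2), setT).
        by split; [exact: nbhsx_ballx|exact: filterT].
      move=> -[[t' s'] M] /= [[]]; rewrite /ball /= => h1 h2 _ st'.
      by move: h1 h2 st' => /=; rewrite !ltr_norml => /andP[? ?] /andP[? ?] ?; exfalso; lra.
    have [dl dl0 H] := evolution_near x st ltr01.
    exists (ball (t, s) dl, [set M | rnorm (U t s x) + 1 < M]).
      split; first exact: nbhsx_ballx.
      by exists (rnorm (U t s x) + 1); split => //; rewrite num_real.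
    move=> -[[t' s'] M] /= [[]]; rewrite /ball /= => h1 h2 h3 st'.
    have := H t' s' st'; rewrite distrC => /(_ h1); rewrite distrC => /(_ h2) h4.
    have := rnorm_le_add (U t' s' x) (U t s x); lra.
  move=> /pinfty_ex_gt0 [M M0 KM]; exists M => _ [t [s [s0 st tT ->]]].
  by apply: (KM (t, s)) => //; split; rewrite /= in_itv/= ?s0 ?(le_trans st) ?(le_trans s0).
exists (`|C| + 1); first by rewrite ltr_wpDl.
move=> t s s0 st tT; rewrite (@le_trans _ _ C)//; first by apply: CP; exists t, s.
by rewrite (le_trans (ler_norm C))// lerDl.
Qed.

Lemma evolution_right_continuous (x : X) (t : R) :
  right_continuous_on 0 t (fun s => U t s x).
Proof.
move=> s s0 st e e0; have [dl dl0 H] := evolution_near x (ltW st) e0.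
exists dl => // s' ss' sd s't; apply: H => //; first by rewrite subrr normr0.
by rewrite gtr0_norm ?subr_gt0// ltrBlDl.
Qed.

End evolution.

(** [filterS] for the almost everywhere filter, with its measure fixed. *)
Lemma ae_imp (R : realType) (P Q : R -> Prop) : (forall t, P t -> Q t) ->
  {ae (@lebesgue_measure R), forall t, P t} ->
  {ae (@lebesgue_measure R), forall t, Q t}.
Proof.
move=> PQ H; have X := ae_filter_ringOfSetsType (@lebesgue_measure R).
exact: (@filterS _ _ X _ _ PQ H).
Qed.

Lemma ae_imp2 (R : realType) (P Q P' : R -> Prop) :
  (forall t, P t -> Q t -> P' t) ->
  {ae (@lebesgue_measure R), forall t, P t} ->
  {ae (@lebesgue_measure R), forall t, Q t} ->
  {ae (@lebesgue_measure R), forall t, P' t}.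
Proof.
move=> PQ H H'; have X := ae_filter_ringOfSetsType (@lebesgue_measure R).
exact: (@filterS2 _ _ X _ _ _ PQ H H').
Qed.

(** * Integrable functions and essentially bounded operators *)

Section L1on.
Context {R : realType} {V : normedModType R[i]}.
Implicit Types (D : set R) (f g : R -> V).

Definition L1on D f := strongly_measurable D f /\ (L1norm D f < +oo)%E.

Lemma finite_itv (a b : R) (x y : bool) :
  (mu [set` Interval (BSide x a) (BSide y b)] < +oo)%E.
Proof.
by rewrite lebesgue_measure_itv/=; case: ifP => // _; rewrite -EFinB ltry.
Qed.

Lemma L1on_sub D D' f : measurable D -> measurable D' -> D `<=` D' ->
  L1on D' f -> L1on D f.
Proof.
move=> mD mD' DD' [fm foo]; split; first exact: strongly_measurable_sub fm.
apply: le_lt_trans foo; apply: ge0_subset_integral => //.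
  exact: strongly_measurable_rnormE.
by move=> t _; rewrite lee_fin rnorm_ge0.
Qed.

Lemma L1onD D f g : measurable D -> L1on D f -> L1on D g -> L1on D (f + g).
Proof.
move=> mD [fm foo] [gm goo]; split; first exact: strongly_measurableD.
by apply: (le_lt_trans (L1normD mD fm gm)); exact: lte_add_pinfty.
Qed.

Lemma L1normZ D (a : R[i]) f : measurable D -> strongly_measurable D f ->
  L1norm D (a *: f) = ((cnorm a)%:E * L1norm D f)%E.
Proof.
move=> mD fm; rewrite /L1norm -ge0_integralZl//=.
- by apply: eq_integral => t _; rewrite -EFinM -rnormZc.
- exact: strongly_measurable_rnormE.
- by move=> t _; rewrite lee_fin rnorm_ge0.
- by rewrite lee_fin cnorm_ge0.
Qed.

Lemma L1onZ D (a : R[i]) f : measurable D -> L1on D f -> L1on D (a *: f).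
Proof.
move=> mD [fm foo]; split; first exact: strongly_measurableZ.
by rewrite L1normZ//; apply: lte_mul_pinfty => //; rewrite lee_fin cnorm_ge0.
Qed.

Lemma L1on0 D : L1on D (fun=> 0 : V).
Proof.
split; first exact: simple_strongly_measurable (simple_fun_cst _).
by rewrite /L1norm integral0_eq// => t _; rewrite rnorm0.
Qed.

Lemma eq_L1on D f g : (forall t, D t -> f t = g t) -> L1on D f -> L1on D g.
Proof.
move=> fg [fm foo]; split; first exact: eq_strongly_measurable fm.
by rewrite -(@eq_L1norm _ _ D f)// => t Dt; rewrite fg.
Qed.

Lemma L1on_setU D1 D2 f : measurable D1 -> measurable D2 -> D1 `&` D2 = set0 ->
  L1on D1 f -> L1on D2 f -> L1on (D1 `|` D2) f.
Proof.
move=> mD1 mD2 D12 [m1 o1] [m2 o2].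
have mU := strongly_measurable_setU mD1 m1 m2; split => //.
by rewrite L1norm_setU//; exact: lte_add_pinfty.
Qed.

Lemma L1on_shift (a : R) D f : measurable D -> L1on D f ->
  L1on ((fun t => t + a) @^-1` D) (fun t => f (t + a)).
Proof.
move=> mD [fm foo]; split; first exact: strongly_measurable_shift.
rewrite /L1norm (ge0_integral_shift a (f := fun t => (rnorm (f t))%:E))//.
- exact: strongly_measurable_rnormE.
- by move=> t _; rewrite lee_fin rnorm_ge0.
Qed.

Lemma L1norm_fin D f : L1on D f -> L1norm D f \is a fin_num.
Proof. by move=> [_ foo]; rewrite ge0_fin_numE// L1norm_ge0. Qed.

Lemma square_integrable_L1on (T : R) f :
  square_integrable `[0, T] f -> L1on `[0, T] f.
Proof.
move=> [fm foo]; split => //.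
apply: (@le_lt_trans _ _ (\int[mu]_(t in `[0%R, T]) (1 + ((rnorm (f t)) ^+ 2)%:E))%E).
  apply: ge0_le_integral => //.
  - by move=> t _; rewrite lee_fin rnorm_ge0.
  - exact: strongly_measurable_rnormE.
  - apply/measurable_EFinP; apply: measurable_funD => //.
    by apply: measurable_funX; exact: strongly_measurable_rnorm.
  - by move=> t _; rewrite -EFinD lee_fin; have := rnorm_ge0 (f t); nra.
rewrite ge0_integralD//=.
- apply: lte_add_pinfty => //; rewrite integral_cst//= mul1e.
  exact: finite_itv.
- by move=> t _; rewrite lee_fin sqr_ge0.
- apply/measurable_EFinP; apply: measurable_funX.
  exact: strongly_measurable_rnorm.
Qed.

(** Absolute continuity of the integral at the left end point. *)
Lemma L1norm_right_small (a b : R) f : a < b -> L1on `[a, b] f ->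
  forall e : R, 0 < e -> exists2 dl : R, 0 < dl &
  forall h, 0 < h -> h < dl -> a + h <= b -> (L1norm `]a, (a + h)%R] f < e%:E)%E.
Proof.
move=> ab [fm foo] e e0.
have intf : mu.-integrable `[a, b] (EFin \o (fun t => rnorm (f t))).
  apply/integrableP; split; first exact: strongly_measurable_rnormE.
  by under eq_integral do rewrite gee0_abs ?lee_fin ?rnorm_ge0//.
have := parameterized_integral_cvg_left ab intf.
move=> /cvgrPdist_lt/(_ e e0)/nbhs_ballP[dl /= dl0 H]; exists dl => // h h0 hdl hb.
have fm' : strongly_measurable `[a, a + h] f.
  apply: strongly_measurable_sub fm => t /=; rewrite !in_itv/= => /andP[-> /le_trans]; exact.
apply: (@le_lt_trans _ _ (L1norm `[a, a + h] f)).
  apply: ge0_subset_integral => //; first exact: strongly_measurable_rnormE.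
    by move=> t _; rewrite lee_fin rnorm_ge0.
  by move=> t /=; rewrite !in_itv/= => /andP[/ltW -> ->].
have := H (a + h); rewrite /ball/= opprD addrA subrr sub0r normrN gtr0_norm//.
move=> /(_ hdl); rewrite sub0r normrN /parameterized_integral /Rintegral.
have fin : L1norm `[a, a + h] f \is a fin_num.
  apply: L1norm_fin; apply: (@L1on_sub _ `[a, b]) => //.
  by move=> t /=; rewrite !in_itv/= => /andP[-> /le_trans]; exact.
rewrite -[X in fine X]/(L1norm `[a, a + h] f) ger0_norm; last first.
  by rewrite fine_ge0// L1norm_ge0.
by rewrite -lte_fin fineK.
Qed.

End L1on.

Section Linfty_operators.
Context {R : realType} {V W : normedModType R[i]}.
Implicit Types (D : set R) (F : R -> bounded_op V W) (f : R -> V).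

Lemma Linfty_bound F : Linfty F -> exists2 M : R, 0 < M &
  {ae mu, forall t, op_norm (F t) <= M}.
Proof.
move=> [_ [M HM]]; exists (`|M| + 1); first by rewrite ltr_wpDl.
apply: ae_imp HM => t h; rewrite (le_trans h)// (le_trans (ler_norm _))//.
by rewrite lerDl.
Qed.

Lemma Linfty_strongly_measurable D F f : Linfty F -> strongly_measurable D f ->
  strongly_measurable D (fun t => F t (f t)).
Proof.
move=> [Fm _]; apply: strongly_measurable_op.
by apply: strongly_measurable_sub Fm.
Qed.

Lemma L1norm_Linfty D F f (M : R) : measurable D -> Linfty F -> 0 <= M ->
  {ae mu, forall t, op_norm (F t) <= M} -> strongly_measurable D f ->
  (L1norm D (fun t => F t (f t)) <= M%:E * L1norm D f)%E.
Proof.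
move=> mD FL M0 FM fm; rewrite /L1norm -ge0_integralZl//=; last 2 first.
- exact: strongly_measurable_rnormE.
- by move=> t _; rewrite lee_fin rnorm_ge0.
apply: ae_ge0_le_integral => //.
- by move=> t _; rewrite lee_fin rnorm_ge0.
- by apply: strongly_measurable_rnormE; exact: Linfty_strongly_measurable.
- by move=> t _; rewrite -EFinM lee_fin mulr_ge0// rnorm_ge0.
- by apply: measurable_funeM; exact: strongly_measurable_rnormE.
apply: ae_imp FM => t FM _; rewrite -EFinM lee_fin.
by rewrite (le_trans (op_normP _ _))// ler_wpM2r// rnorm_ge0.
Qed.

Lemma L1on_Linfty D F f : measurable D -> Linfty F -> L1on D f ->
  L1on D (fun t => F t (f t)).
Proof.
move=> mD FL [fm foo]; split; first exact: Linfty_strongly_measurable.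
have [M M0 FM] := Linfty_bound FL.
rewrite (le_lt_trans (L1norm_Linfty mD FL (ltW M0) FM fm))//.
by apply: lte_mul_pinfty => //; rewrite lee_fin ltW.
Qed.

End Linfty_operators.

(** * The mild state *)

Lemma itv_setUcc (R : realType) (a b c : R) : a <= b -> b <= c ->
  (`[a, b] `|` `]b, c] = `[a, c])%classic.
Proof.
move=> ab bc; apply/seteqP; split => t /=; rewrite !in_itv/=.
  case=> /andP[h1 h2]; first by rewrite h1 (le_trans h2).
  by rewrite h2 andbT (le_trans ab)// ltW.
move=> /andP[h1 h2]; have [tb|bt] := leP t b; [left|right]; first by rewrite h1.
by rewrite h2.
Qed.

Lemma itv_setIcc (R : realType) (a b c : R) :
  (`[a, b] `&` `]b, c] = set0)%classic.
Proof.
rewrite -subset0 => t /= []; rewrite !in_itv/= => /andP[_ tb] /andP[bt _].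
by have := lt_le_trans bt tb; rewrite ltxx.
Qed.

Section mild.
Context {R : realType} {tau : R} {X : completeNormedModType R[i]}
  {U0 Ud0 Y0 : normedModType R[i]}.
Variable S : system X U0 Ud0 Y0.
Hypothesis PS : periodic_system tau S.
Implicit Types (D : set R) (u : R -> U0) (w : R -> Ud0).

Let UE : evolution_family (sysU S). Proof. by case: PS. Qed.
Let BL : Linfty (sysB S). Proof. by case: PS => _ _ []. Qed.
Let BdL : Linfty (sysBd S). Proof. by case: PS => _ _ []. Qed.

Definition forcing u w : R -> X := fun s => sysB S s (u s) + sysBd S s (w s).

(** The response to the inputs from the zero initial state. *)
Definition forced u w (t : R) : X :=
  bochner_integral `[0, t] (fun s => sysU S t s (forcing u w s)).

Lemma mild_stateE x u w t : mild_state S x u w t = sysU S t 0 x + forced u w t.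
Proof. by []. Qed.

Lemma L1on_forcing D u w : measurable D -> L1on D u -> L1on D w ->
  L1on D (forcing u w).
Proof. by move=> mD ul wl; apply: L1onD => //; exact: L1on_Linfty. Qed.

(** The integrand is extended by 0 from D to the whole interval from 0 to t, on
which [strongly_measurable_family] applies. *)
Lemma L1norm_evolution (T C t : R) D (g : R -> X) : measurable D ->
  D `<=` `[0, t]%classic -> t <= T -> 0 <= C ->
  (forall t s, 0 <= s -> s <= t -> t <= T -> op_norm (sysU S t s) <= C) ->
  L1on D g -> strongly_measurable D (fun s => sysU S t s (g s)) /\
  (L1norm D (fun s => sysU S t s (g s)) <= C%:E * L1norm D g)%E.
Proof.
move=> mD Dt tT C0 UC [gm goo].
have Ugm : strongly_measurable D (fun s => sysU S t s (g s)).
  pose g' := fun s => if s \in D then g s else 0.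
  have g'm : strongly_measurable `[0, t] g'.
    have [s [ss sg]] := gm.
    exists (fun n r => if r \in D then s n r else 0); split => [n|r _].
      by apply/step_mapP/step_map_if => //; [exact/step_mapP|exact: step_map_cst].
    rewrite /g'; case: ifPn => [/[1!inE]|_]; first exact: sg.
    exact: cvg_cst.
  have [t0|t0] := leP 0 t; last first.
    exists (fun _ _ => 0); split => [n|s /Dt /=]; first exact: simple_fun_cst.
    by rewrite in_itv/= => /andP[/le_trans h /h]; rewrite leNgt t0.
  have h := @strongly_measurable_family _ _ _ 0 t C (sysU S t) g' t0.
  apply: (@eq_strongly_measurable _ _ D (fun s => sysU S t s (g' s))).
    by move=> s Ds; rewrite /g' mem_set.
  apply: (strongly_measurable_sub Dt); apply: h => //.
    by move=> s s0 st; exact: UC.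
  by move=> x; exact: evolution_right_continuous.
split => //; rewrite /L1norm -ge0_integralZl//=; last 2 first.
- exact: strongly_measurable_rnormE.
- by move=> s _; rewrite lee_fin rnorm_ge0.
apply: ge0_le_integral => //.
- by move=> s _; rewrite lee_fin rnorm_ge0.
- exact: strongly_measurable_rnormE.
- by apply: measurable_funeM; exact: strongly_measurable_rnormE.
move=> s /Dt /=; rewrite in_itv/= => /andP[s0 st]; rewrite -EFinM lee_fin.
by rewrite (le_trans (op_normP _ _))// ler_wpM2r ?rnorm_ge0// UC.
Qed.

Lemma L1on_evolution (t : R) D (g : R -> X) : measurable D ->
  D `<=` `[0, t]%classic -> L1on D g -> L1on D (fun s => sysU S t s (g s)).
Proof.
move=> mD Dt gl; have [C C0 UC] := evolution_locally_bounded UE t.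
have [m l] := L1norm_evolution mD Dt (lexx t) (ltW C0) UC gl; split => //.
by rewrite (le_lt_trans l)//; apply: lte_mul_pinfty => //; [rewrite lee_fin ltW|exact: gl.2].
Qed.

Lemma forced_is t u w : L1on `[0, t] u -> L1on `[0, t] w ->
  bochner_integral_is `[0, t] (fun s => sysU S t s (forcing u w s)) (forced u w t).
Proof.
move=> ul wl.
have [m l] : L1on `[0, t] (fun s => sysU S t s (forcing u w s)).
  by apply: L1on_evolution => //; exact: L1on_forcing.
have [v vP] := bochner_integral_exists (measurable_itv _) (finite_itv _ _ _ _) m l.
by rewrite /forced (bochner_integralE _ _ vP)//; exact: finite_itv.
Qed.

(** Scalar multiplication is handled as the bounded operator [a *: id_op X], through
[bochner_integral_is_map]. *)
Lemma forced_linear t (a : R[i]) u w u' w' :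
  L1on `[0, t] u -> L1on `[0, t] w -> L1on `[0, t] u' -> L1on `[0, t] w' ->
  forced (a *: u + u') (a *: w + w') t = a *: forced u w t + forced u' w' t.
Proof.
move=> ul wl ul' wl'; apply: bochner_integralE => //; first exact: finite_itv.
have h1 := bochner_integral_is_map (measurable_itv _) (finite_itv _ _ _ _)
  (a *: id_op X) (forced_is ul wl).
have h2 := bochner_integral_isD (measurable_itv _) (finite_itv _ _ _ _) h1 (forced_is ul' wl').
apply: eq_bochner_integral_is h2 => s _.
rewrite !fctE /= /forcing !fctE !(linearP (sysB S s)) !(linearP (sysBd S s)).
rewrite -[X in X + _ = _]/(a *: sysU S t s (sysB S s (u s) + sysBd S s (w s))).
by rewrite -bopZ -bopD; congr (sysU S t s _); rewrite scalerDr addrACA.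
Qed.

Lemma forced_ae t u w u' w' : L1on `[0, t] u -> L1on `[0, t] w ->
  L1on `[0, t] u' -> L1on `[0, t] w' ->
  ae_eq mu `[0, t]%classic u u' -> ae_eq mu `[0, t]%classic w w' ->
  forced u w t = forced u' w' t.
Proof.
move=> ul wl ul' wl' uu ww; apply: bochner_integralE => //; first exact: finite_itv.
apply: (bochner_integral_is_ae _ _ _ (forced_is ul' wl')) => //.
  exact: (forced_is ul wl).1.
by apply: ae_imp2 uu ww => s us ws Is; rewrite /forcing us// ws.
Qed.

Lemma mild_state_bound (T : R) : exists2 C : R, 0 < C &
  forall x u w t, 0 <= t -> t <= T -> L1on `[0, T] u -> L1on `[0, T] w ->
  rnorm (mild_state S x u w t) <=
    C * (rnorm x + fine (L1norm `[0, T] u) + fine (L1norm `[0, T] w)).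
Proof.
have [C C0 UC] := evolution_locally_bounded UE T.
have [Mb Mb0 MbP] := Linfty_bound BL; have [Md Md0 MdP] := Linfty_bound BdL.
exists (C * (1 + Mb + Md)); first by rewrite mulr_gt0// !addr_gt0.
move=> x u w t t0 tT ul wl.
have sub : `[0, t]%classic `<=` `[0, T]%classic.
  by move=> s /=; rewrite !in_itv/= => /andP[-> /le_trans]; exact.
have ul' : L1on `[0, t] u by exact: L1on_sub ul.
have wl' : L1on `[0, t] w by exact: L1on_sub wl.
have fl := L1on_forcing (measurable_itv _) ul' wl'.
have [m l] := L1norm_evolution (measurable_itv _) (@subset_refl _ _) tT (ltW C0) UC fl.
have : ((rnorm (forced u w t))%:E <=
    C%:E * (Mb%:E * L1norm `[0%R, T] u + Md%:E * L1norm `[0%R, T] w))%E.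
  apply: (le_trans (bochner_integral_is_norm _ _ (forced_is ul' wl'))) => //.
    exact: finite_itv.
  apply: (le_trans l); apply: lee_wpmul2l; first by rewrite lee_fin ltW.
  apply: (le_trans (L1normD _ _ _)) => //.
  - exact: (L1on_Linfty _ BL ul').1.
  - exact: (L1on_Linfty _ BdL wl').1.
  apply: leeD.
    apply: (le_trans (L1norm_Linfty _ BL (ltW Mb0) MbP ul'.1)) => //.
    apply: lee_wpmul2l; first by rewrite lee_fin ltW.
    apply: ge0_subset_integral => //; first exact: strongly_measurable_rnormE ul.1.
    by move=> s _; rewrite lee_fin rnorm_ge0.
  apply: (le_trans (L1norm_Linfty _ BdL (ltW Md0) MdP wl'.1)) => //.
  apply: lee_wpmul2l; first by rewrite lee_fin ltW.
  apply: ge0_subset_integral => //; first exact: strongly_measurable_rnormE wl.1.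
  by move=> s _; rewrite lee_fin rnorm_ge0.
set a := fine _; set b := fine _ => h0.
have h : rnorm (forced u w t) <= C * (Mb * a + Md * b).
  by rewrite -lee_fin EFinM EFinD !EFinM !fineK//; exact: L1norm_fin.
have a0 : 0 <= a by rewrite fine_ge0// L1norm_ge0.
have b0 : 0 <= b by rewrite fine_ge0// L1norm_ge0.
rewrite mild_stateE (le_trans (rnormD _ _))//.
have := op_normP (sysU S t 0) x; have := ler_wpM2r (rnorm_ge0 x) (UC t 0 (lexx 0) t0 tT).
move=> h1 h2; have x0 := rnorm_ge0 x.
rewrite (@le_trans _ _ (C * rnorm x + C * (Mb * a + Md * b)))//.
  by apply: lerD => //; exact: le_trans h1.
rewrite -mulrDr -mulrA ler_pM2l//.
have := mulr_ge0 (ltW Mb0) x0; have := mulr_ge0 (ltW Md0) x0.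
have := mulr_ge0 (ltW Mb0) b0; have := mulr_ge0 (ltW Md0) a0.
lra.
Qed.

(** The variation of constants formula can be started afresh at time a: the cocycle
property of U moves [U (a + h) a] out of the part of the integral up to time a. *)
Lemma mild_state_restart x u w (a h : R) : 0 <= a -> 0 <= h ->
  L1on `[0, a + h] u -> L1on `[0, a + h] w ->
  exists2 I, bochner_integral_is `]a, a + h]
      (fun s => sysU S (a + h) s (forcing u w s)) I &
    mild_state S x u w (a + h) = sysU S (a + h) a (mild_state S x u w a) + I.
Proof.
move=> a0 h0 ul wl.
have aah : a <= a + h by rewrite lerDl.
have sub1 : `[0, a]%classic `<=` `[0, a + h]%classic.
  by move=> s /=; rewrite !in_itv/= => /andP[-> /le_trans]; exact.
have sub2 : `]a, a + h]%classic `<=` `[0, a + h]%classic.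
  by move=> s /=; rewrite !in_itv/= => /andP[/ltW/(le_trans a0) -> ->].
have fl := L1on_forcing (measurable_itv _) ul wl.
have [m l] := L1on_evolution (measurable_itv _) sub2 (L1on_sub (measurable_itv _) (measurable_itv _) sub2 fl).
have [I IP] := bochner_integral_exists (measurable_itv _) (finite_itv _ _ _ _) m l.
exists I => //; rewrite !mild_stateE bopD.
have [_ UU _] := UE.
rewrite UU// -addrA; congr (_ + _).
apply: bochner_integralE => //; first exact: finite_itv.
rewrite -(itv_setUcc a0 aah); apply: bochner_integral_is_setU => //.
- exact: finite_itv.
- exact: finite_itv.
- exact: itv_setIcc.
have ul' := L1on_sub (measurable_itv _) (measurable_itv _) sub1 ul.
have wl' := L1on_sub (measurable_itv _) (measurable_itv _) sub1 wl.
have := bochner_integral_is_map (measurable_itv _) (finite_itv _ _ _ _)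
  (sysU S (a + h) a) (forced_is ul' wl').
apply: eq_bochner_integral_is => s /=; rewrite in_itv/= => /andP[s0 sa].
by rewrite UU.
Qed.

(** After a short time h the formula restarted at s differs from the state at s by two
small terms: U(s + h, s) is strongly close to the identity, and the integral of the
forcing over a short interval is small.
Right-continuity is enough for measurability. *)
Lemma mild_state_right_continuous x u w (T : R) :
  L1on `[0, T] u -> L1on `[0, T] w ->
  right_continuous_on 0 T (mild_state S x u w).
Proof.
move=> ul wl s s0 sT e e0.
have e20 : 0 < e / 2 by rewrite divr_gt0.
have [C C0 UC] := evolution_locally_bounded UE T.
have [d1 d10 H1] := evolution_near UE (mild_state S x u w s) (lexx s) e20.
have sub : `[s, T]%classic `<=` `[0, T]%classic.
  by move=> r /=; rewrite !in_itv/= => /andP[/(le_trans s0) -> ->].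
have fl := L1on_sub (measurable_itv _) (measurable_itv _) sub
   (L1on_forcing (measurable_itv _) ul wl).
have eC0 : 0 < e / 2 / C by rewrite divr_gt0.
have [d2 d20 H2] := L1norm_right_small sT fl eC0.
exists (Num.min d1 d2); first by rewrite lt_min d10.
move=> s' ss' s'd s'T; pose h := s' - s.
have h0 : 0 < h by rewrite subr_gt0.
have s'E : s' = s + h by rewrite /h addrC subrK.
have hd : h < Num.min d1 d2 by rewrite /h ltrBlDl.
have [hd1 hd2] : h < d1 /\ h < d2 by move: hd; rewrite lt_min => /andP[].
have sub' : `[0, s + h]%classic `<=` `[0, T]%classic.
  by rewrite -s'E => r /=; rewrite !in_itv/= => /andP[-> /le_trans]; exact.
have [I IP] := mild_state_restart x s0 (ltW h0)
  (L1on_sub (measurable_itv _) (measurable_itv _) sub' ul)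
  (L1on_sub (measurable_itv _) (measurable_itv _) sub' wl).
rewrite s'E => ->; have [Uid _ _] := UE.
have sub2 : `]s, s + h]%classic `<=` `[0, s + h]%classic.
  by move=> r /=; rewrite !in_itv/= => /andP[/ltW/(le_trans s0) -> ->].
have sub3 : `]s, s + h]%classic `<=` `[0, T]%classic by move=> r /sub2 /sub'.
have gl := L1on_sub (measurable_itv _) (measurable_itv _) sub3
   (L1on_forcing (measurable_itv _) ul wl).
have shT : s + h <= T by rewrite -s'E.
have [m l] := L1norm_evolution (measurable_itv _) sub2 shT (ltW C0) UC gl.
have Ie : rnorm I < e / 2.
  rewrite -lte_fin; apply: (le_lt_trans (bochner_integral_is_norm _ _ IP)) => //.
    exact: finite_itv.
  apply: (le_lt_trans l); rewrite -lte_pdivlMl// -EFinM mulrC.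
  exact: H2.
have := H1 (s + h) s; rewrite Uid addrAC subrr add0r normr0 => /(_ _ _ d10).
rewrite lerDl gtr0_norm// => /(_ (ltW h0) hd1) h1.
rewrite addrAC [e]splitr (le_lt_trans (rnormD _ _))//; exact: ltrD.
Qed.

Lemma sysU_shift n s t : s <= t ->
  sysU S (t + n%:R * tau) (s + n%:R * tau) = sysU S t s.
Proof.
have [_ Up _ _] := PS; move=> st.
elim: n => [|n IH]; first by rewrite mul0r !addr0.
by rewrite -natr1 mulrDl mul1r !addrA Up// lerD2r.
Qed.

Lemma periodic_shift (T : Type) (F : R -> T) n t : Defs.periodic tau F ->
  F (t + n%:R * tau) = F t.
Proof.
move=> Fp; elim: n => [|n IH]; first by rewrite mul0r addr0.
by rewrite -natr1 mulrDl mul1r addrA Fp.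
Qed.

(** The restarted formula at n tau, translated back to time 0: the plant looks the
same in every period. *)
Lemma mild_state_periodic x u w n s : 0 <= tau -> 0 <= s ->
  L1on `[0, n%:R * tau + s] u -> L1on `[0, n%:R * tau + s] w ->
  mild_state S x u w (n%:R * tau + s) =
  mild_state S (mild_state S x u w (n%:R * tau))
    (fun t => u (t + n%:R * tau)) (fun t => w (t + n%:R * tau)) s.
Proof.
move=> tau0 s0 ul wl; set a := n%:R * tau.
have a0 : 0 <= a by rewrite mulr_ge0.
have [I IP ->] := mild_state_restart x a0 s0 ul wl.
rewrite mild_stateE; congr (_ + _).
  by rewrite addrC -[X in sysU S _ X](add0r a) sysU_shift.
apply/esym/bochner_integralE => //; first exact: finite_itv.
have IP' := bochner_integral_is_shift a (measurable_itv _) IP.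
have E : (fun t : R => t + a) @^-1` `]a, a + s] = `]0, s]%classic.
  by apply/seteqP; split => t /=; rewrite !in_itv/= ltrDr addrC lerD2l.
rewrite E in IP'.
have {}IP' : bochner_integral_is `]0, s]
    (fun r => sysU S s r (forcing (fun t => u (t + a)) (fun t => w (t + a)) r)) I.
  apply: eq_bochner_integral_is IP' => r /=; rewrite in_itv/= => /andP[r0 rs].
  rewrite addrC sysU_shift// /forcing.
  have [_ _ _ [Bp Bdp _ _]] := PS.
  by rewrite (periodic_shift n r Bp) (periodic_shift n r Bdp).
rewrite -(itv_setUcc (lexx 0) s0) -[I]add0r; apply: bochner_integral_is_setU => //.
- exact: finite_itv.
- exact: finite_itv.
- exact: itv_setIcc.
apply: bochner_integral_is_null => //.
  by rewrite set_itv1 lebesgue_measure_set1.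
exists (fun _ _ => sysU S s 0 (forcing (fun t => u (t + a)) (fun t => w (t + a)) 0)).
split => [k|t /=]; first exact: simple_fun_cst.
rewrite in_itv/= => /andP[t0 t0']; have -> : t = 0 by apply/eqP; rewrite eq_le t0 t0'.
exact: cvg_cst.
Qed.

End mild.

(** * Square integrable functions on one period *)

Section L2.
Context {R : realType} {tau : R} {V : normedModType R[i]}.
Local Notation J := (`[0, tau]%classic : set R).
Local Open Scope quotient_scope.
Implicit Types (f g : R -> V) (x y : L2 tau V).

Lemma L2classE f : square_integrable J f -> exists F : L2fun tau V,
  (F : R -> V) = f /\ L2class tau f = \pi_(L2 tau V) F.
Proof.
move=> fs; have fP : f \in @is_L2fun R tau V by apply/asboolP.
exists (BuildL2fun fP); split => //; rewrite /L2class; congr (\pi_(L2 tau V) _).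
by apply: val_inj; rewrite /= insubdK.
Qed.

Lemma L2val_square_integrable x : square_integrable J (L2val x).
Proof. exact: L2funP. Qed.

Lemma L2class_eq f g : square_integrable J f -> square_integrable J g ->
  ae_eq mu J f g -> L2class tau f = L2class tau g.
Proof.
move=> /L2classE[F [<- ->]] /L2classE[G [<- ->]] FG.
by apply/eqP/L2_eqP.
Qed.

Lemma L2valK x : L2class tau (L2val x) = x.
Proof.
have [F [FE ->]] := L2classE (L2val_square_integrable x).
rewrite -[RHS]reprK; congr (\pi_(L2 tau V) _); apply: val_inj.
exact: FE.
Qed.

Lemma L2val_class f : square_integrable J f ->
  ae_eq mu J (L2val (L2class tau f)) f.
Proof.
move=> /[dup] fs /L2classE[F [FE E]]; rewrite E -FE.
by apply/L2_eqP; rewrite reprK.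
Qed.

Lemma L2class_linear (a : R[i]) f g : square_integrable J f ->
  square_integrable J g ->
  L2class tau (a *: f + g) = a *: L2class tau f + L2class tau g.
Proof.
move=> fs gs; have ms : square_integrable J (a *: f + g).
  by apply: square_integrableD => //; exact: square_integrableZ.
have [F [FE ->]] := L2classE fs; have [G [GE ->]] := L2classE gs.
have [H [HE ->]] := L2classE ms.
rewrite L2_piZ L2_piD; congr (\pi_(L2 tau V) _); apply: val_inj.
by rewrite /= HE -FE -GE.
Qed.

Lemma L2classB f g : square_integrable J f -> square_integrable J g ->
  L2class tau (f - g) = L2class tau f - L2class tau g.
Proof.
move=> fs gs; rewrite (_ : f - g = -1 *: g + f); last by rewrite scaleN1r addrC.
by rewrite L2class_linear// scaleN1r addrC.
Qed.

Lemma L2val_linear (a : R[i]) x y :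
  ae_eq mu J (L2val (a *: x + y)) (a *: L2val x + L2val y).
Proof.
rewrite -{1}(L2valK x) -{1}(L2valK y) -L2class_linear; try exact: L2val_square_integrable.
apply: L2val_class; apply: square_integrableD => //; last exact: L2val_square_integrable.
by apply: square_integrableZ => //; exact: L2val_square_integrable.
Qed.

Lemma L2class_norm f : square_integrable J f ->
  ((rnorm (L2class tau f) ^+ 2)%:E = \int[mu]_(t in J) ((rnorm (f t)) ^+ 2)%:E)%E.
Proof.
move=> fs; have [F [FE ->]] := L2classE fs.
rewrite L2_normE L2_norm_pi FE sqr_sqrtr; last first.
  by apply: fine_ge0; apply: integral_ge0 => t _; rewrite lee_fin sqr_ge0.
rewrite fineK// ge0_fin_numE; first exact: fs.2.
by apply: integral_ge0 => t _; rewrite lee_fin sqr_ge0.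
Qed.

Lemma square_integrable_le f (G : R -> R) : strongly_measurable J f ->
  measurable_fun J G -> {ae mu, forall t, J t -> rnorm (f t) <= G t} ->
  (\int[mu]_(t in J) (G t ^+ 2)%:E < +oo)%E -> 
  square_integrable J f /\
  (\int[mu]_(t in J) (rnorm (f t) ^+ 2)%:E <= \int[mu]_(t in J) (G t ^+ 2)%:E)%E.
Proof.
move=> fm mG fG Goo.
suff h : (\int[mu]_(t in J) (rnorm (f t) ^+ 2)%:E <= \int[mu]_(t in J) (G t ^+ 2)%:E)%E.
  by split => //; split => //; exact: le_lt_trans h Goo.
apply: ae_ge0_le_integral => //.
- by move=> t _; rewrite lee_fin sqr_ge0.
- by apply/measurable_EFinP; apply: measurable_funX; exact: strongly_measurable_rnorm.
- by move=> t _; rewrite lee_fin sqr_ge0.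
- by apply/measurable_EFinP; apply: measurable_funX.
apply: ae_imp fG => t h Jt; rewrite lee_fin lerXn2r ?nnegrE ?rnorm_ge0 ?h//.
by rewrite (le_trans (rnorm_ge0 _) (h Jt)).
Qed.

Lemma L2class_bounded f (K : R) : 0 <= tau -> 0 <= K -> strongly_measurable J f ->
  {ae mu, forall t, J t -> rnorm (f t) <= K} ->
  square_integrable J f /\ rnorm (L2class tau f) <= K * (tau + 1).
Proof.
move=> tau0 K0 fm fK.
have IE : (\int[mu]_(t in J) (K ^+ 2)%:E = (K ^+ 2 * tau)%:E)%E.
  rewrite integral_cst//= lebesgue_measure_itv/= lte_fin.
  by case: ltgtP tau0 => // [tau0|<-] _; rewrite ?sube0 -?EFinM// mulr0 mule0.
have [] := @square_integrable_le f (fun=> K) fm _ fK; rewrite ?IE ?ltry//.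
move=> fs; rewrite -L2class_norm// lee_fin => h; split => //.
rewrite -(@ler_pXn2r _ 2) ?nnegrE ?rnorm_ge0 ?mulr_ge0 ?addr_ge0//.
rewrite (le_trans h)// exprMn ler_wpM2l ?sqr_ge0// expr2; nra.
Qed.

Lemma L2val_L1on x : L1on J (L2val x).
Proof. exact/square_integrable_L1on/L2val_square_integrable. Qed.

(** From [r <= c + c^-1 r^2] with [c] slightly larger than the L2 norm; the excess d
covers the case of norm 0. *)
Lemma L1norm_L2 x : 0 <= tau ->
  fine (L1norm J (L2val x)) <= (tau + 1) * rnorm x.
Proof.
move=> tau0; set n := rnorm x; have n0 : 0 <= n by exact: rnorm_ge0.
have xs := L2val_square_integrable x; have xl := L2val_L1on x.
suff h (d : R) : 0 < d -> fine (L1norm J (L2val x)) <= (tau + 1) * (n + d).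
  apply/ler_addgt0Pr => e e0.
  have t1 : 0 < tau + 1 by rewrite ltr_wpDl.
  have := h (e / (tau + 1)) (divr_gt0 e0 t1).
  by rewrite mulrDr mulrCA divff ?gt_eqF// mulr1.
move=> d0; set c := n + d; have c0 : 0 < c by rewrite ltr_wpDl.
rewrite -lee_fin fineK ?L1norm_fin//.
apply: (@le_trans _ _ (\int[mu]_(t in J) (c%:E + (c^-1)%:E * ((rnorm (L2val x t)) ^+ 2)%:E))%E).
  apply: ge0_le_integral => //.
  - by move=> t _; rewrite lee_fin rnorm_ge0.
  - by apply: strongly_measurable_rnormE; exact: xs.1.
  - apply: emeasurable_funD => //; apply: measurable_funeM.
    by apply/measurable_EFinP; apply: measurable_funX; apply: strongly_measurable_rnorm; exact: xs.1.
  move=> t _; rewrite -EFinM -EFinD lee_fin; set r := rnorm _.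
  rewrite -(ler_pM2l c0) mulrDr mulVKf ?gt_eqF//.
  have : 0 <= (c - r) ^+ 2 by exact: sqr_ge0.
  have : 0 <= c * r by rewrite mulr_ge0 ?rnorm_ge0// ltW.
  by rewrite !expr2; lra.
rewrite ge0_integralD//=; last 3 first.
- by move=> t _; rewrite lee_fin ltW.
- by move=> t _; rewrite -EFinM lee_fin mulr_ge0 ?sqr_ge0// invr_ge0 ltW.
- apply: measurable_funeM.
  by apply/measurable_EFinP; apply: measurable_funX; apply: strongly_measurable_rnorm; exact: xs.1.
rewrite ge0_integralZl//=; last 3 first.
- by apply/measurable_EFinP; apply: measurable_funX; apply: strongly_measurable_rnorm; exact: xs.1.
- by move=> t _; rewrite lee_fin sqr_ge0.
- by rewrite lee_fin invr_ge0 ltW.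
rewrite -L2class_norm// L2valK integral_cst//= lebesgue_measure_itv/= lte_fin.
rewrite (_ : (if 0 < tau then _ else _) = tau%:E); last first.
  by case: ltgtP tau0 => // [tau0|<-] _; rewrite ?sube0.
have h : c^-1 * n ^+ 2 <= c.
  by rewrite ler_pdivrMl// -expr2 lerXn2r ?nnegrE ?(ltW c0)// /c lerDl ltW.
by rewrite -!EFinM -EFinD lee_fin; move: h; rewrite -/n; lra.
Qed.

End L2.

Lemma L2class_dominated (R : realType) (tau : R) (V W : normedModType R[i])
    (f : R -> V) (x : L2 tau W) (M : R) : 0 <= M -> strongly_measurable `[0, tau] f ->
  {ae mu, forall t, `[0, tau]%classic t -> rnorm (f t) <= M * rnorm (L2val x t)} ->
  square_integrable `[0, tau] f /\ rnorm (L2class tau f) <= M * rnorm x.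
Proof.
move=> M0 fm fM.
have xs := L2val_square_integrable x.
have mx : measurable_fun `[0, tau] (fun t => rnorm (L2val x t)).
  by apply: strongly_measurable_rnorm; exact: xs.1.
have IE : (\int[mu]_(t in `[0%R, tau]) ((M * rnorm (L2val x t)) ^+ 2)%:E =
    ((M * rnorm x) ^+ 2)%:E)%E.
  under eq_integral do rewrite exprMn EFinM.
  rewrite ge0_integralZl//=; last 3 first.
  - by apply/measurable_EFinP; apply: measurable_funX.
  - by move=> t _; rewrite lee_fin sqr_ge0.
  - by rewrite lee_fin sqr_ge0.
  by rewrite -L2class_norm// L2valK -EFinM exprMn.
have [] := @square_integrable_le _ _ _ f (fun t => M * rnorm (L2val x t)) fm _ fM; rewrite ?IE ?ltry//.
  by apply: measurable_funM.
move=> fs; rewrite -L2class_norm// lee_fin => h; split => //.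
by rewrite -(@ler_pXn2r _ 2) ?nnegrE ?rnorm_ge0 ?mulr_ge0 ?rnorm_ge0.
Qed.

(** * The response over one period *)

Section sampled.
Context {R : realType} {tau : R} {X : completeNormedModType R[i]}
  {U0 Ud0 Y0 : normedModType R[i]}.
Variable S : system X U0 Ud0 Y0.
Hypotheses (PS : periodic_system tau S) (tau_gt0 : 0 < tau).
Local Notation J := (`[0, tau]%classic : set R).
Implicit Types (x : X) (u : L2 tau U0) (w : R -> Ud0).

Let tau_ge0 : 0 <= tau. Proof. exact: ltW. Qed.
Let CL : Linfty (sysC S). Proof. by case: PS => _ _ []. Qed.
Let DL : Linfty (sysD S). Proof. by case: PS => _ _ []. Qed.

Definition response x (u : R -> U0) w : R -> Y0 :=
  fun s => sysC S s (mild_state S x u w s) + sysD S s (u s).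

Definition sample_state x u w : X := mild_state S x (L2val u) w tau.

Definition sample_output x u w : L2 tau Y0 :=
  L2class tau (response x (L2val u) w).

Lemma mild_state_linear (a : R[i]) x x' u u' w w' t : 0 <= t -> t <= tau ->
  L1on J w -> L1on J w' ->
  mild_state S (a *: x + x') (L2val (a *: u + u')) (a *: w + w') t =
  a *: mild_state S x (L2val u) w t + mild_state S x' (L2val u') w' t.
Proof.
move=> t0 tt wl wl'.
have sub : `[0, t]%classic `<=` J.
  by move=> s /=; rewrite !in_itv/= => /andP[-> /le_trans]; exact.
have L1t (W : normedModType R[i]) (f : R -> W) : L1on J f -> L1on `[0, t] f.
  exact: L1on_sub.
have ul := L1t _ _ (L2val_L1on u); have ul' := L1t _ _ (L2val_L1on u').
have wt := L1t _ _ wl; have wt' := L1t _ _ wl'.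
have mt : measurable (`[0, t]%classic : set R) by [].
rewrite !mild_stateE (@forced_ae _ _ _ _ _ _ _ PS _ (L2val (a *: u + u')) (a *: w + w')
    (a *: L2val u + L2val u') (a *: w + w')).
- rewrite (forced_linear PS)// linearP /= scalerDr !addrA; congr (_ + _).
  by rewrite addrAC.
- exact: (L1t _ _ (L2val_L1on _)).
- by apply: L1onD => //; exact: L1onZ.
- by apply: L1onD => //; exact: L1onZ.
- by apply: L1onD => //; exact: L1onZ.
- by apply: ae_imp (L2val_linear a u u') => s h Ds; apply/h/sub.
- exact: ae_eq_refl.
Qed.

Lemma strongly_measurable_mild x u w : L1on J w ->
  strongly_measurable J (mild_state S x (L2val u) w).
Proof.
move=> wl; apply: right_continuous_strongly_measurable => //.
by apply: (mild_state_right_continuous PS) => //; exact: L2val_L1on.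
Qed.

(** One constant bounds the state throughout the period and the output over it; the
output is split into its bounded part [C x] and the part [D u] dominated by u. *)
Lemma response_bound : exists2 C : R, 0 < C & forall x u w, L1on J w ->
  [/\ forall t, 0 <= t -> t <= tau -> rnorm (mild_state S x (L2val u) w t) <=
        C * (rnorm x + rnorm u + fine (L1norm J w)),
      square_integrable J (response x (L2val u) w) &
      rnorm (sample_output x u w) <= C * (rnorm x + rnorm u + fine (L1norm J w))].
Proof.
have [C1 C10 C1P] := mild_state_bound PS tau.
have [Mc Mc0 McP] := Linfty_bound CL; have [Md Md0 MdP] := Linfty_bound DL.
pose C2 := C1 * (tau + 1).
have t1 : 1 <= tau + 1 by rewrite lerDr.
have C20 : 0 < C2 by rewrite mulr_gt0// (lt_le_trans ltr01).
pose C := C2 * (1 + Mc * (tau + 1)) + Md.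
have C0 : 0 < C by rewrite addr_gt0// mulr_gt0// addr_gt0// mulr_gt0// (lt_le_trans ltr01).
exists C => // x u w wl; set N := rnorm x + rnorm u + fine (L1norm J w).
have w0 : 0 <= fine (L1norm J w) by rewrite fine_ge0// L1norm_ge0.
have N0 : 0 <= N by rewrite !addr_ge0// rnorm_ge0.
have h1 t : 0 <= t -> t <= tau -> rnorm (mild_state S x (L2val u) w t) <= C2 * N.
  move=> t0 tt; rewrite (le_trans (C1P x _ w t t0 tt (L2val_L1on u) wl))//.
  rewrite /C2 -mulrA ler_pM2l// /N !mulrDr; apply: lerD; last by rewrite ler_peMl.
  by apply: lerD; [rewrite ler_peMl// rnorm_ge0|exact: L1norm_L2].
have C2C : C2 <= C.
  rewrite /C mulrDr mulr1 -addrA lerDl; apply: addr_ge0; last exact: ltW.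
  by apply: mulr_ge0; [exact: ltW|apply: mulr_ge0; [exact: ltW|exact: addr_ge0]].
have fm : strongly_measurable J (fun s => sysC S s (mild_state S x (L2val u) w s)).
  by apply: Linfty_strongly_measurable => //; exact: strongly_measurable_mild.
have gm : strongly_measurable J (fun s => sysD S s (L2val u s)).
  by apply: Linfty_strongly_measurable => //; exact: (L2val_L1on u).1.
have [fs fb] := @L2class_bounded _ tau _ _ (Mc * (C2 * N)) tau_ge0
  (mulr_ge0 (ltW Mc0) (mulr_ge0 (ltW C20) N0)) fm
  (ltac:(apply: ae_imp McP => t Mt /=; rewrite in_itv/= => /andP[t0 tt];
     apply: (le_trans (op_normP _ _));
     apply: ler_pM; [exact: op_norm_ge0|exact: rnorm_ge0|exact: Mt|exact: h1])).
have [gs gb] := @L2class_dominated _ tau _ _ _ u Md (ltW Md0) gm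
  (ltac:(apply: ae_imp MdP => t Mt _; apply: (le_trans (op_normP _ _));
    rewrite ler_wpM2r ?rnorm_ge0//)).
split => [t t0 tt||].
- by rewrite (le_trans (h1 t t0 tt))// ler_wpM2r.
- exact: square_integrableD.
have E : response x (L2val u) w = 1 *: (fun s => sysC S s (mild_state S x (L2val u) w s)) +
    (fun s => sysD S s (L2val u s)) by rewrite scale1r.
rewrite /sample_output E L2class_linear// scale1r (le_trans (rnormD _ _))//.
rewrite (le_trans (lerD fb gb))//.
have uN : rnorm u <= N by rewrite /N -addrA addrC -addrA lerDl addr_ge0// rnorm_ge0.
rewrite /C mulrDl; apply: lerD; last by rewrite ler_pM2l.
rewrite (_ : C2 * _ * N = C2 * N + Mc * (C2 * N) * (tau + 1)); last by ring.
by rewrite lerDr mulr_ge0// ltW.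
Qed.

Lemma square_integrable_response x u w : L1on J w ->
  square_integrable J (response x (L2val u) w).
Proof. by move=> wl; have [C _ /(_ x u w wl)[]] := response_bound. Qed.

Lemma sample_output_linear (a : R[i]) x x' u u' w w' : L1on J w -> L1on J w' ->
  sample_output (a *: x + x') (a *: u + u') (a *: w + w') =
  a *: sample_output x u w + sample_output x' u' w'.
Proof.
move=> wl wl'; rewrite -L2class_linear; try exact: square_integrable_response.
have wll : L1on J (a *: w + w') by apply: L1onD => //; exact: L1onZ.
apply: L2class_eq.
- exact: square_integrable_response.
- apply: square_integrableD => //; last exact: square_integrable_response.
  by apply: square_integrableZ => //; exact: square_integrable_response.
apply: ae_imp (L2val_linear a u u') => s h Js.
have {}h := h Js; move: Js => /=; rewrite in_itv/= => /andP[s0 st].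
rewrite /response !fctE /= mild_state_linear// h !fctE.
rewrite (linearP (sysC S s)) (linearP (sysD S s)) /= scalerDr.
exact: addrACA.
Qed.

Lemma sample_state_linear (a : R[i]) x x' u u' w w' : L1on J w -> L1on J w' ->
  sample_state (a *: x + x') (a *: u + u') (a *: w + w') =
  a *: sample_state x u w + sample_state x' u' w'.
Proof. by move=> wl wl'; exact: mild_state_linear. Qed.

(** The same disturbance in both periods cancels. *)
Lemma sample_stateB x x' u u' w : L1on J w ->
  sample_state (x - x') (u - u') (fun=> 0) =
  sample_state x u w - sample_state x' u' w.
Proof.
move=> wl; have w0 : (fun=> 0) = -1 *: w + w by rewrite scaleN1r addNr.
have E (V : lmodType R[i]) (y y' : V) : y - y' = -1 *: y' + y by rewrite scaleN1r addrC.
by rewrite w0 (E _ x) (E _ u) sample_state_linear// -E.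
Qed.

Lemma sample_outputB x x' u u' w : L1on J w ->
  sample_output (x - x') (u - u') (fun=> 0) =
  sample_output x u w - sample_output x' u' w.
Proof.
move=> wl; have w0 : (fun=> 0) = -1 *: w + w by rewrite scaleN1r addNr.
have E (V : lmodType R[i]) (y y' : V) : y - y' = -1 *: y' + y by rewrite scaleN1r addrC.
by rewrite w0 (E _ x) (E _ u) sample_output_linear// -E.
Qed.

Lemma mild_state0 x (u : R -> U0) w : L1on `[0, 0] u -> L1on `[0, 0] w ->
  mild_state S x u w 0 = x.
Proof.
move=> ul wl; have [[Uid _ _] _ _ _] := PS.
have m0 : mu (`[0, 0]%classic : set R) = 0%E by rewrite set_itv1 lebesgue_measure_set1.
rewrite mild_stateE Uid (_ : forced S u w 0 = 0) ?addr0//.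
apply: bochner_integralE => //; first exact: finite_itv.
apply: bochner_integral_is_null => //.
exact: (forced_is PS ul wl).1.
Qed.

End sampled.

(** * Sampling the closed loop *)

Section periods.
Context {R : realType} {V : normedModType R[i]}.
Variable tau : R.
Hypothesis tau_gt0 : 0 < tau.

(** Glues integrability over the half-open periods, the pieces on which the control
input is given. *)
Lemma L1on_periods (f : R -> V) :
  (forall n : nat, L1on `[0, tau[ (fun s => f (s + n%:R * tau))) ->
  forall T, L1on `[0, T] f.
Proof.
move=> fn T.
have step n : L1on `[0, n%:R * tau[ f.
  elim: n => [|n IH].
    have E : (`[0, 0%:R * tau[%classic : set R) = set0.
      by rewrite mul0r set_itvco0.
    rewrite E; split; last by rewrite /L1norm integral_set0.
    by exists (fun _ _ => 0) => //; split => // k; exact: simple_fun_cst.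
  have -> : `[0, n.+1%:R * tau[%classic =
      `[0, n%:R * tau[%classic `|` `[n%:R * tau, n.+1%:R * tau[%classic.
    apply/seteqP; split => t /=; rewrite !in_itv/=.
      by move=> /andP[h1 h2]; have [h|h] := ltP t (n%:R * tau); [left|right]; rewrite ?h1 ?h.
    case=> /andP[h1 h2]; first by rewrite h1 (lt_le_trans h2)// ler_pM2r// ler_nat.
    by rewrite h2 andbT (le_trans _ h1)// mulr_ge0// ltW.
  apply: L1on_setU => //.
    rewrite -subset0 => t /= []; rewrite !in_itv/= => /andP[_ h1] /andP[h2 _].
    by have := lt_le_trans h1 h2; rewrite ltxx.
  have := L1on_shift (- (n%:R * tau)) (measurable_itv _) (fn n).
  rewrite [X in L1on X _](_ : _ = `[n%:R * tau, n.+1%:R * tau[%classic); last first.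
    apply/seteqP; split => t /=; rewrite !in_itv/= subr_ge0 ltrBlDr -[n.+1]addn1.
      by rewrite natrD mulrDl mul1r [tau + _]addrC.
    by rewrite natrD mulrDl mul1r [tau + _]addrC.
  by apply: eq_L1on => t _; rewrite subrK.
pose n := (Num.truncn (T / tau)).+1.
apply: L1on_sub (step n) => // t /=; rewrite !in_itv/= => /andP[-> tT] /=.
by rewrite (le_lt_trans tT)// -ltr_pdivrMr// truncnS_gt.
Qed.

End periods.

Section control.
Context {R : realType} {tau : R} {X : completeNormedModType R[i]}
  {U0 Ud0 Y0 : normedModType R[i]} {Z : normedModType R[i]}.
Variable S : system X U0 Ud0 Y0.
Variable Ctrl : controller tau U0 Y0 Z.
Hypotheses (PS : periodic_system tau S) (tau_gt0 : 0 < tau).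
Local Notation J := (`[0, tau]%classic : set R).

Let tau_ge0 : 0 <= tau. Proof. exact: ltW. Qed.
Let CL : Linfty (sysC S). Proof. by case: PS => _ _ []. Qed.
Let DL : Linfty (sysD S). Proof. by case: PS => _ _ []. Qed.
Let Cp : Defs.periodic tau (sysC S). Proof. by case: PS => _ _ _ []. Qed.
Let Dp : Defs.periodic tau (sysD S). Proof. by case: PS => _ _ _ []. Qed.

Lemma control_inputE (z : nat -> Z) n s : 0 <= s -> s < tau ->
  control_input Ctrl z (s + n%:R * tau) = L2val (ctrlK Ctrl (z n)) s.
Proof.
move=> s0 st; rewrite /control_input.
have -> : Num.truncn ((s + n%:R * tau) / tau) = n.
  apply: truncn_def; rewrite mulrDl mulfK ?gt_eqF// lerDr divr_ge0//=.
  by rewrite -natr1 addrC ltrD2l ltr_pdivrMr// mul1r.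
by rewrite addrK.
Qed.

Lemma control_input_L1on (z : nat -> Z) T : L1on `[0, T] (control_input Ctrl z).
Proof.
apply: (L1on_periods tau_gt0) => n.
apply: (@eq_L1on _ _ _ (L2val (ctrlK Ctrl (z n)))).
  by move=> s /=; rewrite in_itv/= => /andP[s0 st]; rewrite control_inputE.
apply: (@L1on_sub _ _ _ J) => //; last exact: L2val_L1on.
by move=> s /=; rewrite !in_itv/= => /andP[-> /ltW ->].
Qed.

(** What the disturbance must satisfy for the sampled recursion; a disturbance that is
a linear combination inherits it from its components. *)
Definition periodic_input (W : normedModType R[i]) (w : R -> W) :=
  (forall T, L1on `[0, T] w) /\ forall t, 0 <= t -> w (t + tau) = w t.

Lemma periodic_inputE (W : normedModType R[i]) (w : R -> W) n s :
  (forall t, 0 <= t -> w (t + tau) = w t) -> 0 <= s -> w (s + n%:R * tau) = w s.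
Proof.
move=> wp s0; elim: n => [|n IH]; first by rewrite mul0r addr0.
by rewrite -natr1 mulrDl mul1r addrA wp// addr_ge0// mulr_ge0.
Qed.

Lemma ae_neq (a : R) : {ae mu, forall t : R, t <> a}.
Proof.
exists [set a]; split => //; first exact: lebesgue_measure_set1.
by move=> t /= /contrapT ->.
Qed.

(** Within the n-th period the closed loop is the plant driven by [K z_n]. At the end
point the control input already belongs to the next period, which is a null set. *)
Lemma mild_state_sampled x0 (z : nat -> Z) w n s : periodic_input w ->
  0 <= s -> s <= tau ->
  mild_state S x0 (control_input Ctrl z) w (n%:R * tau + s) =
  mild_state S (mild_state S x0 (control_input Ctrl z) w (n%:R * tau))
    (L2val (ctrlK Ctrl (z n))) w s.
Proof.
move=> [wl wp] s0 st.
suff E : forced S (fun t => control_input Ctrl z (t + n%:R * tau))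
    (fun t => w (t + n%:R * tau)) s = forced S (L2val (ctrlK Ctrl (z n))) w s.
  rewrite (mild_state_periodic PS x0 tau_ge0 s0 (control_input_L1on z _) (wl _)).
  by rewrite [LHS]mild_stateE E.
have Js : `[0, s]%classic `<=` J.
  by move=> t /=; rewrite !in_itv/= => /andP[-> /le_trans]; exact.
have shE : (fun t : R => t + n%:R * tau) @^-1` `[n%:R * tau, n%:R * tau + s] = `[0, s]%classic.
  by apply/seteqP; split => t /=; rewrite !in_itv/= lerDr [t + _]addrC lerD2l.
have sh (W : normedModType R[i]) (f : R -> W) : (forall T, L1on `[0, T] f) ->
    L1on `[0, s] (fun t => f (t + n%:R * tau)).
  move=> fl; rewrite -shE; apply: L1on_shift => //.
  apply: L1on_sub (fl (n%:R * tau + s)) => // t /=; rewrite !in_itv/= => /andP[h ->].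
  by rewrite andbT (le_trans _ h)// mulr_ge0.
apply: (forced_ae PS).
- by apply: sh => T; exact: control_input_L1on.
- exact: sh.
- by apply: (@L1on_sub _ _ _ J) => //; exact: L2val_L1on.
- exact: wl.
- apply: ae_imp (ae_neq tau) => t tt /Js /=; rewrite in_itv/= => /andP[t0 t1].
  by rewrite control_inputE// lt_neqAle t1 andbT; exact/eqP.
- apply: aeW => t /=; rewrite in_itv/= => /andP[t0 _].
  by rewrite (periodic_inputE n wp t0).
Qed.

(** The output agrees with the response except at the end of the period, where the
control input jumps. *)
Lemma output_sampled x0 (z : nat -> Z) w x y (yref : R -> Y0) n :
  periodic_input w -> square_integrable J yref ->
  (forall t, 0 <= t -> x t = mild_state S x0 (control_input Ctrl z) w t) ->
  (forall t, 0 <= t -> y t = output S x (control_input Ctrl z) t) ->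
  square_integrable J (fun s => y (n%:R * tau + s) - yref s) /\
  L2class tau (fun s => y (n%:R * tau + s) - yref s) =
  sample_output S (x (n%:R * tau)) (ctrlK Ctrl (z n)) w - L2class tau yref.
Proof.
move=> wP yrs xE yE; have [wl wp] := wP.
pose r := response S (x (n%:R * tau)) (L2val (ctrlK Ctrl (z n))) w.
have n0 : 0 <= n%:R * tau by rewrite mulr_ge0.
have rs : square_integrable J r by apply: square_integrable_response => //; exact: wl.
have yr s : 0 <= s -> s < tau -> y (n%:R * tau + s) = r s.
  move=> s0 st; have ns0 : 0 <= n%:R * tau + s by rewrite addr_ge0.
  rewrite yE// /output /r /response xE// mild_state_sampled//; last exact: ltW.
  rewrite -xE// [n%:R * tau + s]addrC control_inputE//.
  by rewrite (periodic_shift n s Cp) (periodic_shift n s Dp).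
have yae : ae_eq mu J (fun s => y (n%:R * tau + s)) r.
  apply: ae_imp (ae_neq tau) => s st /=; rewrite in_itv/= => /andP[s0 s1].
  by apply: yr => //; rewrite lt_neqAle s1 andbT; exact/eqP.
have ym : strongly_measurable J (fun s => y (n%:R * tau + s)).
  have -> : J = `[0, tau[%classic `|` [set tau].
    by rewrite setUitv1//= bnd_simp ltW.
  apply: strongly_measurable_setU => //.
    apply: (@eq_strongly_measurable _ _ _ r).
      by move=> s /=; rewrite in_itv/= => /andP[s0 s1]; rewrite yr.
    apply: strongly_measurable_sub rs.1 => s /=.
    by rewrite !in_itv/= => /andP[-> /ltW ->].
  exists (fun _ _ => y (n%:R * tau + tau)); split => [k|t /= ->].
    exact: simple_fun_cst.
  exact: cvg_cst.
have ys : square_integrable J (fun s => y (n%:R * tau + s)).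
  have yle : {ae mu, forall s, J s -> rnorm (y (n%:R * tau + s)) <= rnorm (r s)}.
    by apply: ae_imp yae => s h Js; rewrite h.
  exact: (square_integrable_le ym (strongly_measurable_rnorm rs.1) yle rs.2).1.
have Nyrs : square_integrable J (- yref).
  by rewrite -scaleN1r; exact: square_integrableZ.
have E : (fun s => y (n%:R * tau + s) - yref s) = (fun s => y (n%:R * tau + s)) - yref by [].
split; first by rewrite E; exact: (square_integrableD _ ys Nyrs).
by rewrite E L2classB//; congr (_ - _); exact: L2class_eq.
Qed.

End control.

(** * Tracking from closed-loop stability *)

Section signals.
Context {R : realType} {V : normedModType R[i]}.
Variable tau : R.
Local Notation J := (`[0, tau]%classic : set R).

Lemma periodic_signal_input (w : R -> V) :
  periodic_signal tau w -> periodic_input (tau := tau) w.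
Proof. by move=> [_ ws wp]; split => // T; exact: square_integrable_L1on. Qed.

Lemma periodic_input0 : periodic_input (tau := tau) (fun=> 0 : V).
Proof. by split => // T; exact: L1on0. Qed.

Lemma L1on_disturbance D q (v : 'I_q -> R[i]) (wk : 'I_q -> R -> V) :
  measurable D -> (forall k, L1on D (wk k)) ->
  L1on D (disturbance v wk) /\
  fine (L1norm D (disturbance v wk)) <= \sum_k cnorm (v k) * fine (L1norm D (wk k)).
Proof.
move=> mD wkl.
have H (r : seq 'I_q) : L1on D (fun t => \sum_(k <- r) v k *: wk k t) /\
    fine (L1norm D (fun t => \sum_(k <- r) v k *: wk k t)) <=
    \sum_(k <- r) cnorm (v k) * fine (L1norm D (wk k)).
  elim: r => [|k r [IH1 IH2]].
    rewrite (_ : (fun t => _) = (fun=> 0 : V)); last by apply/funext => t; rewrite big_nil.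
    by rewrite big_nil; split; [exact: L1on0|rewrite /L1norm integral0_eq// => t _; rewrite rnorm0].
  rewrite (_ : (fun t => _) = v k *: wk k + (fun t => \sum_(j <- r) v j *: wk j t)); last first.
    by apply/funext => t; rewrite big_cons fctE.
  have vl : L1on D (v k *: wk k) by exact: L1onZ.
  split; first exact: L1onD.
  rewrite big_cons -lee_fin fineK; last by apply: L1norm_fin; exact: L1onD.
  apply: (le_trans (L1normD mD vl.1 IH1.1)); rewrite EFinD; apply: leeD.
    rewrite L1normZ//; last exact: (wkl k).1.
    by rewrite EFinM fineK// L1norm_fin.
  by rewrite -(fineK (L1norm_fin IH1)) lee_fin.
have [h1 h2] := H (index_enum 'I_q); split; first exact: h1.
exact: h2.
Qed.

Lemma periodic_input_disturbance q (v : 'I_q -> R[i]) (wk : 'I_q -> R -> V) :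
  (forall k, periodic_input (tau := tau) (wk k)) ->
  periodic_input (tau := tau) (disturbance v wk).
Proof.
move=> wp; split => [T|t t0].
  by apply: (L1on_disturbance v _ _).1 => // k; exact: (wp k).1.
by rewrite /disturbance; apply: eq_bigr => k _; rewrite (wp k).2.
Qed.

End signals.

Lemma sum_sqr_le (R : realType) q (a : 'I_q -> R) :
  (\sum_k a k) ^+ 2 <= q%:R * \sum_k a k ^+ 2.
Proof.
have E : \sum_(j < q) \sum_(k < q) (a j ^+ 2 + a k ^+ 2) = 2 * (q%:R * \sum_k a k ^+ 2).
  under eq_bigr do rewrite big_split /= sumr_const card_ord.
  rewrite big_split /= sumr_const card_ord sumrMnl.
  by rewrite [q%:R * _]mulr_natl mulr_natl mulr2n.
rewrite -(ler_pM2l (ltr0n R 2)) -E expr2 mulr_suml mulr_sumr; apply: ler_sum => j _.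
rewrite mulrA mulr_sumr; apply: ler_sum => k _.
by have := sqr_ge0 (a j - a k); rewrite !expr2; lra.
Qed.

(** Passes from the norms of the data to their squares, the form in which the decay
of the tracking error is measured. *)
Lemma data_size_sqr (R : realType) q (a b : R) (c : 'I_q -> R) :
  (a + b + \sum_j c j + 1) ^+ 2 <=
  4 * (q%:R + 1) * (a ^+ 2 + b ^+ 2 + \sum_j c j ^+ 2 + 1).
Proof.
have := sum_sqr_le c.
have : 0 <= \sum_j c j ^+ 2 by apply: sumr_ge0 => j _; exact: sqr_ge0.
have q0 : 0 <= q%:R :> R by [].
move: (\sum_j c j) (\sum_j c j ^+ 2) q%:R q0 => s Q p p0 Q0 sQ.
have : (a + b + s + 1) ^+ 2 <= 4 * (a ^+ 2 + b ^+ 2 + s ^+ 2 + 1).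
  have := sqr_ge0 (a - b); have := sqr_ge0 (a - s); have := sqr_ge0 (a - 1).
  have := sqr_ge0 (b - s); have := sqr_ge0 (b - 1); have := sqr_ge0 (s - 1).
  by rewrite !expr2; lra.
move=> /le_trans; apply; rewrite -mulrA ler_pM2l//.
have := mulr_ge0 p0 (sqr_ge0 a); have := mulr_ge0 p0 (sqr_ge0 b).
by move: (a ^+ 2) (b ^+ 2) (s ^+ 2) sQ => x y z; lra.
Qed.

Lemma decay_sqr (R : realType) (e D E N Q c : R) : 0 <= e -> e <= D * E * N ->
  N ^+ 2 <= 4 * c * Q -> 1 <= c -> 0 <= Q ->
  e ^+ 2 <= (2 * c * D) ^+ 2 * (E * E) * Q.
Proof.
move=> e0 eN NQ c1 Q0.
have : e ^+ 2 <= (D * E * N) ^+ 2 by rewrite lerXn2r// nnegrE// (le_trans e0).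
move=> /le_trans; apply; rewrite exprMn.
apply: (@le_trans _ _ ((D * E) ^+ 2 * (4 * c * Q))); first by rewrite ler_wpM2l// sqr_ge0.
have c0 : 0 <= c by exact: le_trans c1.
have -> : (2 * c * D) ^+ 2 * (E * E) * Q = (D * E) ^+ 2 * (4 * c * Q) * c by ring.
by rewrite ler_peMr// mulr_ge0 ?sqr_ge0// !mulr_ge0.
Qed.

Lemma data_size_bound (R : realType) (a b c k W u d : R) :
  0 <= a -> 0 <= b -> 0 <= c -> 0 <= k -> 0 <= W -> u <= k * b -> d <= c * W ->
  a + u + d <= (1 + k + W) * (a + b + c + 1).
Proof.
move=> a0 b0 c0 k0 W0 uk dW.
have := mulr_ge0 k0 a0; have := mulr_ge0 k0 b0; have := mulr_ge0 k0 c0.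
have := mulr_ge0 W0 a0; have := mulr_ge0 W0 b0; have := mulr_ge0 W0 c0.
lra.
Qed.

Section tracking.
Context {R : realType} {tau : R} {X : completeNormedModType R[i]}
  {U0 Ud0 Y0 : normedModType R[i]}.
Variable S : system X U0 Ud0 Y0.
Variables (G2 : bounded_op (L2 tau Y0) (L2 tau Y0)) (K : bounded_op (L2 tau Y0) (L2 tau U0)).
Hypotheses (PS : periodic_system tau S) (tau_gt0 : 0 < tau).
Local Notation J := (`[0, tau]%classic : set R).
Let Ctrl := Controller (id_op (L2 tau Y0)) G2 K.

Lemma closed_loop_sampled yref w x0 z0 x z y :
  periodic_input (tau := tau) w -> square_integrable J yref ->
  closed_loop S Ctrl yref w x0 z0 x z y ->
  [/\ x 0 = x0,
    forall n : nat, x (n.+1%:R * tau) = sample_state S (x (n%:R * tau)) (K (z n)) w &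
    forall n, z n.+1 = z n + G2 (sample_output S (x (n%:R * tau)) (K (z n)) w
                                - L2class tau yref)].
Proof.
move=> wP yrs [xE yE z0E zE]; split.
- rewrite xE// (mild_state0 PS)//; first exact: control_input_L1on.
  exact: wP.1.
- move=> n; have t0 := ltW tau_gt0.
  have nt0 : 0 <= n%:R * tau by exact: mulr_ge0.
  rewrite -natr1 mulrDl mul1r xE; last exact: addr_ge0.
  by rewrite (mild_state_sampled _ PS)// -xE.
by move=> n; rewrite zE; have [_ ->] := output_sampled PS tau_gt0 n wP yrs xE yE.
Qed.

(** The internal model at work: the increments over one period form a trajectory of
the closed loop without reference and disturbance. *)
Lemma closed_loop_difference yref w x0 z0 x z y :
  periodic_input (tau := tau) w -> square_integrable J yref ->
  closed_loop S Ctrl yref w x0 z0 x z y ->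
  exists x' y', closed_loop S Ctrl (fun=> 0) (fun=> 0) (x tau - x0) (z 1%N - z0)
    x' (fun n => z n.+1 - z n) y'.
Proof.
move=> wP yrs CL; have [X0 XS ZS] := closed_loop_sampled wP yrs CL.
have z0E : z 0%N = z0 by case: CL.
pose dz n := z n.+1 - z n.
pose x' := mild_state S (x tau - x0) (control_input Ctrl dz) (fun=> 0).
pose y' := output S x' (control_input Ctrl dz).
have P0 : periodic_input (tau := tau) (fun=> 0 : Ud0) by exact: periodic_input0.
have wl : L1on J w := wP.1 tau.
have x'E n : x' (n%:R * tau) = x (n.+1%:R * tau) - x (n%:R * tau).
  elim: n => [|n IH].
    rewrite !mul0r mul1r X0 /x' (mild_state0 PS)//; last exact: L1on0.
    exact: control_input_L1on.
  rewrite -[in LHS]natr1 mulrDl mul1r /x' (mild_state_sampled _ PS)//; last exact: ltW.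
  rewrite -/x' IH -[LHS]/(sample_state S _ (K (z n.+1 - z n)) (fun=> 0)).
  by rewrite bopB (sample_stateB PS tau_gt0 _ _ _ _ wl) -!XS.
exists x', y'; split => //=.
  by rewrite z0E.
move=> n; have y'E := output_sampled PS tau_gt0 n P0 (square_integrable0 J)
   (fun t _ => erefl (x' t)) (fun t _ => erefl (y' t)).
have {y'E}[_] := y'E; rewrite -/Ctrl => y'E.
have -> : (fun s => y' (n%:R * tau + s) - 0) = (fun s => y' (n%:R * tau + s) - (0 : R -> Y0) s) by [].
rewrite y'E x'E /= (_ : L2class tau (0 : R -> Y0) = 0) ?subr0; last first.
  by rewrite -(subrr (0 : R -> Y0)) L2classB ?subrr//; exact: square_integrable0.
rewrite bopB (sample_outputB PS tau_gt0 _ _ _ _ wl).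
have dzE m : z m.+1 - z m = G2 (sample_output S (x (m%:R * tau)) (K (z m)) w
    - L2class tau yref) by rewrite {1}ZS addrC addKr.
rewrite !dzE -bopD; congr (G2 _).
by rewrite [RHS]addrC addrA subrK.
Qed.

Lemma tracking_error_sqr (y yref : R -> Y0) n : (forall t, 0 <= t -> yref (t + tau) = yref t) ->
  square_integrable J (fun s => y (n%:R * tau + s) - yref s) ->
  (\int[mu]_(t in `[(n%:R * tau)%R, (n.+1%:R * tau)%R])
      ((rnorm (y t - yref t)) ^+ 2)%:E =
    (rnorm (L2class tau (fun s => y (n%:R * tau + s) - yref s)) ^+ 2)%:E)%E.
Proof.
move=> yp gs; pose g s := y (n%:R * tau + s) - yref s.
rewrite -/g in gs *.
rewrite L2class_norm//.
have := @ge0_integral_shift _ (- (n%:R * tau)) J (fun t => (rnorm (g t) ^+ 2)%:E) (measurable_itv _).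
rewrite (_ : _ @^-1` J = `[(n%:R * tau)%R, (n.+1%:R * tau)%R]%classic); last first.
  apply/seteqP; split => t /=; rewrite !in_itv/= subr_ge0 lerBlDr -[n.+1]addn1;
  by rewrite natrD mulrDl mul1r [tau + _]addrC.
move=> <-.
- apply: eq_integral => t /[1!inE] /=; rewrite in_itv/= => /andP[tn _].
  rewrite /g [n%:R * tau + _]addrC subrK; congr ((rnorm (_ - _) ^+ 2)%:E).
  by rewrite -[in LHS](subrK (n%:R * tau) t) (periodic_inputE tau_gt0 n yp)// subr_ge0.
- by apply/measurable_EFinP; apply: measurable_funX; exact: strongly_measurable_rnorm gs.1.
- by move=> t _; rewrite lee_fin sqr_ge0.
Qed.

(** The tracking error of the n-th period is [G2^-1 (z_(n+1) - z_n)], and the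
increments decay by [closed_loop_difference]. The constant D combines the bound of
the first increment by the data, the constant of closed-loop stability and the norm
of G2^-1. *)
Theorem internal_model_tracking (yref : R -> Y0) q (wk : 'I_q -> R -> Ud0) :
  boundedly_invertible G2 -> periodic_signal tau yref ->
  (forall k, periodic_signal tau (wk k)) ->
  closed_loop_stable S Ctrl -> output_tracking S Ctrl yref wk.
Proof.
move=> [G2i [G2K KG2]] [yrm yrs yrp] wkP.
move=> [M0 [M1 [a0 [a1 [[M00 M10 a00 a10] stab]]]]].
have [C C0 CP] := response_bound PS tau_gt0.
have wki k := periodic_signal_input (wkP k).
pose W := \sum_k fine (L1norm J (wk k)).
have W0 : 0 <= W by apply: sumr_ge0 => k _; rewrite fine_ge0// L1norm_ge0.
pose r := rnorm (L2class tau yref); have r0 : 0 <= r by exact: rnorm_ge0.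
pose k := op_norm K; have k0 : 0 <= k by exact: op_norm_ge0.
pose g := op_norm G2; have g0 : 0 <= g by exact: op_norm_ge0.
pose gi := op_norm G2i; have gi0 : 0 <= gi by exact: op_norm_ge0.
pose c1 := C * (1 + k + W).
have c10 : 0 <= c1 by rewrite mulr_ge0 ?(ltW C0)// !addr_ge0.
pose D := (gi + 1) * M1 * (c1 + 1 + g * (c1 + r)).
have D0 : 0 < D.
  apply: mulr_gt0; first by rewrite mulr_gt0// ltr_wpDl.
  by apply: ltr_wpDr; [rewrite mulr_ge0// addr_ge0|rewrite ltr_wpDl].
exists (2 * (q%:R + 1) * D), a1; split => //.
  by apply: mulr_gt0 => //; apply: mulr_gt0 => //; rewrite ltr_wpDl.
move=> x0 z0 v x z y CL n.
have wP : periodic_input (tau := tau) (disturbance v wk).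
  exact: periodic_input_disturbance.
have yrsJ : square_integrable J yref by exact: yrs.
have [X0 XS ZS] := closed_loop_sampled wP yrsJ CL.
have [x' [y' CL']] := closed_loop_difference wP yrsJ CL.
have [_ /(_ n) zn] := stab _ _ _ _ _ CL'.
have [xE yE z0E zE] := CL.
have [es eE] := output_sampled PS tau_gt0 n wP yrsJ xE yE.
rewrite (tracking_error_sqr yrp es) lee_fin.
set e := L2class tau _ in eE *.
have eG : e = G2i (z n.+1 - z n) by rewrite ZS -eE addrC addKr G2K.
pose s := \sum_j cnorm (v j); have s0 : 0 <= s by apply: sumr_ge0 => j _; exact: cnorm_ge0.
have ws : fine (L1norm J (disturbance v wk)) <= s * W.
  apply: le_trans (L1on_disturbance v (measurable_itv _) (fun k => (wki k).1 tau)).2 _.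
  rewrite /s mulr_suml; apply: ler_sum => j _; rewrite ler_wpM2l ?cnorm_ge0//.
  rewrite /W (bigD1 j)//= lerDl; apply: sumr_ge0 => i _.
  by rewrite fine_ge0// L1norm_ge0.
pose N := rnorm x0 + rnorm z0 + s + 1.
have [x00 z00] := (rnorm_ge0 x0, rnorm_ge0 z0).
have N0 : 0 <= N by rewrite !addr_ge0.
have [b1 _ b2] := CP x0 (K z0) _ (wP.1 tau).
have Kz : rnorm (K z0) <= k * rnorm z0 by exact: op_normP.
have inner : C * (rnorm x0 + rnorm (K z0) + fine (L1norm J (disturbance v wk))) <= c1 * N.
  by rewrite /c1 -mulrA ler_pM2l//; exact: data_size_bound.
have dx : rnorm (x tau - x0) <= (c1 + 1) * N.
  rewrite (le_trans (rnormB _ _))// mulrDl mul1r; apply: lerD; last first.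
    by rewrite /N -!addrA lerDl !addr_ge0.
  have := XS 0%N; rewrite mul0r mul1r X0 z0E => ->.
  by apply: le_trans (b1 _ _ _) inner => //; exact: ltW.
have dz : rnorm (z 1%N - z 0%N) <= g * (c1 + r) * N.
  rewrite ZS addrC addKr (le_trans (op_normP _ _))// -mulrA ler_wpM2l//.
  rewrite mul0r X0 z0E (le_trans (rnormB _ _))// mulrDl; apply: lerD.
    exact: le_trans b2 inner.
  by rewrite ler_peMr// /N lerDr !addr_ge0.
have eN : rnorm e <= D * expR (- a1 * n%:R) * N.
  rewrite eG (le_trans (op_normP _ _))//.
  have E0 := expR_ge0 (- a1 * n%:R); set E := expR _ in zn E0 *.
  apply: (@le_trans _ _ ((gi + 1) * (M1 * E * ((c1 + 1 + g * (c1 + r)) * N)))).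
    apply: ler_pM => //; first exact: rnorm_ge0; first by rewrite lerDl.
    rewrite (le_trans zn)// ler_wpM2l ?mulr_ge0 ?(ltW M10)//.
    by rewrite mulrDl; apply: lerD => //; rewrite -z0E.
  by rewrite /D le_eqVlt; apply/orP; left; apply/eqP; ring.
have -> : expR (- 2 * a1 * n%:R) = expR (- a1 * n%:R) * expR (- a1 * n%:R).
  by rewrite -expRD; congr expR; ring.
have Nq := data_size_sqr (rnorm x0) (rnorm z0) (fun j => cnorm (v j)).
rewrite -/s -/N in Nq; clearbody D N.
apply: (decay_sqr (rnorm_ge0 e) eN Nq); first by rewrite lerDr.
by rewrite !addr_ge0 ?sqr_ge0//; apply: sumr_ge0 => j _; exact: sqr_ge0.
Qed.

End tracking.

(** * Stability of the slow-fast recursion *)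

Section power_contraction.
Context {R : realType}.

(** In the adapted norm T is a contraction, so [id - T] is bounded below and its
inverse is found by fixed-point iteration. *)
Lemma power_contraction_inverse (V : completeNormedModType R[i])
    (T : bounded_op V V) (k : nat) : (0 < k)%N -> bounded_by (iter k T) 2^-1 ->
  exists Rv : bounded_op V V, (forall x, Rv (x - T x) = x) /\
    (forall y, Rv y - T (Rv y) = y).
Proof.
move=> k0 Tk; have [N [r [C [r0 r1 C0 [N1 N2 N3 N4 N5]]]]] :=
  exists_adapted_norm (T := T) k0 (op_norm_ge0 T) (@bounded_opW _ _ _ T) Tk.
have N0 x : 0 <= N x by rewrite (le_trans (rnorm_ge0 x)).
have r1' : 0 < 1 - r by rewrite subr_gt0.
have bnd x : N x <= N (x - T x) / (1 - r).
  rewrite ler_pdivlMr//; have := N3 (x - T x) (T x); rewrite subrK.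
  by have := N5 x; lra.
have inj x : x - T x = 0 -> x = 0.
  move=> h; apply: rnorm0_eq0; apply/eqP; rewrite eq_le rnorm_ge0 andbT.
  rewrite (le_trans (N1 x))// (le_trans (bnd x))// h.
  rewrite -[X in N X](scale0r (0 : V)) N4 (_ : cnorm 0 = 0) ?mul0r//.
  by apply/eqP; rewrite cnorm_eq0.
have surj y : exists x, x - T x = y.
  pose s := fix s n := if n is m.+1 then y + T (s m) else 0.
  have sd n : N (s n.+1 - s n) <= r ^+ n * N y.
    elim: n => [|n IH]; first by rewrite /= bop0 addr0 subr0 mul1r.
    rewrite (_ : s n.+2 - s n.+1 = (y + T (s n.+1)) - (y + T (s n)))//.
    rewrite opprD addrACA subrr add0r -bopB (le_trans (N5 _))//.
    by rewrite exprS -mulrA ler_wpM2l// ltW.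
  have sk n j : N (s (n + j)%N - s n) <= r ^+ n * (N y / (1 - r)).
    suff : N (s (n + j)%N - s n) <= (r ^+ n - r ^+ (n + j)) * (N y / (1 - r)).
      move=> /le_trans; apply; rewrite ler_wpM2r ?divr_ge0 ?(ltW r1')// gerBl.
      by rewrite exprn_ge0// ltW.
    elim: j => [|j IH].
      by rewrite addn0 !subrr mul0r -[X in N X](scale0r (0 : V)) N4 cnorm_real normr0 mul0r.
    have := N3 (s (n + j.+1)%N - s (n + j)%N) (s (n + j)%N - s n).
    rewrite addrA subrK => /le_trans; apply.
    have := sd (n + j)%N; rewrite addnS => h; rewrite (le_trans (lerD h IH))//.
    rewrite exprS -[in X in X * N y](divfK (lt0r_neq0 r1') (r ^+ (n + j))).
    rewrite le_eqVlt; apply/orP; left; apply/eqP; field; exact: lt0r_neq0.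
  have [l sl] : exists l : V, s n @[n --> \oo] --> l.
    apply: rnorm_cauchy_cvg => e e0.
    pose c := 2 * (N y / (1 - r)) + 1.
    have c0 : 0 < c by rewrite ltr_wpDl// mulr_ge0// divr_ge0// ltW.
    have : r ^+ n @[n --> \oo] --> (0 : R) by apply: cvg_expr; rewrite gtr0_norm.
    have ec : 0 < e / c by rewrite divr_gt0.
    move=> /cvgrPdist_lt/(_ _ ec)[M _ /(_ M (leqnn M))] /=.
    rewrite sub0r normrN ger0_norm ?exprn_ge0 ?(ltW r0)// ltr_pdivlMr// => Me.
    exists M => m n Mm Mn; rewrite (le_lt_trans (rnorm_dist (s M) _ _))//.
    rewrite [X in _ + X]rnormBC; apply: le_lt_trans Me.
    have := sk M (m - M)%N; rewrite subnKC// => h1.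
    have := sk M (n - M)%N; rewrite subnKC// => h2.
    apply: (le_trans (lerD (le_trans (N1 _) h1) (le_trans (N1 _) h2))).
    have := exprn_ge0 M (ltW r0); rewrite /c.
    by move: (N y / (1 - r)) (r ^+ M) => a b; lra.
  exists l; apply/eqP; rewrite subr_eq; apply/eqP.
  have s1 : s n.+1 @[n --> \oo] --> l by move: sl; rewrite -cvg_shiftS.
  have s2 : s n.+1 @[n --> \oo] --> y + T l.
    apply: cvgD; first exact: cvg_cst.
    exact: (continuous_cvg _ (@bounded_op_continuous _ _ _ T l)).
  exact: (cvg_unique _ s1 s2).
have [f fP] := choice surj.
have flin : linear f.
  move=> a x y; apply/eqP; rewrite -subr_eq0; apply/eqP/inj.
  have E : (a *: f x + f y) - T (a *: f x + f y) = a *: x + y.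
    by rewrite bopD bopZ opprD addrACA -scalerBr !fP.
  by rewrite bopB subrACA fP E subrr.
have fb : bounded_by f (C / (1 - r)).
  move=> y; rewrite (le_trans (N1 _))// (le_trans (bnd _))// fP mulrAC.
  by rewrite ler_wpM2r// invr_ge0 ltW.
have [Rv RvE] := bounded_op_of flin fb.
exists Rv; split => [x|y]; last by rewrite RvE fP.
apply/eqP; rewrite -subr_eq0; apply/eqP/inj.
by rewrite RvE (bopB T) subrACA fP subrr.
Qed.

(** Here p is the size of the fast and s that of the slow variable. The weight kap
makes the feed [c3 p] into the slow variable cost at most half of the fast decay
[1 - rho]; what the slow variable feeds back has an extra factor e, so for small e it
costs at most half of the slow decay [e dl]. *)
Lemma slow_fast_weight (rho c1 c2 c3 dl : R) : 0 < rho -> rho < 1 ->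
  0 <= c1 -> 0 <= c2 -> 0 <= c3 -> 0 < dl ->
  exists kap es : R, [/\ 1 <= kap, 0 < es, es <= 1 & forall e, 0 < e -> e <= es ->
  exists th : R, [/\ 0 < th, th < 1 & forall p s p' s', 0 <= p -> 0 <= s ->
    p' <= (rho + e * c1) * p + e * (e * c2) * s ->
    s' <= c3 * p + (1 - e * dl) * s ->
    kap * p' + s' <= th * (kap * p + s)]].
Proof.
move=> rho0 rho1 c10 c20 c30 dl0.
have rho1' : 0 < 1 - rho by rewrite subr_gt0.
pose kap := 2 * (c3 + 1) / (1 - rho).
have kapE : kap * (1 - rho) = 2 * (c3 + 1) by rewrite /kap divfK// gt_eqF.
have kap1 : 1 <= kap by rewrite /kap ler_pdivlMr// mul1r; lra.
have kap0 : 0 < kap by exact: lt_le_trans kap1.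
clearbody kap; pose e1 := (1 - rho) / (4 * (c1 + 1)); pose e2 := dl / (2 * kap * (c2 + 1)).
have c11 : 0 < c1 + 1 by rewrite ltr_wpDl.
have c21 : 0 < c2 + 1 by rewrite ltr_wpDl.
have e10 : 0 < e1 by rewrite divr_gt0// mulr_gt0.
have e20 : 0 < e2 by rewrite divr_gt0// !mulr_gt0.
exists kap, (Num.min 1 (Num.min e1 e2)); split => //.
- by rewrite !lt_min ltr01 e10.
- by rewrite ge_min lexx.
move=> e e0; rewrite !le_min => /and3P[_ ee1 ee2].
have h1 : e * c1 <= (1 - rho) / 4.
  apply: (@le_trans _ _ (e1 * (c1 + 1))); last first.
    by rewrite /e1 le_eqVlt; apply/orP; left; apply/eqP; field; rewrite gt_eqF.
  by apply: ler_pM => //; [exact: ltW|rewrite lerDl].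
have h2 : kap * (e * c2) <= dl / 2.
  apply: (@le_trans _ _ (kap * (e2 * (c2 + 1)))); last first.
    rewrite /e2 le_eqVlt; apply/orP; left; apply/eqP; field.
    by rewrite !gt_eqF.
  rewrite ler_pM2l//.
  by apply: ler_pM => //; [exact: ltW|rewrite lerDl].
exists (Num.max ((3 + rho) / 4) (1 - e * dl / 2)); split.
- by rewrite lt_max divr_gt0// addr_gt0.
- rewrite gt_max; apply/andP; split; first by lra.
  by rewrite ltrBlDr ltrDl divr_gt0// mulr_gt0.
move=> p s p' s' p0 s0 pp ss; set th := Num.max _ _.
have t1 : (3 + rho) / 4 <= th by rewrite le_max lexx.
have t2 : 1 - e * dl / 2 <= th by rewrite le_max lexx orbT.
clearbody th; rewrite mulrDr.
have a1 : kap * p' <= kap * ((rho + e * c1) * p + e * (e * c2) * s) by rewrite ler_pM2l.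
have a2 : kap * p * (rho + e * c1) + c3 * p <= th * (kap * p).
  apply: (@le_trans _ _ ((3 + rho) / 4 * (kap * p))); last first.
    by rewrite ler_wpM2r// mulr_ge0// ltW.
  have := ler_wpM2l (mulr_ge0 (ltW kap0) p0) h1.
  have : c3 * p <= kap * (1 - rho) / 2 * p by rewrite ler_wpM2r// kapE; lra.
  lra.
have a3 : kap * (e * (e * c2)) * s + (1 - e * dl) * s <= th * s.
  rewrite -mulrDl ler_wpM2r// (le_trans _ t2)//.
  have := ler_wpM2l (ltW e0) h2; lra.
lra.
Qed.

(** The fast variable is the deviation [x - e h z] from the slow manifold, on which
[x = A x + e b z]; in it the coupling from z has order [e^2] instead of e. *)
Lemma slow_fast_contraction (X Z W : normedModType R[i])
    (A : bounded_op X X) (h b : bounded_op Z X) (c : bounded_op X W)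
    (d : bounded_op Z W) (G : bounded_op W Z) (Q : bounded_op Z Z) (k l : nat) (e0 : R) :
  (0 < k)%N -> bounded_by (iter k A) 2^-1 ->
  (forall z, h z - A (h z) = b z) -> (forall z, Q z = G (c (h z) + d z)) ->
  0 < e0 -> (0 < l)%N -> bounded_by (iter l (euler_step Q e0 0)) 2^-1 ->
  exists2 es : R, 0 < es & forall e, 0 < e -> e <= es ->
  exists C th : R, [/\ 0 < C, 0 < th, th < 1 &
    forall (x : nat -> X) (z : nat -> Z),
      (forall n, x n.+1 = A (x n) + e%:C *: b (z n)) ->
      (forall n, z n.+1 = z n + G (c (x n) + e%:C *: d (z n))) ->
      forall n, rnorm (x n) + rnorm (z n) <=
        C * th ^+ n * (rnorm (x 0%N) + rnorm (z 0%N))].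
Proof.
move=> k0 Ak hb Qd e00 l0 Tl.
have [NX [rho [CX [rho0 rho1 CX0 [X1 X2 X3 X4 X5]]]]] :=
  exists_adapted_norm (T := A) k0 (op_norm_ge0 A) (@bounded_opW _ _ _ A) Ak.
have q0 : 0 <= 1 - 0 + e0 * op_norm Q.
  by rewrite subr0 addr_ge0// mulr_ge0 ?op_norm_ge0// ltW.
have [NZ [r [CZ [r0 r1 CZ0 [Z1 Z2 Z3 Z4 Z5]]]]] :=
  exists_adapted_norm (T := euler_step Q e0 0) l0 q0
    (euler_step_bounded Q (ltW e00) (lexx 0) ler01) Tl.
have NX0 x : 0 <= NX x := le_trans (rnorm_ge0 x) (X1 x).
have NZ0 x : 0 <= NZ x := le_trans (rnorm_ge0 x) (Z1 x).
pose c3 := CZ * (op_norm G * op_norm c).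
have c30 : 0 <= c3 by rewrite mulr_ge0 ?(ltW CZ0)// mulr_ge0// op_norm_ge0.
have c3P x : NZ (G (c x)) <= c3 * NX x.
  rewrite (le_trans (Z2 _))// /c3 -mulrA ler_pM2l//.
  rewrite (le_trans (op_normP _ _))// -mulrA ler_wpM2l ?op_norm_ge0//.
  rewrite (le_trans (op_normP _ _))// ler_wpM2l ?op_norm_ge0//.
pose ch := CX * op_norm h.
have ch0 : 0 <= ch by rewrite mulr_ge0 ?(ltW CX0)// op_norm_ge0.
have chP z : NX (h z) <= ch * NZ z.
  rewrite (le_trans (X2 _))// /ch -mulrA ler_pM2l//.
  by rewrite (le_trans (op_normP _ _))// ler_wpM2l ?op_norm_ge0.
pose cq := CZ * op_norm Q.
have cq0 : 0 <= cq by rewrite mulr_ge0 ?(ltW CZ0)// op_norm_ge0.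
have cqP z : NZ (Q z) <= cq * NZ z.
  rewrite (le_trans (Z2 _))// /cq -mulrA ler_pM2l//.
  by rewrite (le_trans (op_normP _ _))// ler_wpM2l ?op_norm_ge0.
clearbody c3 ch cq; pose dl := (1 - r) / e0; have dl0 : 0 < dl by rewrite divr_gt0// subr_gt0.
(* id + e Q is a convex combination of id and of the contraction id + e0 Q *)
have slow e z : 0 < e -> e <= e0 -> NZ (z + e%:C *: Q z) <= (1 - e * dl) * NZ z.
  move=> e1 e2; have ee : 0 <= 1 - e / e0 by rewrite subr_ge0 ler_pdivrMr// mul1r.
  have -> : z + e%:C *: Q z = (1 - e / e0)%:C *: z + (e / e0)%:C *: euler_step Q e0 0 z.
    rewrite euler_stepE subr0 scale1r scalerDr scalerA -rmorphM /= divfK ?gt_eqF//.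
    by rewrite addrA -scalerDl -rmorphD /= subrK scale1r.
  rewrite (le_trans (Z3 _ _))// !Z4 !cnorm_real ger0_norm// ger0_norm; last first.
    by rewrite divr_ge0// ltW.
  have := ler_wpM2l (divr_ge0 (ltW e1) (ltW e00)) (Z5 z).
  rewrite (_ : (1 - e * dl) * NZ z = (1 - e / e0) * NZ z + e / e0 * (r * NZ z)).
    by move=> ?; rewrite lerD2l.
  by rewrite /dl; field; rewrite gt_eqF.
have c10 : 0 <= ch * c3 by exact: mulr_ge0.
have c20 : 0 <= ch * cq by exact: mulr_ge0.
have [kap [es [kap1 es0 es1 H]]] := slow_fast_weight rho0 rho1 c10 c20 c30 dl0.
have kap0 : 0 < kap by exact: lt_le_trans kap1.
exists (Num.min es e0); first by rewrite lt_min es0.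
move=> e ep; rewrite le_min => /andP[ees ee0].
have e1 : e <= 1 by exact: le_trans es1.
have [th [th0 th1 thP]] := H e ep ees.
have hn0 := op_norm_ge0 h.
pose C0 := kap * (CX * (1 + op_norm h)) + CZ.
have C00 : 0 < C0 by rewrite addr_gt0// !mulr_gt0// ltr_wpDr.
exists ((1 + op_norm h) * C0), th; split => //.
  by rewrite mulr_gt0// ltr_wpDr.
move=> x z xS zS n.
pose xh m := x m - e%:C *: h (z m).
have zS' m : z m.+1 = (z m + e%:C *: Q (z m)) + G (c (xh m)).
  rewrite zS Qd /xh bopB bopZ -addrA; congr (_ + _).
  by rewrite -(bopZ G) -(bopD G); congr (G _); rewrite scalerDr [RHS]addrC addrA subrK.
have xS' m : xh m.+1 = A (xh m) - e%:C *: h (G (c (xh m)) + e%:C *: Q (z m)).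
  have -> : xh m.+1 = A (x m) + e%:C *: b (z m) - e%:C *: h (z m.+1).
    by rewrite /xh xS.
  have -> : z m.+1 = z m + (G (c (xh m)) + e%:C *: Q (z m)).
    by rewrite zS' -addrA; congr (_ + _); exact: addrC.
  rewrite (bopD h (z m)) scalerDr opprD addrA; congr (_ + _).
  rewrite [in RHS]/xh bopB bopZ -hb scalerBr -addrA; congr (_ + _).
  by rewrite addrAC subrr add0r.
pose Vn m := kap * NX (xh m) + NZ (z m).
have VS m : Vn m.+1 <= th * Vn m.
  apply: thP => //.
    rewrite xS' (le_trans (X3 _ _))// mulrDl -addrA; apply: lerD; first exact: X5.
    rewrite -scaleN1r X4 (_ : cnorm (-1) = 1); last first.
      by rewrite cnormN -[1]/(1%:C) cnorm_real normr1.
    rewrite mul1r X4 cnorm_real gtr0_norm// -!mulrA -mulrDr ler_pM2l//.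
    rewrite (le_trans (chP _))// [e * (ch * _)]mulrCA -mulrDr ler_wpM2l//.
    rewrite (le_trans (Z3 _ _))//; apply: lerD; first exact: c3P.
    by rewrite Z4 cnorm_real gtr0_norm// ler_pM2l.
  rewrite zS' (le_trans (Z3 _ _))// addrC; apply: lerD; first exact: c3P.
  exact: slow.
have Vn0 : Vn n <= th ^+ n * Vn 0%N.
  elim: n => [|n IH]; first by rewrite expr0 mul1r.
  by rewrite (le_trans (VS n))// exprS -mulrA ler_pM2l.
have V0 : Vn 0%N <= C0 * (rnorm (x 0%N) + rnorm (z 0%N)).
  have a0 := rnorm_ge0 (x 0%N); have b0 := rnorm_ge0 (z 0%N).
  rewrite /Vn /C0 mulrDl; apply: lerD; last first.
    by rewrite (le_trans (Z2 _))// ler_pM2l// lerDr.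
  rewrite -!mulrA ler_pM2l// (le_trans (X2 _))// ler_pM2l//.
  rewrite (le_trans (rnormB _ _))// rnormZr gtr0_norm//.
  have := op_normP h (z 0%N); have := mulr_ge0 hn0 a0; have := mulr_ge0 hn0 b0.
  have : e * rnorm (h (z 0%N)) <= rnorm (h (z 0%N)) by rewrite ler_piMl// rnorm_ge0.
  lra.
have xzV : rnorm (x n) + rnorm (z n) <= (1 + op_norm h) * Vn n.
  have a0 := NX0 (xh n); have b0 := NZ0 (z n).
  have h1 : rnorm (x n) <= rnorm (xh n) + e * rnorm (h (z n)).
    by rewrite -{1}(subrK (e%:C *: h (z n)) (x n)) (le_trans (rnormD _ _))// rnormZr gtr0_norm.
  have h2 : e * rnorm (h (z n)) <= op_norm h * NZ (z n).
    rewrite (@le_trans _ _ (rnorm (h (z n))))//; first by rewrite ler_piMl// rnorm_ge0.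
    by rewrite (le_trans (op_normP _ _))// ler_wpM2l.
  have h3 : NX (xh n) <= kap * NX (xh n) by rewrite ler_peMl.
  have h4 := X1 (xh n); have h5 := Z1 (z n).
  have := mulr_ge0 hn0 (mulr_ge0 (ltW kap0) a0).
  rewrite /Vn; lra.
apply: (le_trans xzV).
rewrite -!mulrA ler_pM2l ?ltr_wpDr// (le_trans Vn0)// mulrCA ler_pM2l ?exprn_gt0//.
Qed.

End power_contraction.

(** * Stability of the closed loop *)

Lemma bounded_op_comp (R : realType) (V W Z : normedModType R[i])
    (f : bounded_op W Z) (g : bounded_op V W) :
  exists T : bounded_op V Z, forall x, T x = f (g x).
Proof.
apply: (@bounded_op_of _ _ _ (fun x => f (g x)) (op_norm f * op_norm g)).
  by move=> a x y; rewrite (bopD g) (bopZ g) (bopD f) (bopZ f).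
by apply: bounded_by_comp; [exact: op_norm_ge0|exact: bounded_opW|exact: bounded_opW].
Qed.

Section monodromy.
Context {R : realType} {tau : R} {X : completeNormedModType R[i]}
  {U0 Ud0 Y0 : normedModType R[i]}.
Variable S : system X U0 Ud0 Y0.
Hypotheses (PS : periodic_system tau S) (tau_gt0 : 0 < tau).

Lemma sysU_iter (k : nat) x :
  sysU S (k%:R * tau) 0 x = iter k (sysU S tau 0) x.
Proof.
have [[U1 U2 _] _ _ _] := PS.
elim: k => [|k IH]; first by rewrite mul0r U1.
have kt : 0 <= k%:R * tau by rewrite mulr_ge0// ltW.
rewrite iterS -IH -(sysU_shift PS k (ltW tau_gt0)) add0r.
have -> : tau + k%:R * tau = k.+1%:R * tau by rewrite mulrS mulrDl mul1r.
by rewrite U2// ler_pM2r// ler_nat.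
Qed.

Lemma stable_monodromy_contraction : exponentially_stable S ->
  exists2 k : nat, (0 < k)%N & bounded_by (iter k (sysU S tau 0)) 2^-1.
Proof.
move=> [M [om [M0 om0 H]]]; have ot : 0 < om * tau by exact: mulr_gt0.
pose k := (Num.truncn (2 * M / (om * tau))).+1.
exists k => // x; rewrite -sysU_iter.
have kt : 0 <= k%:R * tau by rewrite mulr_ge0// ltW.
rewrite (le_trans (op_normP _ _))// ler_wpM2r ?rnorm_ge0//.
rewrite (le_trans (H _ _ kt))// subr0 mulNr expRN.
have h1 : 2 * M <= expR (om * (k%:R * tau)).
  rewrite (le_trans _ (expR_ge1Dx _))//.
  have : 2 * M / (om * tau) < k%:R by exact: truncnS_gt.
  rewrite ltr_pdivrMr// mulrCA mulrA => h.
  by apply: (le_trans (ltW h)); rewrite -mulrA mulrCA lerDr.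
rewrite ler_pdivrMr ?expR_gt0//.
by move: (expR _) h1 => y; lra.
Qed.

Lemma inv_id_sub_monodromyE (Inv : X -> X) :
  (forall x, Inv (x - sysU S tau 0 x) = x) ->
  (forall y, Inv y - sysU S tau 0 (Inv y) = y) ->
  inv_id_sub_monodromy tau S = Inv.
Proof.
move=> I1 I2; apply/funext => y; rewrite -{1}[y]I2 /inv_id_sub_monodromy.
rewrite (@pinvKV _ _ _ _ (fun x => x - sysU S tau 0 x))// ?in_setT//.
by move=> x x' _ _ /(congr1 Inv); rewrite !I1.
Qed.

(** The Green function term is the response to the initial state [(I - A)^-1 f], where
f is the state reached from 0 after one period: [Inv] and U(t,0) move through the
integral. So P u is the output over the period of the tau-periodic state that u
generates. *)
Lemma input_output_sampled (Inv : bounded_op X X) (u : L2 tau U0) :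
  inv_id_sub_monodromy tau S = Inv ->
  input_output S u =
  sample_output S (Inv (sample_state S 0 u (fun=> 0))) u (fun=> 0).
Proof.
move=> IE; congr (L2class tau _); apply/funext => t.
have fE s : forcing S (L2val u) (fun=> 0) s = sysB S s (L2val u s).
  by rewrite /forcing bop0 addr0.
have uL := L2val_L1on u.
have wL : L1on `[0, tau] (fun=> 0 : Ud0) by exact: L1on0.
have J0 := finite_itv (R := R) 0 tau true false.
have FI := forced_is PS uL wL.
have GI := bochner_integral_is_map (measurable_itv _) J0 (sysU S t 0)
  (bochner_integral_is_map (measurable_itv _) J0 Inv FI).
have E1 : bochner_integral `[0, tau]
    (fun s => green tau S t s (sysB S s (L2val u s))) =
    sysU S t 0 (Inv (forced S (L2val u) (fun=> 0) tau)).
  rewrite -(bochner_integralE (measurable_itv _) J0 GI).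
  by congr (bochner_integral _ _); apply/funext => s; rewrite /green IE /= fE.
have E2 : bochner_integral `[0, t]
    (fun s => sysU S t s (sysB S s (L2val u s))) = forced S (L2val u) (fun=> 0) t.
  by congr (bochner_integral _ _); apply/funext => s; rewrite fE.
rewrite E1 E2 /response /sample_state !mild_stateE (bop0 (sysU S tau 0)) add0r.
by rewrite (bopD (sysC S t)).
Qed.

Lemma sampled_operators :
  exists (b : bounded_op (L2 tau U0) X) (c : bounded_op X (L2 tau Y0))
    (d : bounded_op (L2 tau U0) (L2 tau Y0)),
  forall x u, sample_state S x u (fun=> 0) = sysU S tau 0 x + b u /\
    sample_output S x u (fun=> 0) = c x + d u.
Proof.
have w0 : L1on `[0, tau] (fun=> 0 : Ud0) by exact: L1on0.
have n0 : fine (L1norm `[0, tau] (fun=> 0 : Ud0)) = 0.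
  by rewrite /L1norm integral0_eq// => t _; rewrite rnorm0.
have [C C0 CP] := response_bound PS tau_gt0.
have ww (a : R[i]) : a *: (fun=> 0 : Ud0) + (fun=> 0 : Ud0) = (fun=> 0) :> (R -> Ud0).
  by apply/funext => t; rewrite fctE /= scaler0 addr0.
have bl : linear (fun u : L2 tau U0 => sample_state S 0 u (fun=> 0)).
  move=> a u u'; have := sample_state_linear PS tau_gt0 a 0 0 u u' w0 w0.
  by rewrite ww scaler0 addr0.
have cl : linear (fun x : X => sample_output S x (0 : L2 tau U0) (fun=> 0)).
  move=> a x x'; have := sample_output_linear PS tau_gt0 a x x' 0 0 w0 w0.
  by rewrite ww scaler0 addr0.
have dl : linear (fun u : L2 tau U0 => sample_output S (0 : X) u (fun=> 0)).
  move=> a u u'; have := sample_output_linear PS tau_gt0 a 0 0 u u' w0 w0.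
  by rewrite ww scaler0 addr0.
have bb : bounded_by (fun u : L2 tau U0 => sample_state S 0 u (fun=> 0)) C.
  move=> u; have [/(_ tau (ltW tau_gt0) (lexx _)) h _ _] := CP 0 u _ w0.
  by move: h; rewrite rnorm0 n0 add0r addr0.
have cb : bounded_by (fun x : X => sample_output S x (0 : L2 tau U0) (fun=> 0)) C.
  move=> x; have [_ _ h] := CP x 0 _ w0.
  by move: h; rewrite rnorm0 n0 !addr0.
have db : bounded_by (fun u : L2 tau U0 => sample_output S (0 : X) u (fun=> 0)) C.
  move=> u; have [_ _ h] := CP 0 u _ w0.
  by move: h; rewrite rnorm0 n0 add0r addr0.
have [b bE] := bounded_op_of bl bb.
have [c cE] := bounded_op_of cl cb.
have [d dE] := bounded_op_of dl db.
exists b, c, d => x u; rewrite bE cE dE.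
have := sample_state_linear PS tau_gt0 1 x 0 0 u w0 w0.
have := sample_output_linear PS tau_gt0 1 x 0 0 u w0 w0.
rewrite !ww !scale1r !addr0 add0r => -> ->; split => //; congr (_ + _).
rewrite /sample_state mild_stateE -[RHS]addr0; congr (_ + _).
have z0 := L2val_L1on (0 : L2 tau U0).
have := sample_state_linear PS tau_gt0 (-1) (0 : X) 0 0 (0 : L2 tau U0) w0 w0.
rewrite ww !scaler0 !addr0 scaleN1r addNr /sample_state mild_stateE.
by rewrite bop0 add0r.
Qed.

End monodromy.

Section stabilization.
Context {R : realType} {tau : R} {X : completeNormedModType R[i]}
  {U0 Ud0 Y0 : normedModType R[i]}.
Variable S : system X U0 Ud0 Y0.
Variables (G2 : bounded_op (L2 tau Y0) (L2 tau Y0)).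
Hypotheses (PS : periodic_system tau S) (tau_gt0 : 0 < tau).

(** Decay at the sampling times spreads over the periods by [response_bound]. The
factor [expR al] accounts for the time elapsed since the last sample. *)
Lemma sampled_decay_stable (K : bounded_op (L2 tau Y0) (L2 tau U0)) (C th : R) :
  0 < C -> 0 < th -> th < 1 ->
  (forall (x : nat -> X) (z : nat -> L2 tau Y0),
    (forall n, x n.+1 = sample_state S (x n) (K (z n)) (fun=> 0)) ->
    (forall n, z n.+1 = z n + G2 (sample_output S (x n) (K (z n)) (fun=> 0))) ->
    forall n, rnorm (x n) + rnorm (z n) <=
      C * th ^+ n * (rnorm (x 0%N) + rnorm (z 0%N))) ->
  closed_loop_stable S (Controller (id_op (L2 tau Y0)) G2 K).
Proof.
move=> C0 th0 th1 H.
have w0 : periodic_input (tau := tau) (fun=> 0 : Ud0) by exact: periodic_input0.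
have wL : L1on `[0, tau] (fun=> 0 : Ud0) by exact: L1on0.
have n0 : fine (L1norm `[0, tau] (fun=> 0 : Ud0)) = 0.
  by rewrite /L1norm integral0_eq// => t _; rewrite rnorm0.
have [B B0 BP] := response_bound PS tau_gt0.
have k0 := op_norm_ge0 K.
pose al := - ln th.
have al0 : 0 < al by rewrite oppr_gt0 ln_lt0// th0.
have thE (n : nat) : th ^+ n = expR (- al * n%:R).
  by rewrite /al opprK mulrC expRM_natl lnK.
clearbody al.
exists (B * (1 + op_norm K) * C * expR al), C, (al / tau), al; split.
  split => //; last exact: divr_gt0.
  by rewrite !mulr_gt0 ?expR_gt0// ltr_wpDr.
move=> x0 z0 x z y CL.
have sq0 : square_integrable `[0, tau] (fun=> 0 : Y0) by exact: square_integrable0.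
have [x00 xS zS] := closed_loop_sampled PS tau_gt0 w0 sq0 CL.
have L0 : L2class tau (fun=> 0 : Y0) = 0.
  apply: (etrans _ (subrr (L2class tau (fun=> 0 : Y0)))).
  rewrite -(L2classB sq0 sq0); congr (L2class tau _).
  by apply/funext => t; rewrite fctE /= subrr.
have D n : rnorm (x (n%:R * tau)) + rnorm (z n) <=
    C * th ^+ n * (rnorm x0 + rnorm z0).
  have [_ _ z00 _] := CL.
  have := H (fun n => x (n%:R * tau)) z xS _ n; rewrite mul0r x00 z00; apply.
  by move=> m; rewrite zS L0 subr0.
have N0 : 0 <= rnorm x0 + rnorm z0 by rewrite addr_ge0 ?rnorm_ge0.
split => [t t0|n]; last first.
  rewrite -thE (le_trans _ (D n))// lerDr; exact: rnorm_ge0.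
have [xt _ _ _] := CL.
pose n := Num.truncn (t / tau); pose s := t - n%:R * tau.
have /andP[nt tn] : n%:R <= t / tau < n.+1%:R.
  by apply: truncn_itv; rewrite divr_ge0// ltW.
have s0 : 0 <= s by rewrite subr_ge0 -ler_pdivlMr.
have st : s <= tau.
  by rewrite lerBlDr -[X in X + _]mul1r -mulrDl -mulrS -ler_pdivrMr// ltW.
have tE : t = n%:R * tau + s by rewrite addrC subrK.
have nt0 : 0 <= n%:R * tau by rewrite mulr_ge0// ltW.
have -> : x t = mild_state S (x (n%:R * tau)) (L2val (K (z n))) (fun=> 0) s.
  rewrite xt// {1}tE (mild_state_sampled _ PS tau_gt0 x0 z n w0 s0 st) -xt//.
have [/(_ s s0 st) h _ _] := BP (x (n%:R * tau)) (K (z n)) _ wL.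
apply: (le_trans h); rewrite n0 addr0.
have h2 := op_normP K (z n).
have h3 : rnorm (x (n%:R * tau)) + rnorm (K (z n)) <=
    (1 + op_norm K) * (C * th ^+ n * (rnorm x0 + rnorm z0)).
  rewrite (@le_trans _ _ ((1 + op_norm K) * (rnorm (x (n%:R * tau)) + rnorm (z n))))//.
    have := mulr_ge0 k0 (rnorm_ge0 (x (n%:R * tau))).
    by have := rnorm_ge0 (z n); lra.
  by rewrite ler_wpM2l// addr_ge0.
have h4 : th ^+ n <= expR al * expR (- (al / tau) * t).
  rewrite thE -expRD ler_expR.
  have : al * (t / tau) <= al * n.+1%:R by rewrite ler_pM2l// ltW.
  rewrite -natr1 mulrDr mulr1 mulrCA => h5.
  by rewrite !mulNr [al / tau * t]mulrC; move: h5; move: (t * _) (al * n%:R) => ? ?; lra.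
rewrite -!mulrA ler_pM2l// (le_trans h3)// ler_pM2l ?ltr_wpDr//.
by rewrite -!mulrA ler_pM2l// mulrA ler_wpM2r.
Qed.

(** The operator Q of the slow dynamics is [G2 P K0], so the spectral hypothesis is
the stability of its Euler steps. *)
Theorem integral_control_stable (K0 : bounded_op (L2 tau Y0) (L2 tau U0)) :
  exponentially_stable S ->
  spectrum (fun y => G2 (input_output S (K0 y))) `<=` [set l | complex.Re l < 0] ->
  exists2 es : R, 0 < es & forall eps, 0 < eps -> eps <= es ->
    closed_loop_stable S (Controller (id_op (L2 tau Y0)) G2 (eps%:C *: K0)).
Proof.
move=> St Sp.
have [k k0 Ak] := stable_monodromy_contraction PS tau_gt0 St.
have [Inv [I1 I2]] := power_contraction_inverse k0 Ak.
have IE := inv_id_sub_monodromyE I1 I2.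
have [b0 [c [d0 bcd]]] := sampled_operators PS tau_gt0.
have [b bE] := bounded_op_comp b0 K0.
have [d dE] := bounded_op_comp d0 K0.
have [h hE] := bounded_op_comp Inv b.
have [ch chE] := bounded_op_comp c h.
have [Q0 Q0E] := bounded_op_comp G2 (ch + d).
have QE y : Q0 y = G2 (input_output S (K0 y)).
  rewrite Q0E (input_output_sampled PS _ IE) (bcd _ (K0 y)).2 (bcd 0 (K0 y)).1.
  by rewrite bop0 add0r -dE -bE -hE -chE.
have [e0 [e00 [l l0 Tl]]] : exists e, 0 < e /\
    exists2 k, (0 < k)%N & bounded_by (iter k (euler_step Q0 e 0)) 2^-1.
  apply: spectrum_left_half_plane_contraction => m m0.
  have : ~ spectrum (fun y => G2 (input_output S (K0 y))) m.
    by move=> /Sp /=; rewrite ltNge m0.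
  move=> /contrapT; rewrite /resolvent_set /=.
  by under [X in boundedly_invertible X]eq_fun do rewrite -QE.
have hb z : h z - sysU S tau 0 (h z) = b z by rewrite hE I2.
have Qd z : Q0 z = G2 (c (h z) + d z) by rewrite Q0E -chE.
have [es es0 H] := slow_fast_contraction k0 Ak hb Qd e00 l0 Tl.
exists es => // eps ep epe.
have [C [th [C0 th0 th1 HH]]] := H _ ep epe.
apply: (sampled_decay_stable C0 th0 th1) => x z xS zS.
have KE y : (eps%:C *: K0) y = eps%:C *: K0 y by [].
apply: HH => n; first by rewrite xS (bcd _ _).1 KE (bopZ b0) bE.
by rewrite zS (bcd _ _).2 KE (bopZ d0) dE.
Qed.

End stabilization.

Theorem theorem3p4 (R : realType) (tau : R) (tau_gt0 : 0 < tau)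
    (X U0 Ud0 Y0 : completeNormedModType R[i])
    (U0_hilbert : hilbert_norm U0) (Ud0_hilbert : hilbert_norm Ud0)
    (Y0_hilbert : hilbert_norm Y0)
    (S : system X U0 Ud0 Y0) (S_periodic : periodic_system tau S)
    (S_stable : exponentially_stable S)
    (P_surj : forall y : L2 tau Y0, exists u : L2 tau U0,
      input_output S u = y)
    (yref : R -> Y0) (yref_periodic : periodic_signal tau yref)
    (q : nat) (wk : 'I_q -> R -> Ud0)
    (wk_periodic : forall k, periodic_signal tau (wk k))
    (G2 : bounded_op (L2 tau Y0) (L2 tau Y0))
    (G2_inv : boundedly_invertible G2)
    (K0 : bounded_op (L2 tau Y0) (L2 tau U0))
    (K0_spectrum : spectrum (fun y => G2 (input_output S (K0 y)))
      `<=` [set l | complex.Re l < 0]) :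
  exists eps_star : R, 0 < eps_star /\
    forall eps : R, 0 < eps -> eps <= eps_star ->
      solves_robust_output_regulation S
        (Controller (id_op (L2 tau Y0)) G2 (eps%:C *: K0)) yref wk.
Proof.
have [es es0 H] := integral_control_stable S_periodic tau_gt0 S_stable K0_spectrum.
exists es; split => // eps ep epe; have CS := H eps ep epe; split => //.
  exact: internal_model_tracking.
by move=> S' yref' wk' PS' yref'P wk'P CS'; exact: internal_model_tracking.
Qed.
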